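(* For $i,j\in[5]$ with $i\neq j$, let $\mathtt{A}$ and $\mathtt{B}$ be two 3-way arrays over a field $\mathbb{F}$, compatible with the $i$th action below, of length $L$. Then there is a polynomial-time computable function $f$ that takes $\mathtt{A}$ and $\mathtt{B}$ and outputs 3-way arrays $f(\mathtt{A})$ and $f(\mathtt{B})$ such that (1) the lengths of $f(\mathtt{A})$ and $f(\mathtt{B})$ are $O(L)$, and (2) $\mathtt{A}$ and $\mathtt{B}$ are in the same orbit under the $i$th action if and only if $f(\mathtt{A})$ and $f(\mathtt{B})$ are in the same orbit under the $j$th action. Furthermore: if $j=2$, $f$ can be chosen so that the frontal slices of $f(\mathtt{A}),f(\mathtt{B})$ are symmetric (or, alternatively, skew-symmetric); if $j=4$, so that $f(\mathtt{A}),f(\mathtt{B})$ are symmetric (or, alternatively, anti-symmetric) 3-way arrays; if $j=5$, so that $f(\mathtt{A}),f(\mathtt{B})$ are the structure constants of associative (or, alternatively, Lie) algebras. When $\mathbb{F}=\mathbb{F}_q$, these five orbit problems are equivalent under $q^{O(L)}$-time reductions.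
   Context: $\mathrm{T}(n\times m\times\ell,\mathbb{F})$ is the space of 3-way arrays $\mathtt{A}=(a_{i,j,k})$, $i\in[n],j\in[m],k\in[\ell]$; its length is $n+m+\ell$. For $(R,S,T)\in\mathrm{GL}(n,\mathbb{F})\times\mathrm{GL}(m,\mathbb{F})\times\mathrm{GL}(\ell,\mathbb{F})$, $(R,S,T)\cdot\mathtt{A}=\mathtt{A}'$ where $a'_{i,j,k}=\sum_{i',j',k'}r_{i,i'}s_{j,j'}t_{k,k'}a_{i',j',k'}$. The five actions: (1) $\mathrm{GL}(n)\times\mathrm{GL}(m)\times\mathrm{GL}(\ell)$ on $\mathrm{T}(n\times m\times\ell,\mathbb{F})$ by $(R,S,T)$; (2) $\mathrm{GL}(n)\times\mathrm{GL}(\ell)$ on $\mathrm{T}(n\times n\times\ell,\mathbb{F})$ by $(R,T)\mapsto(R,R,T)$; (3) $\mathrm{GL}(n)\times\mathrm{GL}(\ell)$ on $\mathrm{T}(n\times n\times\ell,\mathbb{F})$ by $(R,T)\mapsto(R,R^{-t},T)$ where $R^{-t}$ is the inverse transpose; (4) $\mathrm{GL}(n)$ on $\mathrm{T}(n\times n\times n,\mathbb{F})$ by $R\mapsto(R,R,R)$; (5) $\mathrm{GL}(n)$ on $\mathrm{T}(n\times n\times n,\mathbb{F})$ by $R\mapsto(R,R,R^{-t})$. An array is compatible with action $i$ if it has the shape required there. The frontal slices of $\mathtt{A}\in\mathrm{T}(n\times m\times\ell,\mathbb{F})$ are the matrices $A_k$ with $A_k(i,j)=a_{i,j,k}$. A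 cubical array is symmetric if $a_{i,j,k}$ is invariant under permuting the indices, anti-symmetric if permuting the indices by $\sigma$ multiplies it by $\mathrm{sgn}(\sigma)$. An array in $\mathrm{T}(n\times n\times n,\mathbb{F})$ records structure constants of an algebra with basis $b_1,\dots,b_n$ via $b_ib_j=\sum_k a_{i,j,k}b_k$. *)

(* Defs.v *)
From HB Require Import structures.
From mathcomp Require Import all_boot all_order all_fingroup all_algebra.

Set Implicit Arguments.
Unset Strict Implicit.
Unset Printing Implicit Defensive.

Import GRing.Theory.
Local Open Scope ring_scope.

(** * 3-way arrays and the five actions *)

Definition tensor (F : fieldType) (n m l : nat) : Type :=
  {ffun 'I_n * 'I_m * 'I_l -> F}.

Definition tensor_act (F : fieldType) (n m l : nat)
    (R : 'M[F]_n) (S : 'M[F]_m) (T : 'M[F]_l) (A : tensor F n m l) :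
    tensor F n m l :=
  [ffun x => \sum_(i < n) \sum_(j < m) \sum_(k < l)
     R x.1.1 i * S x.1.2 j * T x.2 k * A (i, j, k)].

(* An array of unspecified shape; needed because a reduction changes shapes. *)
Record array (F : fieldType) : Type := Array {
  dim1 : nat;
  dim2 : nat;
  dim3 : nat;
  entry : tensor F dim1 dim2 dim3 }.
Arguments Array {F dim1 dim2 dim3} _.

Definition dims (F : fieldType) (A : array F) : nat * nat * nat :=
  (dim1 A, dim2 A, dim3 A).

Definition len (F : fieldType) (A : array F) : nat :=
  (dim1 A + dim2 A + dim3 A)%N.

Inductive tensor_action : Type := Act1 | Act2 | Act3 | Act4 | Act5.

Definition compatible (F : fieldType) (a : tensor_action) (A : array F) :
    bool :=
  match a with
  | Act1 => true
  | Act2 | Act3 => dim1 A == dim2 A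
  | Act4 | Act5 => (dim1 A == dim2 A) && (dim2 A == dim3 A)
  end.

Inductive same_orbit (F : fieldType) :
    tensor_action -> array F -> array F -> Prop :=
| Orbit1 n m l (A : tensor F n m l) R S T of
    R \in unitmx & S \in unitmx & T \in unitmx :
    same_orbit Act1 (Array A) (Array (tensor_act R S T A))
| Orbit2 n l (A : tensor F n n l) R T of R \in unitmx & T \in unitmx :
    same_orbit Act2 (Array A) (Array (tensor_act R R T A))
| Orbit3 n l (A : tensor F n n l) R T of R \in unitmx & T \in unitmx :
    same_orbit Act3 (Array A) (Array (tensor_act R (invmx R)^T T A))
| Orbit4 n (A : tensor F n n n) R of R \in unitmx :
    same_orbit Act4 (Array A) (Array (tensor_act R R R A))
| Orbit5 n (A : tensor F n n n) R of R \in unitmx :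
    same_orbit Act5 (Array A) (Array (tensor_act R R (invmx R)^T A)).

(** * Special classes of arrays *)

Definition frontal_slice (F : fieldType) (n m l : nat) (A : tensor F n m l)
    (k : 'I_l) : 'M[F]_(n, m) :=
  \matrix_(i, j) A (i, j, k).

Inductive symmetric_slices (F : fieldType) : array F -> Prop :=
| SymmetricSlices n l (A : tensor F n n l) of
    (forall k, (frontal_slice A k)^T = frontal_slice A k) :
    symmetric_slices (Array A).

Inductive skew_symmetric_slices (F : fieldType) : array F -> Prop :=
| SkewSymmetricSlices n l (A : tensor F n n l) of
    (forall k, (frontal_slice A k)^T = - frontal_slice A k) :
    skew_symmetric_slices (Array A).

Definition entry3 (F : fieldType) (n : nat) (A : tensor F n n n)
    (x : 'I_3 -> 'I_n) : F :=
  A (x (inord 0), x (inord 1), x (inord 2)).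

Inductive symmetric_array (F : fieldType) : array F -> Prop :=
| SymmetricArray n (A : tensor F n n n) of
    (forall (s : 'S_3) (x : 'I_3 -> 'I_n), entry3 A (x \o s) = entry3 A x) :
    symmetric_array (Array A).

Inductive antisymmetric_array (F : fieldType) : array F -> Prop :=
| AntisymmetricArray n (A : tensor F n n n) of
    (forall (s : 'S_3) (x : 'I_3 -> 'I_n),
       entry3 A (x \o s) = (-1) ^+ s * entry3 A x) :
    antisymmetric_array (Array A).

(* The product on F^n with structure constants A in the standard basis. *)
Definition alg_mul (F : fieldType) (n : nat) (A : tensor F n n n)
    (x y : 'rV[F]_n) : 'rV[F]_n :=
  \row_k \sum_(i < n) \sum_(j < n) x 0 i * y 0 j * A (i, j, k).

Inductive associative_algebra (F : fieldType) : array F -> Prop :=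
| AssociativeAlgebra n (A : tensor F n n n) of associative (alg_mul A) :
    associative_algebra (Array A).

Inductive lie_algebra (F : fieldType) : array F -> Prop :=
| LieAlgebra n (A : tensor F n n n) of
    (forall x, alg_mul A x x = 0) &
    (forall x y z, alg_mul A x (alg_mul A y z) + alg_mul A y (alg_mul A z x)
                   + alg_mul A z (alg_mul A x y) = 0) :
    lie_algebra (Array A).

(** * Computation over a field

   Random-access while-programs in the Blum-Shub-Smale style: an integer memory
   (used for control and addressing) and a field memory, finitely many field
   constants per program, exact field operations and zero tests at unit cost.
   There is no integer multiplication, so that an integer computed in time t
   has O(t) more bits than the inputs and constants, and charging integer
   operations one unit is polynomially equivalent to charging their bit cost. *)

Local Close Scope ring_scope.

Inductive iexp : Type :=
| IConst of nat
| ILoad of iexp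
| IAdd of iexp & iexp
| ISub of iexp & iexp.

Inductive fexp (F : fieldType) : Type :=
| FConst of F
| FLoad of iexp
| FAdd of fexp F & fexp F
| FOpp of fexp F
| FMul of fexp F & fexp F
| FInv of fexp F.

Inductive test (F : fieldType) : Type :=
| ILe of iexp & iexp
| FZero of fexp F.

(* ISet and FSet take an address and a value. *)
Inductive prog (F : fieldType) : Type :=
| Skip
| ISet of iexp & iexp
| FSet of iexp & fexp F
| Seq of prog F & prog F
| If of test F & prog F & prog F
| While of test F & prog F.

Record state (F : fieldType) : Type := State {
  imem : nat -> nat;
  fmem : nat -> F }.

Fixpoint ieval (F : fieldType) (s : state F) (e : iexp) : nat :=
  match e with
  | IConst n => n
  | ILoad e1 => imem s (ieval s e1)
  | IAdd e1 e2 => (ieval s e1 + ieval s e2)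
  | ISub e1 e2 => (ieval s e1 - ieval s e2)
  end.

Fixpoint feval (F : fieldType) (s : state F) (e : fexp F) : F :=
  match e with
  | FConst c => c
  | FLoad e1 => fmem s (ieval s e1)
  | FAdd e1 e2 => (feval s e1 + feval s e2)%R
  | FOpp e1 => (- feval s e1)%R
  | FMul e1 e2 => (feval s e1 * feval s e2)%R
  | FInv e1 => ((feval s e1)^-1)%R
  end.

Definition teval (F : fieldType) (s : state F) (b : test F) : bool :=
  match b with
  | ILe e1 e2 => (ieval s e1 <= ieval s e2)
  | FZero e => feval s e == 0%R
  end.

Fixpoint icost (e : iexp) : nat :=
  match e with
  | IConst _ => 1
  | ILoad e1 => (icost e1).+1
  | IAdd e1 e2 | ISub e1 e2 => (icost e1 + icost e2).+1
  end.

Fixpoint fcost (F : fieldType) (e : fexp F) : nat :=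
  match e with
  | FConst _ => 1
  | FLoad e1 => (icost e1).+1
  | FAdd e1 e2 | FMul e1 e2 => (fcost e1 + fcost e2).+1
  | FOpp e1 | FInv e1 => (fcost e1).+1
  end.

Definition tcost (F : fieldType) (b : test F) : nat :=
  match b with
  | ILe e1 e2 => (icost e1 + icost e2).+1
  | FZero e => (fcost e).+1
  end.

(* [exec p s t s']: started in s, p halts in state s' after time t. *)
Inductive exec (F : fieldType) : prog F -> state F -> nat -> state F -> Prop :=
| ExecSkip s : exec (Skip F) s 1 s
| ExecISet s a e :
    exec (ISet F a e) s (icost a + icost e).+1
      (State [eta imem s with ieval s a |-> ieval s e] (fmem s))
| ExecFSet s a e :
    exec (FSet a e) s (icost a + fcost e).+1
      (State (imem s) [eta fmem s with ieval s a |-> feval s e])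
| ExecSeq p1 p2 s1 s2 s3 t1 t2 of
    exec p1 s1 t1 s2 & exec p2 s2 t2 s3 :
    exec (Seq p1 p2) s1 (t1 + t2) s3
| ExecIf b p1 p2 s s' t of
    exec (if teval s b then p1 else p2) s t s' :
    exec (If b p1 p2) s (tcost b + t) s'
| ExecWhileDone b p s of ~~ teval s b : exec (While b p) s (tcost b) s
| ExecWhileStep b p s1 s2 s3 t1 t2 of
    teval s1 b & exec p s1 t1 s2 & exec (While b p) s2 t2 s3 :
    exec (While b p) s1 (tcost b + t1 + t2) s3.

(* Arrays are stored one after the other: the dimensions in the integer memory,
   the entries in row-major order in the field memory. *)
Definition entries (F : fieldType) (A : array F) : seq F :=
  flatten [seq flatten [seq [seq entry A (i, j, k) | k <- enum 'I_(dim3 A)]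
                           | j <- enum 'I_(dim2 A)]
              | i <- enum 'I_(dim1 A)].

Definition code_dims (F : fieldType) (s : seq (array F)) : seq nat :=
  flatten [seq [:: dim1 A; dim2 A; dim3 A] | A <- s].

Definition code_entries (F : fieldType) (s : seq (array F)) : seq F :=
  flatten [seq entries A | A <- s].

Definition initial_state (F : fieldType) (s : seq (array F)) : state F :=
  State (nth 0 (code_dims s)) (nth 0%R (code_entries s)).

(* Memory beyond the output is arbitrary. *)
Definition stores (F : fieldType) (st : state F) (s : seq (array F)) : Prop :=
  [seq imem st r | r <- iota 0 (size (code_dims s))] = code_dims s /\
  [seq fmem st r | r <- iota 0 (size (code_entries s))] = code_entries s.

Definition computes_within (F : fieldType) (p : prog F) (t : nat)
    (input output : seq (array F)) : Prop :=
  exists t' st, [/\ exec p (initial_state input) t' st, (t' <= t)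
                  & stores st output].

(** * Reductions *)

(* The length is polynomially related to the number of entries (unless some
   dimension is 0), so running time is measured in the length. *)
Definition polytime_on (F : fieldType) (c : nat) (D : pred (array F))
    (f : array F -> array F) : Prop :=
  exists p : prog F, forall A, D A ->
    computes_within p (c * (len A).+1 ^ c) [:: A] [:: f A].

(* c bounds both the constant in O(L) and the polynomial running time. *)
Definition linear_length_reduction (F : fieldType) (c : nat)
    (i j : tensor_action) (f : array F -> array F) : Prop :=
  [/\ polytime_on c (compatible i) f,
      forall A, compatible i A ->
        compatible j (f A) /\ (len (f A) <= c * len A)
    & forall A B, compatible i A -> compatible i B -> dims A = dims B ->
        dims (f A) = dims (f B) /\
        (same_orbit i A B <-> same_orbit j (f A) (f B))].

Definition linear_length_reduction_into (F : fieldType) (c : nat)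
    (i j : tensor_action) (Q : array F -> Prop) : Prop :=
  exists2 f : array F -> array F,
    linear_length_reduction c i j f & forall A, compatible i A -> Q (f A).

(* The instances of the i-th orbit problem; yes-instances are the pairs
   satisfying [same_orbit i]. *)
Definition orbit_instance (F : fieldType) (i : tensor_action)
    (x : array F * array F) : bool :=
  [&& compatible i x.1, compatible i x.2 & dims x.1 == dims x.2].

Definition exptime_reducible (F : finFieldType) (c : nat)
    (i j : tensor_action) : Prop :=
  exists g : array F * array F -> array F * array F,
    (exists p : prog F, forall x, orbit_instance i x ->
       computes_within p (c * #|F| ^ (c * len x.1))
         [:: x.1; x.2] [:: (g x).1; (g x).2]) /\
    (forall x, orbit_instance i x ->
       orbit_instance j (g x) /\
       (same_orbit i x.1 x.2 <-> same_orbit j (g x).1 (g x).2)).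

(* Main.v *)
(** Write an array as the bilinear map taking [e_i], [e_j] to its (i, j)-tube;
    the group acts by [B x y = A (x R) (y S) T].  Every action is reduced to
    [Act1] and [Act1] to every action, by adjoining a few basis vectors:

    - a "mark" is an extra coordinate whose slices have a kernel of a different
      dimension from the slices avoiding it, so every group element between two
      constructed arrays is block triangular with respect to it;
    - comparing the identity matrices placed in the slices of the marks then
      relates the diagonal blocks of R, S and T as the action in question
      demands, up to scalars that can be absorbed;
    - zero padding is undone by [unit_completion]: if a block matrix
      [[P, Q], [R, S]] is invertible, so is P + Q M R for some M, and the
      correction Q M R does not change the action on the unpadded array.

    All entries of the constructed arrays are 0, 1 or entries of the input up to
    sign, selected by comparisons of affine index expressions.  Such
    "recipes" are closed under composition and are compiled to programs once
    and for all. *)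
From mathcomp Require Import all_boot all_order all_fingroup all_algebra.
From mathcomp Require Import zify ring.
Require Import Defs.

Set Implicit Arguments.
Unset Strict Implicit.
Unset Printing Implicit Defensive.

Import GRing.Theory.
Local Open Scope ring_scope.

(** * Linear algebra and bilinear maps *)

(** The input may be arbitrarily degenerate and the field arbitrary, possibly of characteristic 2 or
    with two elements, so nothing can be assumed generic, halved, or have a root extracted. Marks
    are therefore recognised by counting alone: [exists_kernel_vector] yields a nonzero padding
    vector as soon as the padding coordinates outnumber the linear conditions imposed, and sizes
    such as [n + 2], [l + n + 2] or [n + 1] are chosen to exceed the number of conditions whatever
    the input is. Where a block must act dually to another, a dual copy of the space is adjoined
    together with the form pairing both: every invertible g preserves this form through diag(g,
    g^{-t}), and conversely preservation of the form up to a scalar makes the block of an arbitrary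
    transformation invertible. Scalars are never removed by roots; each construction makes them
    occur to the same power on both sides of an equation, or next to a matrix that may be rescaled
    freely. *)

Lemma exists_kernel_vector (F : fieldType) (m n : nat) (M : 'M[F]_(m, n)) :
  (n < m)%N -> exists2 x : 'rV_m, x != 0 & x *m M = 0.
Proof.
move=> ltnm; have: kermx M != 0.
  by rewrite -mxrank_eq0 mxrank_ker subn_eq0 -ltnNge (leq_ltn_trans (rank_leq_col M)).
by case/rowV0Pn=> x /sub_kermxP xM nzx; exists x.
Qed.

Lemma unit_mx_of_injective (F : fieldType) (n : nat) (M : 'M[F]_n) :
  (forall x : 'rV_n, x *m M = 0 -> x = 0) -> M \in unitmx.
Proof.
move=> injM; rewrite -row_free_unit -kermx_eq0; apply/rowV0P => x.
by move/sub_kermxP/injM.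
Qed.

Lemma unitmx_injective (F : fieldType) (n m : nat) (M : 'M[F]_n) (x : 'M_(m, n)) :
  M \in unitmx -> x *m M = 0 -> x = 0.
Proof. by move=> uM xM; rewrite -(mulmxK uM x) xM mul0mx. Qed.

(* In a basis where P is an idempotent e, with c = 1 - e, the sum is
   (1 - e P' c) (1 - c P' e). *)
Lemma unit_completion (F : fieldType) (n k : nat) (P P' : 'M[F]_n)
    (Q Q' : 'M_(n, k)) (R R' : 'M_(k, n)) :
  P *m P' + Q *m R' = 1%:M -> P' *m P + Q' *m R = 1%:M ->
  exists M : 'M_k, P + Q *m M *m R \in unitmx.
Proof.
move=> eqr eql.
pose L := col_ebase P; pose U := row_ebase P; pose e : 'M[F]_n := pid_mx (\rank P).
have uL : L \in unitmx := col_ebase_unit P.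
have uU : U \in unitmx := row_ebase_unit P.
have defP : P = L *m e *m U by rewrite mulmx_ebase.
have ee : e *m e = e by rewrite mul_pid_mx !minnn (minn_idPr (rank_leq_row P)).
pose c := 1%:M - e; pose P1 := U *m P' *m L.
have ec : e *m c = 0 by rewrite mulmxBr mulmx1 ee subrr.
have ce : c *m e = 0 by rewrite mulmxBl mul1mx ee subrr.
have cc : c *m c = c by rewrite {2}/c mulmxBr mulmx1 ce subr0.
have ec1 : e + c = 1%:M by rewrite addrC subrK.
have unit_sq0 (y : 'M[F]_n) : y *m y = 0 -> 1%:M - y \in unitmx.
  move=> yy; have /mulmx1_unit[] // : (1%:M - y) *m (1%:M + y) = 1%:M.
  by rewrite mulmxDr mulmx1 mulmxBl mul1mx yy subr0 subrK.
clearbody L U e c.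
(* [L c U] alone would complete [P = L e U] to the unit [L U]. The equations [Q R' = 1 - P P'] and
   [Q' R = 1 - P' P] show that [Q M R] is [L c U] multiplied by these two factors, which changes the
   sum only by unipotent factors. *)
exists (R' *m (L *m c *m U) *m Q').
have ->: P + Q *m (R' *m (L *m c *m U) *m Q') *m R =
         L *m ((1%:M - e *m P1 *m c) *m (1%:M - c *m P1 *m e)) *m U.
  have -> : Q *m (R' *m (L *m c *m U) *m Q') *m R =
            (Q *m R') *m (L *m c *m U) *m (Q' *m R) by rewrite !mulmxA.
  have -> : Q *m R' = 1%:M - P *m P' by rewrite -eqr addrC addKr.
  have -> : Q' *m R = 1%:M - P' *m P by rewrite -eql addrC addKr.
  have -> : (1%:M - P *m P') *m (L *m c *m U) = L *m (c - e *m P1 *m c) *m U.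
    by rewrite mulmxBl mul1mx mulmxBr mulmxBl defP /P1 !mulmxA.
  have -> : L *m (c - e *m P1 *m c) *m U *m (1%:M - P' *m P) =
            L *m ((c - e *m P1 *m c) *m (c - c *m P1 *m e)) *m U.
    have cE : c - e *m P1 *m c = (c - e *m P1 *m c) *m c.
      by rewrite mulmxBl cc -!mulmxA cc.
    rewrite {1}cE -!mulmxA; congr (L *m _); congr (_ *m _).
    by rewrite !mulmxBr !mulmxBl mulmx1 defP /P1 !mulmxA.
  rewrite {1}defP -mulmxDl -mulmxDr; congr (_ *m _ *m _).
  have yc : e *m P1 *m c *m c = e *m P1 *m c by rewrite -mulmxA cc.
  have cz : c *m (c *m P1 *m e) = c *m P1 *m e by rewrite !mulmxA cc.
  rewrite !(mulmxBl _ _ (_ - _)) !(mulmxBr (e *m P1 *m c)) mul1mx mulmx1.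
  by rewrite mulmxBr cc cz yc !addrA ec1.
rewrite !unitmx_mul uL uU andbT /= !unit_sq0 //.
  by rewrite -!mulmxA (mulmxA e c) ec mul0mx !mulmx0.
by rewrite -!mulmxA (mulmxA c e) ce mul0mx !mulmx0.
Qed.

(** For b the inverse of a, the upper left blocks of [a b = 1] and [b a = 1] are the hypotheses of
    [unit_completion]. *)
Lemma unit_ulsubmx_completion (F : fieldType) (n k : nat) (a : 'M[F]_(n + k)) :
  a \in unitmx ->
  exists M, ulsubmx a + ursubmx a *m M *m dlsubmx a \in unitmx.
Proof.
move=> ua; move: (invmx a) (mulVmx ua) (mulmxV ua) => b.
rewrite -{1 2}[a]submxK -{1 2}[b]submxK !mulmx_block (@scalar_mx_block _ n k).
move=> /eq_block_mx[eql _ _ _] /eq_block_mx[eqr _ _ _].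
exact: unit_completion eqr eql.
Qed.

Lemma unit_drsubmx_completion (F : fieldType) (n k : nat) (a : 'M[F]_(n + k)) :
  a \in unitmx ->
  exists M, drsubmx a + dlsubmx a *m M *m ursubmx a \in unitmx.
Proof.
move=> ua; move: (invmx a) (mulVmx ua) (mulmxV ua) => b.
rewrite -{1 2}[a]submxK -{1 2}[b]submxK !mulmx_block (@scalar_mx_block _ n k).
move=> /eq_block_mx[_ _ _ eql] /eq_block_mx[_ _ _ eqr].
by apply: unit_completion; [rewrite addrC; exact: eqr|rewrite addrC; exact: eql].
Qed.

Section BilinearMap.
Variable F : fieldType.
Implicit Types n m l : nat.

Definition bilin n m l (A : tensor F n m l) (x : 'rV[F]_n) (y : 'rV[F]_m) :
  'rV[F]_l := \row_k \sum_(i < n) \sum_(j < m) x 0 i * y 0 j * A (i, j, k).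

Lemma bilinDl n m l (A : tensor F n m l) x x' y :
  bilin A (x + x') y = bilin A x y + bilin A x' y.
Proof.
apply/rowP => k; rewrite !mxE -big_split /=; apply: eq_bigr => i _.
rewrite -big_split /=; apply: eq_bigr => j _; rewrite !mxE; ring.
Qed.

Lemma bilinDr n m l (A : tensor F n m l) x y y' :
  bilin A x (y + y') = bilin A x y + bilin A x y'.
Proof.
apply/rowP => k; rewrite !mxE -big_split /=; apply: eq_bigr => i _.
rewrite -big_split /=; apply: eq_bigr => j _; rewrite !mxE; ring.
Qed.

Lemma bilinZl n m l (A : tensor F n m l) c x y :
  bilin A (c *: x) y = c *: bilin A x y.
Proof.
apply/rowP => k; rewrite !mxE mulr_sumr; apply: eq_bigr => i _.
rewrite mulr_sumr; apply: eq_bigr => j _; rewrite !mxE; ring.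
Qed.

Lemma bilinZr n m l (A : tensor F n m l) c x y :
  bilin A x (c *: y) = c *: bilin A x y.
Proof.
apply/rowP => k; rewrite !mxE mulr_sumr; apply: eq_bigr => i _.
rewrite mulr_sumr; apply: eq_bigr => j _; rewrite !mxE; ring.
Qed.

Lemma bilin0l n m l (A : tensor F n m l) y : bilin A 0 y = 0.
Proof. by rewrite -(scale0r 0) bilinZl scale0r. Qed.

Lemma bilin0r n m l (A : tensor F n m l) x : bilin A x 0 = 0.
Proof. by rewrite -(scale0r 0) bilinZr scale0r. Qed.

Lemma bilinNl n m l (A : tensor F n m l) x y : bilin A (- x) y = - bilin A x y.
Proof. by rewrite -scaleN1r bilinZl scaleN1r. Qed.

Lemma bilin_delta n m l (A : tensor F n m l) i j k :
  bilin A (delta_mx 0 i) (delta_mx 0 j) 0 k = A (i, j, k).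
Proof.
rewrite mxE (bigD1 i) //= [X in _ + X]big1 => [|i' nei]; last first.
  by rewrite big1 // => j' _; rewrite !mxE (negPf nei) andbF !mul0r.
rewrite addr0 (bigD1 j) //= [X in _ + X]big1 => [|j' nej]; last first.
  by rewrite !mxE (negPf nej) andbF mulr0 mul0r.
by rewrite !mxE !eqxx !mul1r addr0.
Qed.

Lemma bilin_inj n m l (A B : tensor F n m l) :
  (forall x y, bilin A x y = bilin B x y) -> A = B.
Proof. by move=> eqAB; apply/ffunP => -[[i j] k]; rewrite -!bilin_delta eqAB. Qed.

Definition rect_act n n' m m' l l' (R : 'M[F]_(n', n)) (S : 'M[F]_(m', m))
    (T : 'M[F]_(l', l)) (A : tensor F n m l) : tensor F n' m' l' :=
  [ffun x => \sum_(i < n) \sum_(j < m) \sum_(k < l)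
     R x.1.1 i * S x.1.2 j * T x.2 k * A (i, j, k)].

Lemma bilin_rect_act n n' m m' l l' (R : 'M[F]_(n', n)) (S : 'M[F]_(m', m))
    (T : 'M[F]_(l', l)) (A : tensor F n m l) x y :
  bilin (rect_act R S T A) x y = bilin A (x *m R) (y *m S) *m T^T.
Proof.
apply/rowP => k; rewrite !mxE.
under eq_bigr => i _ do under eq_bigr => j _ do
  (rewrite ffunE /= mulr_sumr; under eq_bigr => i' _ do
    (rewrite mulr_sumr; under eq_bigr => j' _ do rewrite mulr_sumr)).
under [RHS]eq_bigr => k' _ do
  (rewrite !mxE mulr_suml; under eq_bigr => i' _ do
    (rewrite !mxE mulr_suml; under eq_bigr => j' _ do
      (rewrite !mxE !mulr_suml; under eq_bigr => i _ do
        (rewrite !mulr_sumr !mulr_suml)))).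
under eq_bigr => i _ do (rewrite exchange_big; under eq_bigr => i' _ do
  (rewrite exchange_big; under eq_bigr => j' _ do rewrite exchange_big)).
rewrite exchange_big; under eq_bigr => i' _ do
  (rewrite exchange_big; under eq_bigr => j' _ do rewrite exchange_big).
rewrite [RHS]exchange_big; under [RHS]eq_bigr => i' _ do rewrite exchange_big.
apply: eq_bigr => i' _; apply: eq_bigr => j' _; apply: eq_bigr => k' _.
apply: eq_bigr => i _; apply: eq_bigr => j _; ring.
Qed.

Lemma bilin_act n m l R S T (A : tensor F n m l) x y :
  bilin (tensor_act R S T A) x y = bilin A (x *m R) (y *m S) *m T^T.
Proof. exact: bilin_rect_act. Qed.

End BilinearMap.

(** * Orbits in terms of bilinear maps *)

Section Orbits.
Variable F : fieldType.
Implicit Types n m l : nat.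

(* Entry at arbitrary natural indices, 0 outside the array. *)
Definition aget (A : array F) (a b c : nat) : F :=
  match insub a, insub b, insub c with
  | Some i, Some j, Some k => entry A (i, j, k)
  | _, _, _ => 0
  end.

Lemma aget_ord (A : array F) (i : 'I_(dim1 A)) (j : 'I_(dim2 A))
    (k : 'I_(dim3 A)) : aget A i j k = entry A (i, j, k).
Proof. by rewrite /aget !valK. Qed.

Lemma aget_out (A : array F) a b c :
  ~~ [&& a < dim1 A, b < dim2 A & c < dim3 A]%N -> aget A a b c = 0.
Proof.
rewrite /aget; case: insubP => [i -> _|//]; case: insubP => [j -> _|//].
by case: insubP => [k -> _|//].
Qed.

(** Entries are compared through [aget], at natural indices, which avoids inverting an equality
    between dependent records. *)
Lemma Array_inj n m l (A B : tensor F n m l) : Array A = Array B -> A = B.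
Proof.
move=> eqAB; apply/ffunP => -[[i j] k].
have /= <- := @aget_ord (Array A) i j k.
by rewrite eqAB (@aget_ord (Array B) i j k).
Qed.

(** On values of the bilinear map the third matrix acts from the right by its transpose, so the
    witness is [T^T]; transposition permutes the invertible matrices. *)
Lemma same_orbit1P n m l (A B : tensor F n m l) :
  same_orbit Act1 (Array A) (Array B) <->
  exists R S T, [/\ R \in unitmx, S \in unitmx, T \in unitmx &
    forall x y, bilin B x y = bilin A (x *m R) (y *m S) *m T].
Proof.
split=> [|[R [S [T [uR uS uT eqB]]]]].
  move eqX: (Array A) => X; move eqY: (Array B) => Y; move ea: Act1 => a orb.
  case: orb ea eqX eqY => //= n' m' l' A' R S T uR uS uT _ eqX eqY.
  have [[en em] el] := (congr1 (@dim1 F) eqX, congr1 (@dim2 F) eqX, congr1 (@dim3 F) eqX).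
  simpl in en, em, el; subst n' m' l'.
  move: eqX eqY => /Array_inj-> /Array_inj->.
  by exists R, S, T^T; rewrite unitmx_tr; split=> // x y; rewrite bilin_act.
have -> : B = tensor_act R S T^T A.
  by apply: bilin_inj => x y; rewrite bilin_act trmxK.
by constructor; rewrite ?unitmx_tr.
Qed.

Lemma same_orbit2P n l (A B : tensor F n n l) :
  same_orbit Act2 (Array A) (Array B) <->
  exists R T, [/\ R \in unitmx, T \in unitmx &
    forall x y, bilin B x y = bilin A (x *m R) (y *m R) *m T].
Proof.
split=> [|[R [T [uR uT eqB]]]].
  move eqX: (Array A) => X; move eqY: (Array B) => Y; move ea: Act2 => a orb.
  case: orb ea eqX eqY => //= n' l' A' R T uR uT _ eqX eqY.
  have [en el] := (congr1 (@dim1 F) eqX, congr1 (@dim3 F) eqX).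
  simpl in en, el; subst n' l'.
  move: eqX eqY => /Array_inj-> /Array_inj->.
  by exists R, T^T; rewrite unitmx_tr; split=> // x y; rewrite bilin_act.
have -> : B = tensor_act R R T^T A.
  by apply: bilin_inj => x y; rewrite bilin_act trmxK.
by constructor; rewrite ?unitmx_tr.
Qed.

Lemma same_orbit3P n l (A B : tensor F n n l) :
  same_orbit Act3 (Array A) (Array B) <->
  exists R T, [/\ R \in unitmx, T \in unitmx &
    forall x y, bilin B x y = bilin A (x *m R) (y *m (invmx R)^T) *m T].
Proof.
split=> [|[R [T [uR uT eqB]]]].
  move eqX: (Array A) => X; move eqY: (Array B) => Y; move ea: Act3 => a orb.
  case: orb ea eqX eqY => //= n' l' A' R T uR uT _ eqX eqY.
  have [en el] := (congr1 (@dim1 F) eqX, congr1 (@dim3 F) eqX).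
  simpl in en, el; subst n' l'.
  move: eqX eqY => /Array_inj-> /Array_inj->.
  by exists R, T^T; rewrite unitmx_tr; split=> // x y; rewrite bilin_act.
have -> : B = tensor_act R (invmx R)^T T^T A.
  by apply: bilin_inj => x y; rewrite bilin_act trmxK.
by constructor; rewrite ?unitmx_tr.
Qed.

Lemma same_orbit4P n (A B : tensor F n n n) :
  same_orbit Act4 (Array A) (Array B) <->
  exists2 R, R \in unitmx &
    forall x y, bilin B x y = bilin A (x *m R) (y *m R) *m R^T.
Proof.
split=> [|[R uR eqB]].
  move eqX: (Array A) => X; move eqY: (Array B) => Y; move ea: Act4 => a orb.
  case: orb ea eqX eqY => //= n' A' R uR _ eqX eqY.
  have en := congr1 (@dim1 F) eqX; simpl in en; subst n'.
  move: eqX eqY => /Array_inj-> /Array_inj->.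
  by exists R => // x y; rewrite bilin_act.
have -> : B = tensor_act R R R A by apply: bilin_inj => x y; rewrite bilin_act.
by constructor.
Qed.

(** The two transposes in the third place cancel: R is an isomorphism from the algebra of B to that
    of A. *)
Lemma same_orbit5P n (A B : tensor F n n n) :
  same_orbit Act5 (Array A) (Array B) <->
  exists2 R, R \in unitmx &
    forall x y, bilin B x y = bilin A (x *m R) (y *m R) *m invmx R.
Proof.
split=> [|[R uR eqB]].
  move eqX: (Array A) => X; move eqY: (Array B) => Y; move ea: Act5 => a orb.
  case: orb ea eqX eqY => //= n' A' R uR _ eqX eqY.
  have en := congr1 (@dim1 F) eqX; simpl in en; subst n'.
  move: eqX eqY => /Array_inj-> /Array_inj->.
  by exists R => // x y; rewrite bilin_act trmxK.
have -> : B = tensor_act R R (invmx R)^T A.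
  by apply: bilin_inj => x y; rewrite bilin_act trmxK.
by constructor.
Qed.

Definition transp13 n m l (A : tensor F n m l) : tensor F l m n :=
  [ffun x => A (x.2, x.1.2, x.1.1)].

(** Both sides are the trilinear form with coefficients A, evaluated at x, y and z. *)
Lemma transp13_adj n m l (A : tensor F n m l) x y z :
  bilin A x y *m z^T = bilin (transp13 A) z y *m x^T.
Proof.
apply/matrixP => i0 j0; rewrite !ord1 !mxE.
under eq_bigr => k _ do (rewrite !mxE mulr_suml; under eq_bigr => i _ do rewrite mulr_suml).
under [RHS]eq_bigr => k _ do (rewrite !mxE mulr_suml; under eq_bigr => i _ do rewrite mulr_suml).
rewrite exchange_big; apply: eq_bigr => i _; apply: eq_bigr => k _.
by apply: eq_bigr => j _; rewrite !ffunE /=; ring.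
Qed.

Lemma dot_inj m (u v : 'rV[F]_m) :
  (forall w : 'rV_m, u *m w^T = v *m w^T) -> u = v.
Proof.
move=> eq_uv; apply/rowP => i; have /matrixP/(_ 0 0) := eq_uv (delta_mx 0 i).
by rewrite trmx_delta -!colE !mxE.
Qed.

Lemma same_orbit1_refl n m l (A : tensor F n m l) :
  same_orbit Act1 (Array A) (Array A).
Proof.
apply/same_orbit1P; exists 1%:M, 1%:M, 1%:M.
by rewrite !unitmx1; split=> // x y; rewrite !mulmx1.
Qed.

(** With directions 1 and 3 exchanged, the array is a linear family of endomorphisms of F^n with
    parameter w. The matrices R and R^{-t} merge into the single [g = R^{-t}], and action 3 becomes
    simultaneous conjugation together with a change T of the parameter. *)
Lemma same_orbit3_transp n l (A B : tensor F n n l) :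
  same_orbit Act3 (Array A) (Array B) <->
  exists g T, [/\ g \in unitmx, T \in unitmx & forall w y,
    bilin (transp13 B) w y *m g = bilin (transp13 A) (w *m T) (y *m g)].
Proof.
rewrite same_orbit3P; split=> [[R [T [uR uT eqB]]]|[g [T [ug uT eqB]]]].
  exists (invmx R)^T, T^T; rewrite !unitmx_tr unitmx_inv; split=> // w y.
  apply: dot_inj => z; rewrite -[RHS]transp13_adj -mulmxA -trmx_mul -transp13_adj.
  by rewrite eqB mulmxKV // -mulmxA -{1}[T]trmxK -trmx_mul.
exists (invmx g)^T, T^T; rewrite !unitmx_tr unitmx_inv; split=> // x y.
apply: dot_inj => z; rewrite [(invmx _^T)^T]trmx_inv trmxK invmxK.
rewrite -mulmxA -trmx_mul [RHS]transp13_adj -eqB trmx_mul trmxK.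
by rewrite mulmxA mulmxK // -transp13_adj.
Qed.

End Orbits.

(** * Recipes *)

(* Variables 0, 1, 2 stand for the dimensions of the input array and
   3, 4, 5 for the indices of the output entry. *)
Inductive nexp : Type :=
| NVar of nat
| NConst of nat
| NAdd of nexp & nexp
| NSub of nexp & nexp.

Inductive ent : Type :=
| EZero
| EOne
| EOpp of ent
| EAdd of ent & ent
| EGet of nexp & nexp & nexp
| EIf of nexp & nexp & ent & ent.

Fixpoint neval (v : nat -> nat) (e : nexp) : nat :=
  match e with
  | NVar x => v x
  | NConst n => n
  | NAdd a b => (neval v a + neval v b)%N
  | NSub a b => (neval v a - neval v b)%N
  end.

Fixpoint eeval (F : fieldType) (get : nat -> nat -> nat -> F) (v : nat -> nat)
    (e : ent) : F :=
  match e with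
  | EZero => 0
  | EOne => 1
  | EOpp e1 => - eeval get v e1
  | EAdd e1 e2 => eeval get v e1 + eeval get v e2
  | EGet a b c => get (neval v a) (neval v b) (neval v c)
  | EIf a b e1 e2 =>
      if (neval v a <= neval v b)%N then eeval get v e1 else eeval get v e2
  end.

Record recipe : Type := Recipe {
  rdim1 : nexp;
  rdim2 : nexp;
  rdim3 : nexp;
  rent : ent }.

Definition dimv (d1 d2 d3 : nat) : nat -> nat := nth 0%N [:: d1; d2; d3].
Definition entv (d1 d2 d3 i j k : nat) : nat -> nat :=
  nth 0%N [:: d1; d2; d3; i; j; k].

Definition ntens (F : fieldType) n m l (T : nat -> nat -> nat -> F) :
  tensor F n m l := [ffun x : 'I_n * 'I_m * 'I_l => T x.1.1 x.1.2 x.2].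

Definition build (F : fieldType) (C : recipe) (A : array F) : array F :=
  let v := dimv (dim1 A) (dim2 A) (dim3 A) in
  Array (ntens (neval v (rdim1 C)) (neval v (rdim2 C)) (neval v (rdim3 C))
    (fun i j k => eeval (aget A) (entv (dim1 A) (dim2 A) (dim3 A) i j k) (rent C))).

Fixpoint nsubst (s : nat -> nexp) (e : nexp) : nexp :=
  match e with
  | NVar x => s x
  | NConst n => NConst n
  | NAdd a b => NAdd (nsubst s a) (nsubst s b)
  | NSub a b => NSub (nsubst s a) (nsubst s b)
  end.

Fixpoint esubst (s : nat -> nexp) (g : nexp -> nexp -> nexp -> ent) (e : ent) :
    ent :=
  match e with
  | EZero => EZero
  | EOne => EOne
  | EOpp e1 => EOpp (esubst s g e1)
  | EAdd e1 e2 => EAdd (esubst s g e1) (esubst s g e2)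
  | EGet a b c => g (nsubst s a) (nsubst s b) (nsubst s c)
  | EIf a b e1 e2 => EIf (nsubst s a) (nsubst s b) (esubst s g e1) (esubst s g e2)
  end.

Lemma neval_subst s v e : neval v (nsubst s e) = neval (fun x => neval v (s x)) e.
Proof. by elim: e => //= a -> b ->. Qed.

Lemma eeval_subst (F : fieldType) (get get' : nat -> nat -> nat -> F) s g v v' e :
  (forall x, neval v (s x) = v' x) ->
  (forall a b c, eeval get v (g a b c) = get' (neval v a) (neval v b) (neval v c)) ->
  eeval get v (esubst s g e) = eeval get' v' e.
Proof.
move=> eq_v eq_g.
have eq_n a : neval v (nsubst s a) = neval v' a.
  by rewrite neval_subst; elim: a => //= a -> b ->.
elim: e => //= [e ->|e1 -> e2 ->|a b c|a b e1 -> e2 ->] //; last by rewrite !eq_n.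
by rewrite eq_g !eq_n.
Qed.

Definition dims_then (C : recipe) (rest : nat -> nexp) (x : nat) : nexp :=
  match x with
  | 0 => rdim1 C
  | 1 => rdim2 C
  | 2 => rdim3 C
  | _ => rest x
  end.

Definition indices_then (a b c : nexp) (x : nat) : nexp :=
  match x with
  | 3 => a
  | 4 => b
  | 5 => c
  | _ => NVar x
  end.

(** Reading an entry of an intermediate array means recomputing it from the original one. The three
    tests reproduce the value 0 that [aget] returns outside the bounds. *)
Definition get_of (C : recipe) (a b c : nexp) : ent :=
  EIf (NAdd a (NConst 1)) (rdim1 C)
    (EIf (NAdd b (NConst 1)) (rdim2 C)
       (EIf (NAdd c (NConst 1)) (rdim3 C)
          (esubst (indices_then a b c) EGet (rent C)) EZero) EZero) EZero.

(** Dimensions get evaluated both under [dimv] and under [entv], which are guaranteed to agree only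
    on the variables 0, 1 and 2. *)
Fixpoint dims_only (e : nexp) : bool :=
  match e with
  | NVar x => (x < 3)%N
  | NConst _ => true
  | NAdd a b | NSub a b => dims_only a && dims_only b
  end.

Definition wf (C : recipe) : bool :=
  [&& dims_only (rdim1 C), dims_only (rdim2 C) & dims_only (rdim3 C)].

Definition compose (C2 C1 : recipe) : recipe :=
  let s := dims_then C1 NVar in
  Recipe (nsubst s (rdim1 C2)) (nsubst s (rdim2 C2)) (nsubst s (rdim3 C2))
    (esubst s (get_of C1) (rent C2)).

Lemma neval_dims_only v v' e :
  dims_only e -> (forall x, (x < 3)%N -> v x = v' x) -> neval v e = neval v' e.
Proof.
move=> + eq_v; elim: e => [x lt3|//|a IHa b IHb|a IHa b IHb] /=; first exact: eq_v.
  by case/andP=> da db; rewrite IHa ?IHb.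
by case/andP=> da db; rewrite IHa ?IHb.
Qed.

Lemma neval_dims_then C v v' e :
  dims_only e -> (forall x, (x < 3)%N -> neval v (dims_then C NVar x) = v' x) ->
  neval v (nsubst (dims_then C NVar) e) = neval v' e.
Proof. by move=> de eq_v; rewrite neval_subst; exact: neval_dims_only. Qed.

Lemma aget_build (F : fieldType) C (A : array F) a b c :
  aget (build C A) a b c =
  if (a < dim1 (build C A))%N then
    if (b < dim2 (build C A))%N then
      if (c < dim3 (build C A))%N then
        eeval (aget A) (entv (dim1 A) (dim2 A) (dim3 A) a b c) (rent C)
      else 0
    else 0
  else 0.
Proof.
case: ltnP => a_in; last by rewrite aget_out // ltnNge a_in.
case: ltnP => b_in; last by rewrite aget_out // ltnNge (leq_gtF b_in) andbF.
case: ltnP => c_in; last by rewrite aget_out // !ltnNge c_in !andbF.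
by have /= -> := @aget_ord F (build C A) (Ordinal a_in) (Ordinal b_in) (Ordinal c_in);
  rewrite ffunE.
Qed.

Lemma build_compose (F : fieldType) C2 C1 (A : array F) :
  wf C1 -> wf C2 -> build (compose C2 C1) A = build C2 (build C1 A).
Proof.
case/and3P=> w1 w2 w3 /and3P[w1' w2' w3'].
have eq_d e : dims_only e ->
    neval (dimv (dim1 A) (dim2 A) (dim3 A)) (nsubst (dims_then C1 NVar) e) =
    neval (dimv (dim1 (build C1 A)) (dim2 (build C1 A)) (dim3 (build C1 A))) e.
  by move=> de; apply: neval_dims_then => // -[|[|[|]]].
rewrite {1}/build /= !eq_d // /build /=; congr Array.
apply/ffunP => -[[i j] k]; rewrite !ffunE /=.
have eq_e e i' j' k' : dims_only e ->
    neval (entv (dim1 A) (dim2 A) (dim3 A) i' j' k') e =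
    neval (dimv (dim1 A) (dim2 A) (dim3 A)) e.
  by move=> de; apply: neval_dims_only => // -[|[|[|]]].
have eqE := (eq_e _ i j k w1, eq_e _ i j k w2, eq_e _ i j k w3).
apply: eeval_subst => [[|[|[|[|[|[|x]]]]]]|a b c] /=; rewrite ?eqE //.
rewrite -/(build C1 A) (aget_build C1 A) /= !addn1.
do 3![case: ifP => // _].
by apply: eeval_subst => // -[|[|[|[|[|[|x]]]]]].
Qed.

(** * Placing small arrays inside larger ones *)

Section Placement.
Variable F : fieldType.
Implicit Types (n m l d o : nat) (T : nat -> nat -> nat -> F).

(** The lower bounds are tested because subtraction is truncated. The upper bounds are left to [T],
    which [bilin_place] requires to vanish outside its dimensions. *)
Definition place (o1 o2 o3 : nat) T (i j k : nat) : F :=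
  if (o1 <= i)%N then
    if (o2 <= j)%N then
      if (o3 <= k)%N then T (i - o1)%N (j - o2)%N (k - o3)%N else 0
    else 0
  else 0.

(** As a right factor it cuts out d coordinates from position o on; its transpose inserts d
    coordinates there. *)
Definition shift_mx n d o : 'M[F]_(n, d) := \matrix_(i, j) (i == (o + j)%N :> nat)%:R.

Lemma sum_shift n d o (i : 'I_n) (G : nat -> F) :
  (forall a, (d <= a)%N -> G a = 0) ->
  \sum_(j < d) shift_mx n d o i j * G j = if (o <= i)%N then G (i - o)%N else 0.
Proof.
move=> G0; case: leqP => leoi; last first.
  by rewrite big1 // => j _; rewrite mxE ltn_eqF ?mul0r // ltn_addr.
have [lt_d|ge_d] := ltnP (i - o) d; last first.
  rewrite G0 // big1 // => j _; rewrite mxE eqn_leq (_ : (i <= o + j)%N = false) ?mul0r //.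
  by have := ltn_ord j; lia.
rewrite (bigD1 (Ordinal lt_d)) //= big1 => [|j nej]; last first.
  rewrite mxE (_ : (_ == _ :> nat) = false) ?mul0r //.
  by apply/negbTE; apply: contra nej => /eqP eqi; apply/eqP/val_inj => /=; lia.
by rewrite mxE /= subnKC // eqxx mul1r addr0.
Qed.

(** A placed array is the image of the small one under the rectangular matrices of three coordinate
    inclusions, so [bilin_rect_act] computes its bilinear map. *)
Lemma bilin_place n m l d1 d2 d3 o1 o2 o3 T x y :
  (forall a b c, ~~ [&& a < d1, b < d2 & c < d3]%N -> T a b c = 0) ->
  bilin (ntens n m l (place o1 o2 o3 T)) x y =
  bilin (ntens d1 d2 d3 T) (x *m shift_mx n d1 o1) (y *m shift_mx m d2 o2) *m
    (shift_mx l d3 o3)^T.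
Proof.
move=> T0; rewrite -bilin_rect_act; congr (bilin _ x y).
apply/ffunP => -[[i j] k]; rewrite !ffunE /= /place; symmetry.
under eq_bigr => a _ do under eq_bigr => b _ do
  (under eq_bigr => c _ do rewrite !ffunE /= -!mulrA; rewrite -!mulr_sumr).
under eq_bigr => a _ do rewrite -mulr_sumr.
rewrite (sum_shift o1 i (G := fun a => \sum_(b < d2) shift_mx m d2 o2 j b *
   \sum_(c < d3) shift_mx l d3 o3 k c * T a b c)); last first.
  move=> a lea; rewrite big1 // => b _; rewrite big1 ?mulr0 // => c _.
  by rewrite T0 ?mulr0 // ltnNge lea.
case: ifP => // _.
rewrite (sum_shift o2 j (G := fun b =>
   \sum_(c < d3) shift_mx l d3 o3 k c * T (i - o1)%N b c)); last first.
  by move=> b leb; rewrite big1 // => c _; rewrite T0 ?mulr0 // !ltnNge leb !andbF.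
case: ifP => // _; rewrite (sum_shift o3 k (G := T (i - o1)%N (j - o2)%N)) //.
by move=> c lec; rewrite T0 // !ltnNge lec !andbF.
Qed.

Lemma bilin_ntensD n m l T1 T2 x y :
  bilin (ntens n m l (fun i j k => T1 i j k + T2 i j k)) x y =
  bilin (ntens n m l T1) x y + bilin (ntens n m l T2) x y.
Proof.
apply/rowP => k; rewrite !mxE -big_split /=; apply: eq_bigr => i _.
by rewrite -big_split /=; apply: eq_bigr => j _; rewrite !ffunE mulrDr.
Qed.

Lemma bilin_ntensN n m l T x y :
  bilin (ntens n m l (fun i j k => - T i j k)) x y = - bilin (ntens n m l T) x y.
Proof.
apply/rowP => k; rewrite !mxE -sumrN /=; apply: eq_bigr => i _.
by rewrite -sumrN /=; apply: eq_bigr => j _; rewrite !ffunE mulrN.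
Qed.

Lemma shift_mx_id n : shift_mx n n 0 = 1%:M.
Proof. by apply/matrixP => i j; rewrite !mxE. Qed.

Lemma shift_mx_l n m d o :
  (o + d <= n)%N -> shift_mx (n + m) d o = col_mx (shift_mx n d o) 0.
Proof.
move=> le_n; apply/matrixP => i j; rewrite !mxE.
case: splitP => [i' ->|i' ->]; rewrite !mxE //.
by rewrite gtn_eqF //; have := ltn_ord j; lia.
Qed.

Lemma shift_mx_r n m d o :
  shift_mx (n + m) d (n + o) = col_mx 0 (shift_mx m d o).
Proof.
apply/matrixP => i j; rewrite !mxE; case: splitP => [i' ->|i' ->]; rewrite !mxE.
  by rewrite ltn_eqF //; have := ltn_ord i'; lia.
by rewrite -addnA eqn_add2l.
Qed.

Lemma shift_mx_r0 n m d : shift_mx (n + m) d n = col_mx 0 (shift_mx m d 0).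
Proof. by rewrite -shift_mx_r addn0. Qed.

(* Identity matrices as 3-way arrays whose first, second or third direction has
   dimension 1. *)
Definition id1 (s a b c : nat) : F :=
  if (a <= 0)%N then if (b <= c)%N then if (c <= b)%N then
    if (b + 1 <= s)%N then 1 else 0 else 0 else 0 else 0.
Definition id2 (s a b c : nat) : F := id1 s b a c.
Definition id3 (s a b c : nat) : F := id1 s c a b.

Lemma id1E s a b c : id1 s a b c = [&& a == 0, b == c & b < s]%N%:R.
Proof.
rewrite /id1 leqn0 addn1; case: eqP => //= _; rewrite eqn_leq.
by case: leqP => //= _; case: leqP => //= _; case: ltnP.
Qed.

Lemma id1_out s a b c : ~~ [&& a < 1, b < s & c < s]%N -> id1 s a b c = 0.
Proof.
rewrite id1E => h; rewrite (_ : [&& _, _ & _] = false) //.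
by apply/negbTE; apply: contra h => /and3P[/eqP-> /eqP-> ->].
Qed.

Lemma id2_out s a b c : ~~ [&& a < s, b < 1 & c < s]%N -> id2 s a b c = 0.
Proof. by move=> h; rewrite /id2 id1_out //; apply: contra h => /and3P[-> -> ->]. Qed.

Lemma id3_out s a b c : ~~ [&& a < s, b < s & c < 1]%N -> id3 s a b c = 0.
Proof. by move=> h; rewrite /id3 id1_out //; apply: contra h => /and3P[-> -> ->]. Qed.

Lemma bilin_id1 s x y : bilin (ntens 1 s s (id1 s)) x y = x 0 0 *: y.
Proof.
apply/rowP => k; rewrite !mxE big_ord1 (bigD1 k) //= big1 => [|j nej].
  by rewrite !ffunE id1E /= eqxx ltn_ord mulr1 addr0.
by rewrite !ffunE id1E /= (negPf nej : (j == k :> nat) = false) mulr0.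
Qed.

Lemma bilin_id2 s x y : bilin (ntens s 1 s (id2 s)) x y = y 0 0 *: x.
Proof.
apply/rowP => k; rewrite !mxE; under eq_bigr => i _ do rewrite big_ord1.
rewrite (bigD1 k) //= big1 => [|j nej].
  by rewrite !ffunE /id2 id1E /= eqxx ltn_ord mulr1 addr0 mulrC.
by rewrite !ffunE /id2 id1E /= (negPf nej : (j == k :> nat) = false) mulr0.
Qed.

Lemma bilin_id3 s x y : bilin (ntens s s 1 (id3 s)) x y = x *m y^T.
Proof.
apply/rowP => k; rewrite !ord1 !mxE; apply: eq_bigr => i _.
rewrite mxE (bigD1 i) //= big1 => [|j nej].
  by rewrite !ffunE /id3 id1E /= eqxx ltn_ord mulr1 addr0.
by rewrite !ffunE /id3 id1E /= eq_sym (negPf nej : (j == i :> nat) = false) mulr0.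
Qed.

Lemma ntens_aget n m l (A : tensor F n m l) : ntens n m l (aget (Array A)) = A.
Proof. by apply/ffunP => -[[i j] k]; rewrite ffunE (@aget_ord F (Array A)). Qed.

End Placement.

(** * Reduction of action 2 to action 1 *)

Section ShiftBlocks.
Variable F : fieldType.
Implicit Types (n m d o k : nat).

Lemma mul_shift_id n k (x : 'M[F]_(k, n)) : x *m shift_mx F n n 0 = x.
Proof. by rewrite shift_mx_id mulmx1. Qed.

Lemma mul_shift_l n m d o k (x : 'M[F]_(k, n + m)) :
  (o + d <= n)%N -> x *m shift_mx F (n + m) d o = lsubmx x *m shift_mx F n d o.
Proof.
by move=> le_n; rewrite -{1}[x]hsubmxK shift_mx_l // mul_row_col mulmx0 addr0.
Qed.

Lemma mul_shift_r n m d k (x : 'M[F]_(k, n + m)) :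
  x *m shift_mx F (n + m) d n = rsubmx x *m shift_mx F m d 0.
Proof. by rewrite -{1}[x]hsubmxK shift_mx_r0 mul_row_col mulmx0 add0r. Qed.

Lemma mul_shift_r_add n m d o k (x : 'M[F]_(k, n + m)) :
  x *m shift_mx F (n + m) d (n + o) = rsubmx x *m shift_mx F m d o.
Proof. by rewrite -{1}[x]hsubmxK shift_mx_r mul_row_col mulmx0 add0r. Qed.

Lemma mul_shiftT_r_add n m d o k (w : 'M[F]_(k, d)) :
  w *m (shift_mx F (n + m) d (n + o))^T = row_mx 0 (w *m (shift_mx F m d o)^T).
Proof. by rewrite shift_mx_r tr_col_mx mul_mx_row trmx0 mulmx0. Qed.

Lemma mul_shiftT_id n k (x : 'M[F]_(k, n)) : x *m (shift_mx F n n 0)^T = x.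
Proof. by rewrite shift_mx_id trmx1 mulmx1. Qed.

Lemma mul_shiftT_l n m d o k (w : 'M[F]_(k, d)) : (o + d <= n)%N ->
  w *m (shift_mx F (n + m) d o)^T = row_mx (w *m (shift_mx F n d o)^T) 0.
Proof. by move=> le_n; rewrite shift_mx_l // tr_col_mx mul_mx_row trmx0 mulmx0. Qed.

Lemma mul_shiftT_r n m d k (w : 'M[F]_(k, d)) :
  w *m (shift_mx F (n + m) d n)^T = row_mx 0 (w *m (shift_mx F m d 0)^T).
Proof. by rewrite shift_mx_r0 tr_col_mx mul_mx_row trmx0 mulmx0. Qed.

Lemma mul_shift_head n m k (x : 'M[F]_(k, n + m)) :
  x *m shift_mx F (n + m) n 0 = lsubmx x.
Proof. by rewrite mul_shift_l // mul_shift_id. Qed.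

Lemma mul_shiftT_head n m k (w : 'M[F]_(k, n)) :
  w *m (shift_mx F (n + m) n 0)^T = row_mx w 0.
Proof. by rewrite mul_shiftT_l // mul_shiftT_id. Qed.

Lemma row_mx_block n m k p q (x : 'M[F]_(k, n)) (y : 'M[F]_(k, m))
    (M : 'M[F]_(n + m, p + q)) :
  row_mx x y *m M =
  row_mx (x *m ulsubmx M + y *m dlsubmx M) (x *m ursubmx M + y *m drsubmx M).
Proof. by rewrite -{1}[M]submxK mul_row_block. Qed.

Lemma row_mx_eq0P n m k (x : 'M[F]_(k, n)) (y : 'M[F]_(k, m)) :
  row_mx x y = 0 -> x = 0 /\ y = 0.
Proof. by rewrite -row_mx0 => /eq_row_mx. Qed.

Lemma unitmx_lower n m (R : 'M[F]_(n + m)) : R \in unitmx -> ursubmx R = 0 ->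
  ulsubmx R \in unitmx /\ drsubmx R \in unitmx.
Proof.
move=> uR ur0; move: uR; rewrite -{1}[R]submxK ur0 unitmxE det_lblock unitrM.
by rewrite -!unitmxE => /andP.
Qed.

Lemma unitmx_upper n m (R : 'M[F]_(n + m)) : R \in unitmx -> dlsubmx R = 0 ->
  ulsubmx R \in unitmx /\ drsubmx R \in unitmx.
Proof.
move=> uR dl0; move: uR; rewrite -{1}[R]submxK dl0 unitmxE det_ublock unitrM.
by rewrite -!unitmxE => /andP.
Qed.

Lemma mx11_neq0 (v : 'M[F]_1) : v != 0 -> v 0 0 != 0.
Proof. by apply: contra_neq => v0; apply/matrixP => i j; rewrite !ord1 v0 mxE. Qed.

Lemma zero00 : (0 : 'M[F]_1) 0 0 = 0. Proof. by rewrite mxE. Qed.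

Lemma one00 : (1%:M : 'M[F]_1) 0 0 = 1. Proof. by rewrite mxE. Qed.

Lemma unitmx11 (v : 'M[F]_1) : (v \in unitmx) = (v 0 0 != 0).
Proof. by rewrite unitmxE det_mx11 unitfE. Qed.

Lemma unitmx_diag n m (A : 'M[F]_n) (B : 'M[F]_m) :
  A \in unitmx -> B \in unitmx -> block_mx A 0 0 B \in unitmx.
Proof. by rewrite !unitmxE det_lblock unitrM => -> ->. Qed.

Lemma invmx_diag n m (A : 'M[F]_n) (B : 'M[F]_m) :
  A \in unitmx -> B \in unitmx ->
  invmx (block_mx A 0 0 B) = block_mx (invmx A) 0 0 (invmx B).
Proof.
move=> uA uB; have uAB := unitmx_diag uA uB.
rewrite -[LHS]mulmx1 -(mulKmx uAB (block_mx (invmx A) 0 0 (invmx B))); congr (_ *m _).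
by rewrite mulmx_block !mulmx0 !mul0mx !addr0 !add0r !mulmxV // -scalar_mx_block.
Qed.

Lemma row_mx_diag n m k p q (x : 'M[F]_(k, n)) (y : 'M[F]_(k, m))
    (A : 'M_(n, p)) (B : 'M_(m, q)) :
  row_mx x y *m block_mx A 0 0 B = row_mx (x *m A) (y *m B).
Proof. by rewrite mul_row_block !mulmx0 addr0 add0r. Qed.

Lemma mul_diag n m k p q (x : 'M[F]_(k, n + m)) (A : 'M_(n, p)) (B : 'M_(m, q)) :
  x *m block_mx A 0 0 B = row_mx (lsubmx x *m A) (rsubmx x *m B).
Proof. by rewrite -{1}[x]hsubmxK row_mx_diag. Qed.

Lemma lsubmx_row_mul n m k p q (x : 'M[F]_(k, n)) (y : 'M[F]_(k, m))
    (M : 'M[F]_(n + m, p + q)) :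
  lsubmx (row_mx x y *m M) = x *m ulsubmx M + y *m dlsubmx M.
Proof. by rewrite row_mx_block row_mxKl. Qed.

Lemma rsubmx_row_mul n m k p q (x : 'M[F]_(k, n)) (y : 'M[F]_(k, m))
    (M : 'M[F]_(n + m, p + q)) :
  rsubmx (row_mx x y *m M) = x *m ursubmx M + y *m drsubmx M.
Proof. by rewrite row_mx_block row_mxKr. Qed.

Lemma lsubmx_row0_mul n m k p q (y : 'M[F]_(k, m)) (M : 'M[F]_(n + m, p + q)) :
  lsubmx (row_mx 0 y *m M) = y *m dlsubmx M.
Proof. by rewrite lsubmx_row_mul mul0mx add0r. Qed.

Lemma lsubmx_rowl_mul n m k p q (x : 'M[F]_(k, n)) (M : 'M[F]_(n + m, p + q)) :
  lsubmx (row_mx x 0 *m M) = x *m ulsubmx M.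
Proof. by rewrite lsubmx_row_mul mul0mx addr0. Qed.

Lemma extend_unitmx n k (g : 'M[F]_n) : g \in unitmx ->
  exists h : 'M_(n + k), [/\ h \in unitmx,
    forall x : 'rV_(n + k), lsubmx (x *m h) = lsubmx x *m g &
    forall w : 'rV_n, row_mx w 0 *m h = row_mx (w *m g) 0].
Proof.
move=> ug; exists (block_mx g 0 0 1%:M); rewrite unitmx_diag ?unitmx1 //.
by split=> // x; rewrite mul_diag ?row_mxKl ?row_mxKr ?mul0mx.
Qed.

End ShiftBlocks.

Ltac shift_simp :=
  repeat first
   [ rewrite mul_shift_id | rewrite mul_shiftT_id | rewrite mul_shift_head
   | rewrite mul_shiftT_head | rewrite mul_shift_r | rewrite mul_shiftT_r
   | rewrite mul_shift_r_add | rewrite mul_shiftT_r_add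
   | rewrite mul_shift_l; [| by lia] | rewrite mul_shiftT_l; [| by lia] ].

(** The conditionals are nested exactly as in [place] and [id1], so that the built arrays and their
    mathematical descriptions agree by conversion. *)
Definition eplace (o1 o2 o3 : nexp) (t : nexp -> nexp -> nexp -> ent) : ent :=
  EIf o1 (NVar 3) (EIf o2 (NVar 4) (EIf o3 (NVar 5)
    (t (NSub (NVar 3) o1) (NSub (NVar 4) o2) (NSub (NVar 5) o3))
    EZero) EZero) EZero.

Definition eid1 (s a b c : nexp) : ent :=
  EIf a (NConst 0) (EIf b c (EIf c b (EIf (NAdd b (NConst 1)) s EOne EZero)
    EZero) EZero) EZero.
Definition eid2 (s a b c : nexp) : ent := eid1 s b a c.
Definition eid3 (s a b c : nexp) : ent := eid1 s c a b.

Section Red21.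
Variable F : fieldType.

Definition r21 : recipe :=
  let z := NConst 0 in let l := NVar 2 in
  let p := NAdd (NVar 0) (NConst 2) in
  let q := NAdd p (NConst 1) in
  Recipe q q (NAdd l p)
    (EAdd (eplace z z z EGet)
      (EAdd (eplace z p l (eid2 p)) (eplace p z l (eid1 p)))).

Variables n l : nat.

(** The second output block returns the same vector whether the mark stands on the left or on the
    right, which is what ties [S] to [R]. *)
Definition f21 (A : 'rV[F]_n -> 'rV[F]_n -> 'rV[F]_l) (X Y : 'rV[F]_(n + 2 + 1)) :
    'rV[F]_(l + (n + 2)) :=
  row_mx (A (lsubmx (lsubmx X)) (lsubmx (lsubmx Y)))
         (rsubmx Y 0 0 *: lsubmx X + rsubmx X 0 0 *: lsubmx Y).

Definition t21 (A : tensor F n n l) : tensor F (n + 2 + 1) (n + 2 + 1) (l + (n + 2)) :=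
  ntens _ _ _ (fun i j k => place 0 0 0 (aget (Array A)) i j k +
    (place 0 (n + 2) l (id2 F (n + 2)) i j k + place (n + 2) 0 l (id1 F (n + 2)) i j k)).

Lemma build21 (A : tensor F n n l) : build r21 (Array A) = Array (t21 A).
Proof. by []. Qed.

Lemma bilin21 (A : tensor F n n l) X Y : bilin (t21 A) X Y = f21 (bilin A) X Y.
Proof.
rewrite /t21 !bilin_ntensD (bilin_place _ _ _ _ _ _ (@aget_out F (Array A))).
rewrite (bilin_place _ _ _ _ _ _ (@id2_out F (n + 2))).
rewrite (bilin_place _ _ _ _ _ _ (@id1_out F (n + 2))).
rewrite /= ntens_aget bilin_id1 bilin_id2; shift_simp.
by rewrite !add_row_mx ?add0r ?addr0.
Qed.


(* If R moved the mark into x R, then f21 A (x R) would have a kernel of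
   dimension at most 1, while that of f21 B x is larger. *)
Lemma f21_mark (A B : 'rV[F]_n -> 'rV[F]_n -> 'rV[F]_l) R S :
  S \in unitmx -> (forall x, B x 0 = 0) ->
  (forall X Y, f21 B X Y = 0 -> f21 A (X *m R) (Y *m S) = 0) -> ursubmx R = 0.
Proof.
move=> uS B0 H; apply/row_matrixP => i; rewrite row0 rowE.
set x := delta_mx 0 i; apply/eqP/negPn/negP => /mx11_neq0 nzv.
(* Padding vectors are invisible to [B]. Of the two padding coordinates one is spent on making the
   mark coordinate of [Y *m S] vanish. *)
have [p nzp pN] := exists_kernel_vector (dsubmx (ursubmx S)) (isT : 1 < 2)%N.
pose Y : 'rV[F]_(n + 2 + 1) := row_mx (row_mx 0 p) 0.
have /H : f21 B (row_mx x 0) Y = 0.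
  by rewrite /f21 !(row_mxKl, row_mxKr) B0 !zero00 !scale0r addr0 row_mx0.
have YS0 : rsubmx (Y *m S) = 0.
  by rewrite rsubmx_row_mul -[ursubmx S]vsubmxK mul_row_col !mul0mx add0r addr0.
rewrite /f21 YS0 => /row_mx_eq0P[_]; rewrite zero00 scale0r add0r rsubmx_row_mul.
rewrite mul0mx addr0 => /eqP; rewrite scaler_eq0 (negPf nzv) /= => /eqP YS1.
have /(unitmx_injective uS)/row_mx_eq0P[/row_mx_eq0P[_ p0] _] : Y *m S = 0.
  by rewrite -[Y *m S]hsubmxK YS0 YS1 row_mx0.
by rewrite p0 eqxx in nzp.
Qed.

Lemma red21 (A B : tensor F n n l) :
  same_orbit Act2 (Array A) (Array B) <-> same_orbit Act1 (Array (t21 A)) (Array (t21 B)).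
Proof.
rewrite same_orbit2P same_orbit1P; split=> [[g [t [ug ut eqB]]]|].
  have [h [uh hl _]] := extend_unitmx 2 ug.
  exists (block_mx h 0 0 1%:M), (block_mx h 0 0 1%:M), (block_mx t 0 0 (invmx h)).
  rewrite !unitmx_diag ?unitmx1 ?unitmx_inv //; split=> // X Y.
  rewrite !bilin21 /f21 !mul_diag !(row_mxKl, row_mxKr) !mulmx1 eqB.
  by rewrite !hl mulmxDl -!scalemxAl !mulmxK.
case=> R [S [T [uR uS uT]]] eqB0.
have eqB X Y : f21 (bilin B) X Y = f21 (bilin A) (X *m R) (Y *m S) *m T.
  by rewrite -!bilin21.
have fC (C : tensor F n n l) X Y : f21 (fun x y => bilin C y x) X Y = f21 (bilin C) Y X.
  by rewrite /f21 addrC.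
have R0 : ursubmx R = 0.
  apply: (f21_mark (A := bilin A) (B := bilin B) uS) => [x|X Y]; first exact: bilin0r.
  by rewrite eqB => /(unitmx_injective uT).
(* By [fC] the construction is compatible with exchanging the arguments, so the result on [R]
   applies to the flipped maps. *)
have S0 : ursubmx S = 0.
  apply: (f21_mark (A := fun x y => bilin A y x) (B := fun x y => bilin B y x) uR) => [x|X Y].
    exact: bilin0l.
  by rewrite !fC eqB => /(unitmx_injective uT).
have [up ua] := unitmx_lower uR R0; have [uq ub] := unitmx_lower uS S0.
set p := ulsubmx R in up; set q := ulsubmx S in uq.
rewrite !unitmx11 in ua ub.
set al := _ 0 0 in ua; set be := _ 0 0 in ub.
have Rx x : row_mx x 0 *m R = row_mx (x *m p) 0.
  by rewrite row_mx_block R0 !mulmx0 !mul0mx !addr0.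
have Sx x : row_mx x 0 *m S = row_mx (x *m q) 0.
  by rewrite row_mx_block S0 !mulmx0 !mul0mx !addr0.
have R1 : row_mx 0 1%:M *m R = row_mx (dlsubmx R) (drsubmx R).
  by rewrite row_mx_block !mul0mx !mul1mx !add0r.
have S1 : row_mx 0 1%:M *m S = row_mx (dlsubmx S) (drsubmx S).
  by rewrite row_mx_block !mul0mx !mul1mx !add0r.
(* The products of x with the mark in both orders agree for B; cancelling T and comparing the second
   blocks for A gives [be *: (x *m p) = al *: (x *m q)]. *)
have qE : q = (be / al) *: p.
  apply/row_matrixP => i; rewrite !rowE; set x := delta_mx 0 i.
  have := eqB (row_mx x 0) (row_mx 0 1%:M); have := eqB (row_mx 0 1%:M) (row_mx x 0).
  rewrite /f21 !(Rx, Sx, R1, S1) !(row_mxKl, row_mxKr) !linear0 ?bilin0l ?bilin0r.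
  rewrite !(zero00, one00) !(scale0r, scale1r, add0r, addr0) => -> /(can_inj (mulmxK uT)).
  case/eq_row_mx=> _ eq_pq.
  by rewrite -scalemxAr -[x *m q](scalerK ua) eq_pq scalerA mulrC.
have nzc : be / al != 0 by rewrite mulf_neq0 ?invr_neq0.
have eqB1 x y : row_mx (bilin B (lsubmx x) (lsubmx y)) 0 =
    row_mx ((be / al) *: bilin A (lsubmx (x *m p)) (lsubmx (y *m p))) 0 *m T.
  have := eqB (row_mx x 0) (row_mx y 0).
  rewrite /f21 Rx Sx !(row_mxKl, row_mxKr) !zero00 !scale0r !addr0 => ->.
  by rewrite qE -scalemxAr linearZ /= bilinZr.
have onto x' : exists x : 'rV_(n + 2), lsubmx (x *m p) = x'.
  by exists (row_mx x' 0 *m invmx p); rewrite mulmxKV // row_mxKl.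
have A0 x y : bilin B (lsubmx x) (lsubmx y) = 0 ->
    bilin A (lsubmx (x *m p)) (lsubmx (y *m p)) = 0.
  move=> B0; have := eqB1 x y; rewrite B0 row_mx0 => /esym/(unitmx_injective uT).
  by case/row_mx_eq0P=> /eqP; rewrite scaler_eq0 (negPf nzc) => /eqP.
(* Padding vectors are annihilated by B, so by [A0] and [onto] the projections of their images lie
   in the radical of A. A correction of the upper left block of p by multiples of [dlsubmx p] is
   then invisible to A. *)
have Al z y : bilin A (z *m dlsubmx p) y = 0.
  have [y' <-] := onto y; rewrite -lsubmx_row0_mul.
  by rewrite A0 // row_mxKl bilin0l.
have Ar z y : bilin A y (z *m dlsubmx p) = 0.
  have [y' <-] := onto y; rewrite -lsubmx_row0_mul.
  by rewrite A0 // row_mxKl bilin0r.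
have At x y : bilin A x y *m ursubmx T = 0.
  have [[x' <-] [y' <-]] := (onto x, onto y); have := eqB1 x' y'.
  rewrite row_mx_block !mul0mx !addr0 => /eq_row_mx[_ /esym/eqP].
  by rewrite -scalemxAl scaler_eq0 (negPf nzc) => /eqP.
have [M uM] := unit_ulsubmx_completion up.
have [N uN] := unit_ulsubmx_completion uT.
exists (ulsubmx p + ursubmx p *m M *m dlsubmx p).
exists ((be / al) *: (ulsubmx T + ursubmx T *m N *m dlsubmx T)).
rewrite unitmxZ ?unitfE //; split=> // x y.
have := eqB1 (row_mx x 0) (row_mx y 0).
rewrite !lsubmx_rowl_mul !row_mxKl row_mx_block => /eq_row_mx[-> _].
rewrite !mulmxDr mul0mx addr0 !mulmxA bilinDl !bilinDr !(Al, Ar) !addr0.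
by rewrite -scalemxAr mulmxDr !mulmxA At !mul0mx addr0 scalemxAl.
Qed.

End Red21.

(** * Reductions of actions 5 and 3 to action 2 *)

Section RowBlocks.
Variable F : fieldType.

Lemma mul_row0_mx n m k p (y : 'M[F]_(k, m)) (M : 'M[F]_(n + m, p)) :
  row_mx 0 y *m M = y *m dsubmx M.
Proof. by rewrite -{1}[M]vsubmxK mul_row_col mul0mx add0r. Qed.

Lemma mul_rowl_mx n m k p (x : 'M[F]_(k, n)) (M : 'M[F]_(n + m, p)) :
  row_mx x 0 *m M = x *m usubmx M.
Proof. by rewrite -{1}[M]vsubmxK mul_row_col mul0mx addr0. Qed.

Lemma scale_rowl n m k c (x : 'M[F]_(k, n)) :
  row_mx (c *: x) (0 : 'M_(k, m)) = c *: row_mx x 0.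
Proof. by rewrite scale_row_mx scaler0. Qed.

End RowBlocks.

Section Red52.
Variable F : fieldType.

Definition r52 : recipe :=
  let z := NConst 0 in
  let p := NAdd (NVar 0) (NAdd (NVar 0) (NConst 2)) in
  let q := NAdd p (NConst 1) in
  Recipe q q p (EAdd (eplace z z z EGet) (eplace p z z (eid1 p))).

Variables n : nat.
Let p := (n + (n + 2))%N.

(** Left multiplication by the mark is the identity on unmarked vectors; this forces T to be inverse
    to the main block of R up to a scalar, as action 5 demands. *)
Definition f52 (A : 'rV[F]_n -> 'rV[F]_n -> 'rV[F]_n) (X Y : 'rV[F]_(p + 1)) : 'rV[F]_p :=
  row_mx (A (lsubmx (lsubmx X)) (lsubmx (lsubmx Y))) 0 + rsubmx X 0 0 *: lsubmx Y.

Definition t52 (A : tensor F n n n) : tensor F (p + 1) (p + 1) p :=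
  ntens _ _ _ (fun i j k => place 0 0 0 (aget (Array A)) i j k +
    place p 0 0 (id1 F p) i j k).

Lemma build52 (A : tensor F n n n) : build r52 (Array A) = Array (t52 A).
Proof. by []. Qed.

Lemma bilin52 (A : tensor F n n n) X Y : bilin (t52 A) X Y = f52 (bilin A) X Y.
Proof.
rewrite /t52 !bilin_ntensD (bilin_place _ _ _ _ _ _ (@aget_out F (Array A))).
rewrite (bilin_place _ _ _ _ _ _ (@id1_out F p)).
by rewrite /= ntens_aget bilin_id1; shift_simp.
Qed.

(** If the image of x had a nonzero mark coordinate, left multiplication by it would be injective on
    vectors whose first n coordinates and mark coordinate vanish. These are [n + 1] conditions on
    the image of a padding vector, out of [n + 2] dimensions, whereas x annihilates all the padding
    under B. *)
Lemma f52_mark (A B : tensor F n n n) R : R \in unitmx ->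
  (forall X Y, f52 (bilin B) X Y = 0 -> f52 (bilin A) (X *m R) (Y *m R) = 0) ->
  ursubmx R = 0.
Proof.
move=> uR H; apply/row_matrixP => i; rewrite row0 rowE.
set x := delta_mx 0 i; apply/eqP/negPn/negP => /mx11_neq0 nzv.
pose Rp := dsubmx (usubmx R).
have [|u nzu uN] := @exists_kernel_vector F _ _ (row_mx (lsubmx (lsubmx Rp)) (rsubmx Rp)).
  by rewrite !addnS addn0.
pose Y : 'rV[F]_(p + 1) := row_mx (row_mx 0 u) 0.
have YR : Y *m R = u *m Rp by rewrite mul_rowl_mx mul_row0_mx.
have /row_mx_eq0P[YR1 YR2] : row_mx (lsubmx (lsubmx (Y *m R))) (rsubmx (Y *m R)) = 0.
  by rewrite YR -!mulmx_lsub -mulmx_rsub -mul_mx_row.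
have /H : f52 (bilin B) (row_mx x 0) Y = 0.
  by rewrite /f52 !(row_mxKl, row_mxKr) bilin0r zero00 scale0r addr0 row_mx0.
rewrite /f52 YR1 bilin0r row_mx0 add0r rsubmx_row_mul mul0mx addr0 => /eqP.
rewrite scaler_eq0 (negPf nzv) /= => /eqP YR0.
have /(unitmx_injective uR)/row_mx_eq0P[/row_mx_eq0P[_ u0] _] : Y *m R = 0.
  by rewrite -[Y *m R]hsubmxK YR2 YR0 row_mx0.
by rewrite u0 eqxx in nzu.
Qed.

Lemma red52 (A B : tensor F n n n) :
  same_orbit Act5 (Array A) (Array B) <-> same_orbit Act2 (Array (t52 A)) (Array (t52 B)).
Proof.
rewrite same_orbit5P same_orbit2P; split=> [[g ug eqB]|].
  have [h [uh hl hr]] := extend_unitmx (n + 2) ug.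
  exists (block_mx h 0 0 1%:M), (invmx h).
  rewrite !unitmx_diag ?unitmx1 ?unitmx_inv //; split=> // X Y.
  rewrite !bilin52 /f52 !mul_diag !(row_mxKl, row_mxKr) !mulmx1 !hl eqB.
  apply: (can_inj (mulmxK uh)); rewrite mulmxKV // mulmxDl hr mulmxKV //.
  by rewrite scalemxAl.
case=> R [T [uR uT]] eqB0.
have eqB X Y : f52 (bilin B) X Y = f52 (bilin A) (X *m R) (Y *m R) *m T.
  by rewrite -!bilin52.
have R0 : ursubmx R = 0.
  by apply: (@f52_mark A B) => // X Y; rewrite eqB => /(unitmx_injective uT).
have [ur ua] := unitmx_lower uR R0; rewrite unitmx11 in ua.
set rho := ulsubmx R in ur; set al := _ 0 0 in ua.
have Rx x : row_mx x 0 *m R = row_mx (x *m rho) 0.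
  by rewrite row_mx_block R0 !mulmx0 !mul0mx !addr0.
have R1 : row_mx 0 1%:M *m R = row_mx (dlsubmx R) (drsubmx R).
  by rewrite row_mx_block !mul0mx !mul1mx !add0r.
have onto x' : exists x : 'rV_p, lsubmx (x *m rho) = x'.
  by exists (row_mx x' 0 *m invmx rho); rewrite mulmxKV // row_mxKl.
have Ar z : bilin A z (lsubmx (dlsubmx R)) = 0.
  have [x <-] := onto z; have := eqB (row_mx x 0) (row_mx 0 1%:M).
  rewrite /f52 Rx R1 !(row_mxKl, row_mxKr) !linear0 bilin0r zero00 !scale0r !addr0 row_mx0.
  by move=> /esym/(unitmx_injective uT)/row_mx_eq0P[].
(* The mark has square 0 under B. The square of its image is [al *: dlsubmx R] plus a value of A
   that vanishes by [Ar]. *)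
have r0 : dlsubmx R = 0.
  have := eqB (row_mx 0 1%:M) (row_mx 0 1%:M).
  rewrite /f52 R1 !(row_mxKl, row_mxKr) !linear0 bilin0r Ar row_mx0 !add0r.
  by move=> /esym/(unitmx_injective uT)/eqP; rewrite scaler_eq0 (negPf ua) => /eqP.
have Tinv : (al *: rho) *m T = 1%:M.
  apply/row_matrixP => i; rewrite !rowE mulmx1 mulmxA; set y := delta_mx 0 i.
  have := eqB (row_mx 0 1%:M) (row_mx y 0).
  rewrite /f52 Rx R1 r0 !(row_mxKl, row_mxKr) !linear0 !bilin0l one00 row_mx0 !add0r scale1r.
  by rewrite -scalemxAr => <-.
(* With [rho = al *: r], the two arguments of A contribute [al ^ 2], and so does the inverse
   [al *: rho] of T. The scalar cancels and r is multiplicative on the nose. *)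
have [r rhoE u_r] : exists2 r, rho = al *: r & r \in unitmx.
  by exists (al^-1 *: rho); rewrite ?scalerA ?mulfV ?scale1r // unitmxZ // unitfE invr_neq0.
have eqB1 x y : row_mx (bilin B (lsubmx x) (lsubmx y)) 0 *m r =
    row_mx (bilin A (lsubmx (x *m r)) (lsubmx (y *m r))) 0.
  have := eqB (row_mx x 0) (row_mx y 0).
  rewrite /f52 !Rx !(row_mxKl, row_mxKr) !zero00 !scale0r !addr0 => /(congr1 (mulmx^~ (al *: rho))).
  rewrite -mulmxA (mulmx1C Tinv) mulmx1 rhoE scalerA -!scalemxAr !linearZ /= bilinZl bilinZr scalerA.
  rewrite scale_rowl => eqs; exact: (scalerI (mulf_neq0 ua ua)).
have onto' x' : exists x : 'rV_p, lsubmx (x *m r) = x'.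
  by exists (row_mx x' 0 *m invmx r); rewrite mulmxKV // row_mxKl.
have Al z y : bilin A (z *m dlsubmx r) y = 0.
  have [y' <-] := onto' y; have := eqB1 (row_mx 0 z) y'.
  rewrite lsubmx_row0_mul row_mxKl bilin0l row_mx0 mul0mx => /esym.
  by case/row_mx_eq0P.
have Arr z y : bilin A y (z *m dlsubmx r) = 0.
  have [y' <-] := onto' y; have := eqB1 y' (row_mx 0 z).
  rewrite lsubmx_row0_mul row_mxKl bilin0r row_mx0 mul0mx => /esym.
  by case/row_mx_eq0P.
have [M uM] := unit_ulsubmx_completion u_r.
exists (ulsubmx r + ursubmx r *m M *m dlsubmx r) => // x y.
have := eqB1 (row_mx x 0) (row_mx y 0).
rewrite !lsubmx_rowl_mul !row_mxKl row_mx_block !mul0mx !addr0 => /eq_row_mx[eq1 eq2].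
apply: (can_inj (mulmxK uM)); rewrite mulmxKV //.
rewrite [LHS]mulmxDr !mulmxA eq1 eq2 !mul0mx addr0.
by rewrite !mulmxDr !mulmxA bilinDl !bilinDr !(Al, Arr) !addr0.
Qed.

End Red52.

Section Red32.
Variable F : fieldType.

Definition r32 : recipe :=
  let z := NConst 0 in let n := NVar 0 in let l := NVar 2 in
  let m := NAdd n (NAdd (NAdd l n) (NConst 2)) in
  let o := NAdd l m in let q := NAdd o (NConst 1) in
  Recipe q q (NAdd m l)
    (EAdd (eplace z l z (fun a b c => EGet c b a))
      (EAdd (eplace o l z (eid1 m)) (eplace z o m (eid2 l)))).

Variables n l : nat.
Let m := (n + (l + n + 2))%N.

(** A vector consists of a parameter w, a padded operand and a mark. On the left the mark returns
    the operand of Y; on the right it copies the parameter of X into a separate output block, which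
    will show that the image of the mark has no parameter part. *)
Definition f32 (A : 'rV[F]_l -> 'rV[F]_n -> 'rV[F]_n) (X Y : 'rV[F]_(l + m + 1)) :
    'rV[F]_(m + l) :=
  row_mx (row_mx (A (lsubmx (lsubmx X)) (lsubmx (rsubmx (lsubmx Y)))) 0
            + rsubmx X 0 0 *: rsubmx (lsubmx Y))
         (rsubmx Y 0 0 *: lsubmx (lsubmx X)).

Definition t32 (A : tensor F n n l) : tensor F (l + m + 1) (l + m + 1) (m + l) :=
  ntens _ _ _ (fun i j k => place 0 l 0 (fun a b c => aget (Array A) c b a) i j k +
    (place (l + m) l 0 (id1 F m) i j k + place 0 (l + m) m (id2 F l) i j k)).

Lemma build32 (A : tensor F n n l) : build r32 (Array A) = Array (t32 A).
Proof. by []. Qed.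

Lemma bilin32 (A : tensor F n n l) X Y :
  bilin (t32 A) X Y = f32 (bilin (transp13 A)) X Y.
Proof.
have out a b c : ~~ [&& a < l, b < n & c < n]%N -> aget (Array A) c b a = 0.
  by move=> h; apply: aget_out; apply: contra h => /= /and3P[-> -> ->].
rewrite /t32 !bilin_ntensD (bilin_place _ _ _ _ _ _ out).
rewrite (bilin_place _ _ _ _ _ _ (@id1_out F m)) (bilin_place _ _ _ _ _ _ (@id2_out F l)).
have -> : ntens l n n (fun a b c => aget (Array A) c b a) = transp13 A.
  by apply/ffunP => -[[i j] k]; rewrite !ffunE (@aget_ord F (Array A)).
rewrite bilin_id1 bilin_id2; shift_simp.
by rewrite !add_row_mx ?add0r ?addr0.
Qed.

(** The image of a padding vector is asked to have zero parameter, zero first n operand coordinates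
    and zero mark: [l + n + 1] conditions against [l + n + 2] dimensions. A left factor with a
    nonzero mark coordinate cannot annihilate such an image unless it is 0. *)
Lemma f32_mark (A B : 'rV[F]_l -> 'rV[F]_n -> 'rV[F]_n) R : R \in unitmx ->
  (forall x, A x 0 = 0) -> (forall x, B x 0 = 0) ->
  (forall X Y, f32 B X Y = 0 -> f32 A (X *m R) (Y *m R) = 0) -> ursubmx R = 0.
Proof.
move=> uR A0 B0 H; apply/row_matrixP => i; rewrite row0 rowE.
set x := delta_mx 0 i; apply/eqP/negPn/negP => /mx11_neq0 nzv.
pose Rp := dsubmx (dsubmx (usubmx R)).
have [|u nzu uN] := @exists_kernel_vector F _ _
   (row_mx (row_mx (lsubmx (lsubmx Rp)) (lsubmx (rsubmx (lsubmx Rp)))) (rsubmx Rp)).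
  by rewrite !addnS addn0.
pose Y : 'rV[F]_(l + m + 1) := row_mx (row_mx 0 (row_mx 0 u)) 0.
have YR : Y *m R = u *m Rp by rewrite mul_rowl_mx !mul_row0_mx.
have /row_mx_eq0P[/row_mx_eq0P[YR1 YR2] YR3] :
    row_mx (row_mx (lsubmx (lsubmx (Y *m R))) (lsubmx (rsubmx (lsubmx (Y *m R)))))
      (rsubmx (Y *m R)) = 0.
  by rewrite YR -!(mulmx_lsub, mulmx_rsub) -!mul_mx_row.
have /H : f32 B (row_mx x 0) Y = 0.
  by rewrite /f32 !(row_mxKl, row_mxKr) B0 !zero00 !scale0r addr0 !row_mx0.
rewrite /f32 YR2 A0 row_mx0 add0r rsubmx_row_mul mul0mx addr0 => /row_mx_eq0P[/eqP + _].
rewrite scaler_eq0 (negPf nzv) /= => /eqP YR0.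
have /(unitmx_injective uR)/row_mx_eq0P[/row_mx_eq0P[_ /row_mx_eq0P[_ u0]] _] : Y *m R = 0.
  by rewrite -[Y *m R]hsubmxK -[lsubmx _]hsubmxK YR3 YR0 YR1 !row_mx0.
by rewrite u0 eqxx in nzu.
Qed.

Lemma red32 (A B : tensor F n n l) :
  same_orbit Act3 (Array A) (Array B) <-> same_orbit Act2 (Array (t32 A)) (Array (t32 B)).
Proof.
rewrite same_orbit3_transp same_orbit2P.
have eqf (C : tensor F n n l) X Y := bilin32 C X Y.
split=> [[g [t [ug ut eqB]]]|].
  have [h [uh hl hr]] := extend_unitmx (l + n + 2) ug.
  exists (block_mx (block_mx t 0 0 h) 0 0 1%:M), (block_mx (invmx h) 0 0 (invmx t)).
  rewrite !unitmx_diag ?unitmx1 ?unitmx_inv //; split=> // X Y.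
  rewrite !eqf /f32 !mul_diag !(row_mxKl, row_mxKr) !mulmx1 !hl -eqB.
  congr row_mx; last by rewrite scalemxAl mulmxK.
  by apply: (can_inj (mulmxK uh)); rewrite mulmxKV // mulmxDl hr scalemxAl.
case=> R [T [uR uT]] eqB0.
have eqB X Y : f32 (bilin (transp13 B)) X Y =
    f32 (bilin (transp13 A)) (X *m R) (Y *m R) *m T by rewrite -!eqf.
have H X Y : f32 (bilin (transp13 B)) X Y = 0 ->
    f32 (bilin (transp13 A)) (X *m R) (Y *m R) = 0.
  by rewrite eqB => /(unitmx_injective uT).
have R0 : ursubmx R = 0 by apply: f32_mark H => // x; exact: bilin0r.
have [us ua] := unitmx_lower uR R0; rewrite unitmx11 in ua.
set s := ulsubmx R in us; set al := _ 0 0 in ua.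
have Rx x : row_mx x 0 *m R = row_mx (x *m s) 0.
  by rewrite row_mx_block R0 !mulmx0 !mul0mx !addr0.
have R1 : row_mx 0 1%:M *m R = row_mx (dlsubmx R) (drsubmx R).
  by rewrite row_mx_block !mul0mx !mul1mx !add0r.
(* The left factor is the preimage of the mark. A pure parameter w on the right gives product 0
   under B, while under A the mark returns the operand part of the image of w. *)
have s0 : ursubmx s = 0.
  apply/row_matrixP => i; rewrite row0 rowE; set w := delta_mx 0 i.
  have := H (row_mx 0 1%:M *m invmx R) (row_mx (row_mx w 0) 0).
  rewrite mulmxKV // Rx row_mx_block /f32 !(row_mxKl, row_mxKr) !linear0 !mul0mx !addr0.
  rewrite !bilin0l !bilin0r ?row_mx0 one00 zero00 scale1r ?scaler0 ?scale0r ?add0r ?row_mx0.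
  by case/(_ erefl)/row_mx_eq0P; rewrite rsubmx_row_mul mul0mx addr0.
have [ut ur] := unitmx_lower us s0.
set t := ulsubmx s in ut; set r := drsubmx s in ur.
have sx w u : row_mx w u *m s = row_mx (w *m t + u *m dlsubmx s) (u *m r).
  by rewrite row_mx_block s0 mulmx0 add0r.
have r0 : dlsubmx R = 0.
  have := H (row_mx 0 1%:M) (row_mx 0 1%:M).
  rewrite R1 /f32 !(row_mxKl, row_mxKr) !linear0 !bilin0l ?row_mx0 ?scaler0 ?addr0 ?row_mx0.
  case/(_ erefl)/row_mx_eq0P=> + /eqP; rewrite scaler_eq0 (negPf ua) /= => + /eqP rw0.
  rewrite rw0 bilin0l row_mx0 add0r => /eqP; rewrite scaler_eq0 (negPf ua) /= => /eqP ru0.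
  by rewrite -[dlsubmx R]hsubmxK rw0 ru0 row_mx0.
have eqT (u : 'rV_m) : row_mx u 0 = row_mx (al *: (u *m r)) 0 *m T.
  have := eqB (row_mx 0 1%:M) (row_mx (row_mx 0 u) 0).
  rewrite Rx R1 r0 sx /f32 !(row_mxKl, row_mxKr) !linear0 !bilin0l !row_mx0 !add0r.
  by rewrite one00 scale1r.
have eqB1 w u : row_mx (bilin (transp13 B) w (lsubmx u)) 0 *m r =
    row_mx (bilin (transp13 A) (w *m (al^-1 *: t)) (lsubmx (u *m r))) 0.
  have := eqB (row_mx (row_mx w 0) 0) (row_mx (row_mx 0 u) 0).
  rewrite !Rx !sx /f32 !(row_mxKl, row_mxKr) !zero00 !scale0r !mul0mx !addr0 eqT.
  move/(can_inj (mulmxK uT))/eq_row_mx => -[eqs _]; apply: (scalerI ua); rewrite eqs.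
  by rewrite -scalemxAr bilinZl scale_rowl scalerA mulfV // scale1r.
(* The scalar goes into the parameter matrix, which action 3 leaves free. *)
have utt : al^-1 *: t \in unitmx by rewrite unitmxZ // unitfE invr_neq0.
move: (al^-1 *: t) utt eqB1 => tt utt eqB1.
have Ar z w : bilin (transp13 A) w (z *m dlsubmx r) = 0.
  have := eqB1 (w *m invmx tt) (row_mx 0 z).
  rewrite lsubmx_row0_mul row_mxKl bilin0r row_mx0 mul0mx mulmxKV // => /esym.
  by case/row_mx_eq0P.
have [M uM] := unit_ulsubmx_completion ur.
exists (ulsubmx r + ursubmx r *m M *m dlsubmx r), tt; split=> // w y.
have := eqB1 w (row_mx y 0).
rewrite !lsubmx_rowl_mul !row_mxKl row_mx_block !mul0mx !addr0 => /eq_row_mx[eq1 eq2].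
rewrite [LHS]mulmxDr !mulmxA eq1 eq2 !mul0mx addr0.
by rewrite !mulmxDr !mulmxA bilinDr Ar addr0.
Qed.

End Red32.

(** * Reduction of action 4 to action 2 *)

Section Red42.
Variable F : fieldType.

Definition swap_mx n : 'M[F]_(n + n) := block_mx 0 1%:M 1%:M 0.

Lemma mul_swap n k (z : 'M[F]_(k, n + n)) :
  z *m swap_mx n = row_mx (rsubmx z) (lsubmx z).
Proof. by rewrite -{1}[z]hsubmxK mul_row_block !mulmx0 !mulmx1 add0r addr0. Qed.

Lemma dot_swap n k k' (z : 'M[F]_(k, n + n)) (z' : 'M[F]_(k', n + n)) :
  z *m swap_mx n *m z'^T =
  lsubmx z *m (rsubmx z')^T + rsubmx z *m (lsubmx z')^T.
Proof. by rewrite mul_swap -{1}[z']hsubmxK tr_row_mx mul_row_col addrC. Qed.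

Lemma swap_mxK n : swap_mx n *m swap_mx n = 1%:M.
Proof.
by rewrite mulmx_block !mulmx0 !mul0mx !mulmx1 !add0r !addr0 -scalar_mx_block.
Qed.

Lemma swap_mx_unit n : swap_mx n \in unitmx.
Proof. by have /mulmx1_unit[] := swap_mxK n. Qed.

Definition r42 : recipe :=
  let z := NConst 0 in let n := NVar 0 in
  let m := NAdd n n in let q := NAdd m (NConst 1) in
  Recipe q q q
    (EAdd (eplace z z z EGet)
    (EAdd (eplace m z n (eid1 n))
    (EAdd (eplace m n z (eid1 n))
    (EAdd (eplace z n m (eid3 n))
    (EAdd (eplace n z m (eid3 n)) (eplace m m m (eid1 (NConst 1)))))))).

Variables n : nat.

(** The second copy of F^n is dual to the first under the form J given by [swap_mx]. Multiplication
    by the mark sends z to [z J] and thereby expresses T through R; the last output coordinate makes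
    R a similitude of J. Together they turn T into the [R^T] of action 4. *)
Definition f42 (A : 'rV[F]_n -> 'rV[F]_n -> 'rV[F]_n) (X Y : 'rV[F]_(n + n + 1)) :
    'rV[F]_(n + n + 1) :=
  row_mx (row_mx (A (lsubmx (lsubmx X)) (lsubmx (lsubmx Y))) 0
            + rsubmx X 0 0 *: (lsubmx Y *m swap_mx n))
         (lsubmx X *m swap_mx n *m (lsubmx Y)^T + rsubmx X 0 0 *: rsubmx Y).

Definition t42 (A : tensor F n n n) : tensor F (n + n + 1) (n + n + 1) (n + n + 1) :=
  ntens _ _ _ (fun i j k => place 0 0 0 (aget (Array A)) i j k +
    (place (n + n) 0 n (id1 F n) i j k + (place (n + n) n 0 (id1 F n) i j k +
    (place 0 n (n + n) (id3 F n) i j k + (place n 0 (n + n) (id3 F n) i j k +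
     place (n + n) (n + n) (n + n) (id1 F 1) i j k))))).

Lemma build42 (A : tensor F n n n) : build r42 (Array A) = Array (t42 A).
Proof. by []. Qed.

Lemma bilin42 (A : tensor F n n n) X Y : bilin (t42 A) X Y = f42 (bilin A) X Y.
Proof.
rewrite /t42 !bilin_ntensD (bilin_place _ _ _ _ _ _ (@aget_out F (Array A))).
rewrite !(bilin_place _ _ _ _ _ _ (@id1_out F n)) !(bilin_place _ _ _ _ _ _ (@id3_out F n)).
rewrite (bilin_place _ _ _ _ _ _ (@id1_out F 1)).
rewrite /= ntens_aget !bilin_id1 !bilin_id3; shift_simp.
rewrite /f42 dot_swap mul_swap !add_row_mx ?add0r ?addr0 scale_row_mx add_row_mx.
by rewrite !add_row_mx ?add0r ?addr0 addrA.
Qed.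

Lemma form_mx_inj m (M N : 'M[F]_m) :
  (forall x y : 'rV_m, x *m M *m y^T = x *m N *m y^T) -> M = N.
Proof.
move=> eqMN; apply/matrixP => i j.
have /matrixP/(_ 0 0) := eqMN (delta_mx 0 i) (delta_mx 0 j).
by rewrite -!rowE trmx_delta -!colE !mxE.
Qed.

(** The mark vector takes over the role of the padding: an unmarked left factor annihilates it,
    whereas left multiplication by a vector with nonzero mark coordinate is injective. *)
Lemma f42_mark (A B : tensor F n n n) R : R \in unitmx ->
  (forall X Y, f42 (bilin B) X Y = 0 -> f42 (bilin A) (X *m R) (Y *m R) = 0) ->
  ursubmx R = 0.
Proof.
move=> uR H; apply/row_matrixP => i; rewrite row0 rowE.
set x := delta_mx 0 i; apply/eqP/negPn/negP => /mx11_neq0 nzv.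
pose Y : 'rV[F]_(n + n + 1) := row_mx 0 1%:M.
have /H : f42 (bilin B) (row_mx x 0) Y = 0.
  rewrite /f42 !(row_mxKl, row_mxKr) !linear0 bilin0r !mul0mx ?trmx0 ?mulmx0 zero00.
  by rewrite !scale0r !addr0 !row_mx0.
rewrite /f42 !mul_swap rsubmx_row_mul mul0mx addr0 scale_row_mx add_row_mx add0r.
set v := x *m _ in nzv *; set YR := Y *m R => /row_mx_eq0P[/row_mx_eq0P[+ /eqP]].
rewrite scaler_eq0 (negPf nzv) /= => + /eqP YR0; rewrite YR0 bilin0r add0r => /eqP.
rewrite scaler_eq0 (negPf nzv) /= => /eqP YR1 /eqP.
have YR2 : lsubmx YR = 0 by rewrite -[lsubmx YR]hsubmxK YR0 YR1 row_mx0.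
rewrite YR2 trmx0 mulmx0 add0r scaler_eq0 (negPf nzv) /= => /eqP YR3.
have /(unitmx_injective uR)/row_mx_eq0P[_ /matrixP/(_ 0 0)/eqP] : Y *m R = 0.
  by rewrite -[Y *m R]hsubmxK -/YR YR3 YR2 row_mx0.
by rewrite one00 zero00 oner_eq0.
Qed.

Lemma red42 (A B : tensor F n n n) :
  same_orbit Act4 (Array A) (Array B) <-> same_orbit Act2 (Array (t42 A)) (Array (t42 B)).
Proof.
rewrite same_orbit4P same_orbit2P; split=> [[g ug eqB]|].
  pose h := (invmx g)^T; have uh : h \in unitmx by rewrite unitmx_tr unitmx_inv.
  exists (block_mx (block_mx g 0 0 h) 0 0 1%:M).
  exists (block_mx (block_mx g^T 0 0 (invmx g)) 0 0 1%:M).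
  have hg : h *m g^T = 1%:M by rewrite -trmx_mul mulmxV // trmx1.
  have gh : g *m h^T = 1%:M by rewrite trmxK mulmxV.
  rewrite !unitmx_diag ?unitmx1 ?unitmx_tr ?unitmx_inv //; split=> // X Y.
  rewrite !bilin42 /f42 !dot_swap !mul_swap !scale_row_mx !add_row_mx !add0r.
  clearbody h; rewrite !mul_diag !(row_mxKl, row_mxKr) !mulmx1; congr (row_mx (row_mx _ _) _).
  - by rewrite mulmxDl -scalemxAl eqB -mulmxA hg mulmx1.
  - by rewrite -scalemxAl mulmxK.
  rewrite !trmx_mul !mulmxA; congr (_ + _ + _).
    by rewrite -(mulmxA _ g) gh mulmx1.
  by rewrite -(mulmxA _ h) hg mulmx1.
case=> R [T [uR uT]] eqB0.
have eqB X Y : f42 (bilin B) X Y = f42 (bilin A) (X *m R) (Y *m R) *m T.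
  by rewrite -!bilin42.
have H X Y : f42 (bilin B) X Y = 0 -> f42 (bilin A) (X *m R) (Y *m R) = 0.
  by rewrite eqB => /(unitmx_injective uT).
have R0 : ursubmx R = 0 by apply: f42_mark H.
have [ur ua] := unitmx_lower uR R0; rewrite unitmx11 in ua.
set rho := ulsubmx R in ur; set al := _ 0 0 in ua.
pose J := swap_mx n; have uJ : J \in unitmx := swap_mx_unit n.
have Rx x : row_mx x 0 *m R = row_mx (x *m rho) 0.
  by rewrite row_mx_block R0 !mulmx0 !mul0mx !addr0.
have R1 : row_mx 0 1%:M *m R = row_mx (dlsubmx R) (drsubmx R).
  by rewrite row_mx_block !mul0mx !mul1mx !add0r.
have r0 : dlsubmx R = 0.
  apply: trmx_inj; rewrite trmx0; apply/row_matrixP => i; rewrite row0 rowE.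
  have := H (row_mx (delta_mx 0 i *m invmx J *m invmx rho) 0) (row_mx 0 1%:M).
  rewrite Rx R1 mulmxKV // /f42 !(row_mxKl, row_mxKr) !linear0 !bilin0r ?mul0mx ?zero00.
  rewrite !scale0r !addr0 ?trmx0 ?mulmx0 ?row_mx0 -/J mulmxKV //.
  by case/(_ erefl)/row_mx_eq0P.
have Tc : row_mx 0 1%:M = row_mx 0 (al *: drsubmx R) *m T.
  have := eqB (row_mx 0 1%:M) (row_mx 0 1%:M).
  rewrite R1 r0 /f42 !(row_mxKl, row_mxKr) !linear0 !bilin0r ?mul0mx ?scaler0 one00 scale1r.
  by rewrite ?addr0 ?row_mx0 ?add0r.
have Tz (z : 'rV_(n + n)) : row_mx z 0 = row_mx (al *: (z *m J *m rho *m J)) 0 *m T.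
  have := eqB (row_mx 0 1%:M) (row_mx (z *m J) 0).
  rewrite Rx R1 r0 /f42 !(row_mxKl, row_mxKr) !linear0 !bilin0l ?mul0mx ?scaler0 one00 scale1r.
  by rewrite ?addr0 ?row_mx0 ?add0r -/J -(mulmxA z J J) swap_mxK mulmx1.
have eqB1 z z' : al *: (row_mx (bilin B (lsubmx z) (lsubmx z')) 0 *m J *m rho *m J) =
      row_mx (bilin A (lsubmx (z *m rho)) (lsubmx (z' *m rho))) 0 /\
    (al * al) *: (z *m J *m z'^T) = z *m rho *m J *m (z' *m rho)^T.
  have := eqB (row_mx z 0) (row_mx z' 0).
  rewrite !Rx /f42 !(row_mxKl, row_mxKr) !zero00 !scale0r !addr0 -/J.
  set b := row_mx (bilin B _ _) 0; set c := z *m J *m z'^T => eq1.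
  have : row_mx b c = row_mx (al *: (b *m J *m rho *m J)) ((al * al) *: c) *m T.
    have -> : row_mx b c = row_mx b 0 + c 0 0 *: row_mx 0 1%:M.
      by rewrite scale_row_mx add_row_mx scaler0 addr0 add0r scalemx1 -mx11_scalar.
    rewrite (Tz b) Tc [_ *: (_ *m T)]scalemxAl -mulmxDl scale_row_mx add_row_mx scaler0 addr0 add0r.
    congr (row_mx _ _ *m _); rewrite [drsubmx R]mx11_scalar -/al [c in RHS]mx11_scalar.
    by rewrite -!mul_scalar_mx -!scalar_mxM mulrC.
  by rewrite eq1 => /(can_inj (mulmxK uT))/eq_row_mx[-> ->].
have rJr : rho *m J *m rho^T = (al * al) *: J.
  apply: form_mx_inj => z z'; have [_] := eqB1 z z'.
  by rewrite trmx_mul !mulmxA -scalemxAr -scalemxAl => <-.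
(* After multiplication by [rho^T], the left side carries [al] times the [al ^ 2] of [rJr], and the
   right side has three factors [rho]. Dividing rho by [al] thus cancels [al ^ 3]. *)
have [r rhoE u_r] : exists2 r, rho = al *: r & r \in unitmx.
  by exists (al^-1 *: rho); rewrite ?scalerA ?mulfV ?scale1r // unitmxZ // unitfE invr_neq0.
have eqB2 z z' : row_mx (bilin B (lsubmx z) (lsubmx z')) 0 =
    row_mx (bilin A (lsubmx (z *m r)) (lsubmx (z' *m r))) 0 *m r^T.
  have [/(congr1 (mulmx^~ rho^T)) + _] := eqB1 z z'.
  rewrite -scalemxAl -!mulmxA (mulmxA rho) rJr -!scalemxAr swap_mxK mulmx1 rhoE.
  rewrite -2!(scalemxAr al _ r) !linearZ /= bilinZl bilinZr !scale_rowl -!scalemxAl.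
  rewrite !linearZ /= !scalerA => eqs; apply: (scalerI (mulf_neq0 ua (mulf_neq0 ua ua))).
  by rewrite eqs mulrA.
have u_rT : r^T \in unitmx by rewrite unitmx_tr.
have onto x' : exists x : 'rV_(n + n), lsubmx (x *m r) = x'.
  by exists (row_mx x' 0 *m invmx r); rewrite mulmxKV // row_mxKl.
have eqB3 z z' : bilin B (lsubmx z) (lsubmx z') =
      bilin A (lsubmx (z *m r)) (lsubmx (z' *m r)) *m (ulsubmx r)^T /\
    bilin A (lsubmx (z *m r)) (lsubmx (z' *m r)) *m (dlsubmx r)^T = 0.
  have := eqB2 z z'; rewrite row_mx_block !mul0mx !addr0 => /eq_row_mx[-> eqs].
  by rewrite trmx_ulsub trmx_dlsub.
have Al z y : bilin A (z *m dlsubmx r) y = 0.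
  have [y' <-] := onto y; have := eqB2 (row_mx 0 z) y'.
  rewrite lsubmx_row0_mul row_mxKl bilin0l row_mx0 => /esym.
  by move/(unitmx_injective u_rT)/row_mx_eq0P=> [].
have Ar z y : bilin A y (z *m dlsubmx r) = 0.
  have [y' <-] := onto y; have := eqB2 y' (row_mx 0 z).
  rewrite lsubmx_row0_mul row_mxKl bilin0r row_mx0 => /esym.
  by move/(unitmx_injective u_rT)/row_mx_eq0P=> [].
have At x y : bilin A x y *m (dlsubmx r)^T = 0.
  by have [[x' <-] [y' <-]] := (onto x, onto y); have [] := eqB3 x' y'.
have [M uM] := unit_ulsubmx_completion u_r.
exists (ulsubmx r + ursubmx r *m M *m dlsubmx r) => // x y.
have [+ _] := eqB3 (row_mx x 0) (row_mx y 0).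
rewrite !lsubmx_rowl_mul !row_mxKl => ->.
rewrite !mulmxDr !mulmxA bilinDl !bilinDr !(Al, Ar) !addr0.
by rewrite linearD /= mulmxDr !trmx_mul !mulmxA At !mul0mx addr0.
Qed.

End Red42.

(** * Reduction of action 1 to action 3 *)

Section Red13.
Variable F : fieldType.

Definition r13 : recipe :=
  let z := NConst 0 in
  let n := NVar 0 in let m := NVar 1 in let l := NVar 2 in
  Recipe (NAdd n m) (NAdd n m) (NAdd l (NConst 1))
    (EAdd (eplace z n z EGet) (eplace z z l (eid3 n))).

Variables n m l : nat.

(** Under action 3 the slices are square matrices up to conjugation. Those of A are placed in an
    off-diagonal corner, hence square to 0; the additional slice is an identity in a diagonal
    corner, hence is not nilpotent unless n is 0. *)
Definition f13 (A : 'rV[F]_n -> 'rV[F]_m -> 'rV[F]_l) (X Y : 'rV[F]_(n + m)) :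
    'rV[F]_(l + 1) :=
  row_mx (A (lsubmx X) (rsubmx Y)) (lsubmx X *m (lsubmx Y)^T).

Definition t13 (A : tensor F n m l) : tensor F (n + m) (n + m) (l + 1) :=
  ntens _ _ _ (fun i j k => place 0 n 0 (aget (Array A)) i j k +
    place 0 0 l (id3 F n) i j k).

Lemma build13 (A : tensor F n m l) : build r13 (Array A) = Array (t13 A).
Proof. by []. Qed.

Lemma bilin13 (A : tensor F n m l) X Y : bilin (t13 A) X Y = f13 (bilin A) X Y.
Proof.
rewrite /t13 !bilin_ntensD (bilin_place _ _ _ _ _ _ (@aget_out F (Array A))).
rewrite (bilin_place _ _ _ _ _ _ (@id3_out F n)).
rewrite /= ntens_aget bilin_id3; shift_simp.
by rewrite add_row_mx add0r addr0.
Qed.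

Lemma bilin_form (A : tensor F n m l) (c : 'cV[F]_l) :
  exists M : 'M_(n, m), forall x y, bilin A x y *m c = x *m M *m y^T.
Proof.
exists (\matrix_(i, j) \sum_k A (i, j, k) * c k 0) => x y.
apply/matrixP => i0 j0; rewrite !ord1 !mxE.
under eq_bigr => k _ do (rewrite !mxE mulr_suml; under eq_bigr => i _ do rewrite mulr_suml).
under [RHS]eq_bigr => j _ do
  (rewrite !mxE mulr_suml; under eq_bigr => i _ do rewrite !mxE mulr_sumr mulr_suml).
rewrite exchange_big; under eq_bigr => i _ do rewrite exchange_big.
rewrite exchange_big; apply: eq_bigr => j _; apply: eq_bigr => i _.
by apply: eq_bigr => k _; ring.
Qed.

(* The matrices of [f13 B] at functionals killing the last coordinate are
   nilpotent, and t%:M in the upper left corner is not, unless t = 0. *)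
Lemma f13_mark (A B : tensor F n m l) R S T : (0 < n)%N -> S^T *m R = 1%:M ->
  (forall X Y, f13 (bilin B) X Y = f13 (bilin A) (X *m R) (Y *m S) *m T) ->
  dlsubmx T = 0.
Proof.
move=> n_gt0 SR eqB; apply: trmx_inj; rewrite trmx0.
apply/row_matrixP => k; rewrite row0 rowE; set phi := delta_mx 0 k.
apply: trmx_inj; rewrite trmx_mul trmxK trmx0; set c := phi^T.
have [N eqN] := bilin_form B c; have [M eqM] := bilin_form A (ulsubmx T *m c).
set t := dlsubmx T *m c.
pose N1 : 'M[F]_(n + m) := block_mx 0 N 0 0.
pose M1 : 'M[F]_(n + m) := block_mx (t 0 0)%:M M 0 (0 : 'M_m).
have formE (a : 'M_n) (b : 'M_(n, m)) (X Y : 'rV_(n + m)) :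
    X *m block_mx a b 0 0 *m Y^T =
    lsubmx X *m a *m (lsubmx Y)^T + lsubmx X *m b *m (rsubmx Y)^T.
  rewrite -{1}[X]hsubmxK -{1}[Y]hsubmxK mul_row_block !mulmx0 !addr0 tr_row_mx.
  by rewrite mul_row_col.
have N1E X Y : f13 (bilin B) X Y *m col_mx c 0 = X *m N1 *m Y^T.
  by rewrite formE /f13 mul_row_col mulmx0 addr0 eqN mulmx0 mul0mx add0r.
have M1E X Y : f13 (bilin A) X Y *m T *m col_mx c 0 = X *m M1 *m Y^T.
  rewrite formE /f13 row_mx_block mul_row_col mulmx0 addr0 mulmxDl -(mulmxA _ _ c) eqM.
  rewrite addrC -(mulmxA _ _ c) -/t {1}[t]mx11_scalar !mul_mx_scalar.
  by rewrite scalemxAl.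
(* Since [S^T *m R = 1], this is a conjugation, and a vanishing square is transported along it. *)
have N1M1 : N1 = R *m M1 *m S^T.
  apply: form_mx_inj => X Y; rewrite -N1E eqB M1E trmx_mul !mulmxA.
  by [].
have N1sq : N1 *m N1 = 0.
  by rewrite mulmx_block !mulmx0 !mul0mx !addr0 -block_mx0.
have RS : R *m S^T = 1%:M by rewrite (mulmx1C SR).
have M1sq : M1 *m M1 = 0.
  have -> : M1 = S^T *m N1 *m R by rewrite N1M1 !mulmxA SR mul1mx -mulmxA SR mulmx1.
  by rewrite -!mulmxA (mulmxA R) RS mul1mx (mulmxA N1) N1sq mul0mx mulmx0.
move: M1sq; rewrite /M1; clearbody t; rewrite mulmx_block !mulmx0 !addr0 -scalar_mxM -block_mx0.
move=> /eq_block_mx[/matrixP/(_ (Ordinal n_gt0) (Ordinal n_gt0))/eqP + _ _ _].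
rewrite !mxE eqxx mulf_eq0 orbb => /eqP t0.
by apply/matrixP => i j; rewrite !ord1 t0 mxE.
Qed.

Lemma red13 (A B : tensor F n m l) :
  same_orbit Act1 (Array A) (Array B) <-> same_orbit Act3 (Array (t13 A)) (Array (t13 B)).
Proof.
rewrite {1}same_orbit1P same_orbit3P; split=> [[g [h [t [ug uh ut eqB]]]]|].
  exists (block_mx g 0 0 (invmx h)^T), (block_mx t 0 0 1%:M).
  have uh' : (invmx h)^T \in unitmx by rewrite unitmx_tr unitmx_inv.
  rewrite !unitmx_diag ?unitmx1 //; split=> // X Y; rewrite !bilin13 /f13.
  rewrite invmx_diag // tr_block_mx !trmx0 [(invmx _^T)^T]trmx_inv !trmxK invmxK !mul_diag.
  rewrite !(row_mxKl, row_mxKr) eqB mulmx1; congr row_mx.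
  by rewrite trmx_mul trmxK mulmxA mulmxK.
(* The nilpotency argument needs a nonempty scalar block; for [n = 0] there is only one array. *)
have [n0|n_gt0] := posnP n.
  suff -> : B = A by move=> _; apply/same_orbit1P/same_orbit1_refl.
  by apply/ffunP => -[[[i lt_i] j] k]; exfalso; rewrite n0 in lt_i.
case=> R [T [uR uT]]; set S := (invmx R)^T => eqB0.
have SR : S^T *m R = 1%:M by rewrite trmxK mulVmx.
have uS : S \in unitmx by rewrite unitmx_tr unitmx_inv.
have eqB X Y : f13 (bilin B) X Y = f13 (bilin A) (X *m R) (Y *m S) *m T.
  by rewrite -!bilin13.
have T0 := f13_mark n_gt0 SR eqB; have [ut _] := unitmx_upper uT T0.
clearbody S.
(* Under B a vector of the second block annihilates from the left. Under A the last output
   coordinate pairs the first part of its image with an arbitrary u. *)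
have R0 : dlsubmx R = 0.
  apply/row_matrixP => i; rewrite row0 rowE; apply: dot_inj => u; rewrite mul0mx.
  have := eqB (row_mx 0 (delta_mx 0 i)) (row_mx u 0 *m invmx S).
  rewrite mulmxKV // /f13 lsubmx_row0_mul !(row_mxKl, row_mxKr) ?linear0 bilin0l mul0mx row_mx0.
  by move/esym/(unitmx_injective uT)/row_mx_eq0P=> [].
have [ua ud] := unitmx_upper uR R0.
have S0 : ursubmx S = 0.
  have RTS : R^T *m S = 1%:M by rewrite -[S]trmxK -trmx_mul SR trmx1.
  have := mulmx1C RTS; rewrite -{1}[S]submxK -[R]submxK tr_block_mx R0 trmx0 mulmx_block (@scalar_mx_block _ n m).
  move=> /eq_block_mx[_ + _ _]; rewrite mulmx0 add0r; apply: unitmx_injective.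
  by rewrite unitmx_tr.
have [_ us] := unitmx_lower uS S0.
exists (ulsubmx R), (drsubmx S), (ulsubmx T); split=> // x y.
have := eqB (row_mx x 0) (row_mx 0 y).
rewrite /f13 lsubmx_rowl_mul rsubmx_row_mul mul0mx add0r !(row_mxKl, row_mxKr) row_mx_block.
by rewrite T0 mulmx0 addr0 => /eq_row_mx[].
Qed.

End Red13.

(** * Reductions of action 1 to associative and Lie algebras *)

Section Red15.
Variable F : fieldType.

Definition r15a : recipe :=
  let z := NConst 0 in let o := NConst 1 in
  let n := NVar 0 in let m := NVar 1 in let l := NVar 2 in
  let q := NAdd o (NAdd (NAdd n l) m) in
  Recipe q q q
    (EAdd (eplace z z z (eid1 o))
    (EAdd (eplace z o o (eid1 (NAdd n l)))
          (eplace o (NAdd o (NAdd n l)) (NAdd o n) EGet))).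

Definition r15l : recipe :=
  let z := NConst 0 in let o := NConst 1 in
  let n := NVar 0 in let m := NVar 1 in let l := NVar 2 in
  let q := NAdd o (NAdd (NAdd n l) m) in
  Recipe q q q
    (EAdd (EAdd (eplace z o o (eid1 (NAdd n l)))
                (EOpp (eplace o z o (eid2 (NAdd n l)))))
          (EAdd (eplace o (NAdd o (NAdd n l)) (NAdd o n) EGet)
                (EOpp (eplace (NAdd o (NAdd n l)) o (NAdd o n) (fun a b c => EGet b a c))))).

Variables n m l : nat.
Notation N := (1 + (n + l + m))%N.
Implicit Types (X Y Z : 'rV[F]_N) (A B : tensor F n m l).

Definition ecoef X : F := lsubmx X 0 0.
Definition uwpart X : 'rV[F]_(n + l) := lsubmx (rsubmx X).
Definition upart X : 'rV[F]_n := lsubmx (uwpart X).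
Definition vpart X : 'rV[F]_m := rsubmx (rsubmx X).

(** On a basis of one e, followed by vectors u, w and v (n, l and m of them), the nonzero products
    are [e e = e], [e u = u], [e w = w], and [u v] given by A as a combination of the w. *)
Definition f15a A X Y : 'rV[F]_N :=
  row_mx (ecoef X *: lsubmx Y)
    (row_mx (ecoef X *: uwpart Y + row_mx 0 (bilin A (upart X) (vpart Y))) 0).

(** This is the commutator of [f15a], which is alternating in every characteristic. *)
Definition f15l A X Y : 'rV[F]_N :=
  row_mx 0
    (row_mx (ecoef X *: uwpart Y - ecoef Y *: uwpart X
       + row_mx 0 (bilin A (upart X) (vpart Y) - bilin A (upart Y) (vpart X))) 0).

Definition t15a A : tensor F N N N :=
  ntens _ _ _ (fun i j k => place 0 0 0 (id1 F 1) i j k +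
    (place 0 1 1 (id1 F (n + l)) i j k +
     place 1 (1 + (n + l)) (1 + n) (aget (Array A)) i j k)).

Definition t15l A : tensor F N N N :=
  ntens _ _ _ (fun i j k => (place 0 1 1 (id1 F (n + l)) i j k +
     (- place 1 0 1 (id2 F (n + l)) i j k)) +
    (place 1 (1 + (n + l)) (1 + n) (aget (Array A)) i j k +
     (- place (1 + (n + l)) 1 (1 + n) (fun a b c => aget (Array A) b a c) i j k))).

Lemma build15a A : build r15a (Array A) = Array (t15a A).
Proof. by []. Qed.

Lemma build15l A : build r15l (Array A) = Array (t15l A).
Proof. by []. Qed.

Lemma bilin15a A X Y : bilin (t15a A) X Y = f15a A X Y.
Proof.
rewrite /t15a !bilin_ntensD (bilin_place _ _ _ _ _ _ (@aget_out F (Array A))).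
rewrite (bilin_place _ _ _ _ _ _ (@id1_out F 1)) (bilin_place _ _ _ _ _ _ (@id1_out F (n + l))).
rewrite [dim1 _]/= [dim2 _]/= [dim3 _]/= ntens_aget !bilin_id1; shift_simp.
by rewrite !add_row_mx ?add0r ?addr0.
Qed.

Lemma bilin_swap A x y :
  bilin (ntens m n l (fun a b c => aget (Array A) b a c)) x y = bilin A y x.
Proof.
apply/rowP => k; rewrite !mxE exchange_big; apply: eq_bigr => i _.
apply: eq_bigr => j _; rewrite ffunE (@aget_ord F (Array A)) /=; ring.
Qed.

Lemma bilin15l A X Y : bilin (t15l A) X Y = f15l A X Y.
Proof.
have out a b c : ~~ [&& a < m, b < n & c < l]%N -> aget (Array A) b a c = 0.
  by move=> h; apply: aget_out; apply: contra h => /= /and3P[-> -> ->].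
rewrite /t15l !bilin_ntensD !bilin_ntensN (bilin_place _ _ _ _ _ _ (@aget_out F (Array A))).
rewrite (bilin_place _ _ _ _ _ _ (@id1_out F (n + l))) (bilin_place _ _ _ _ _ _ (@id2_out F (n + l))).
rewrite (bilin_place _ _ _ _ _ _ out) bilin_swap.
rewrite [dim1 _]/= [dim2 _]/= [dim3 _]/= ntens_aget bilin_id1 bilin_id2; shift_simp.
by rewrite !opp_row_mx !add_row_mx ?oppr0 ?add0r ?addr0.
Qed.

Lemma ecoef_row (a : 'rV[F]_1) x : ecoef (row_mx a x) = a 0 0.
Proof. by rewrite /ecoef row_mxKl. Qed.

Lemma uwpart_row (a : 'rV[F]_1) x y : uwpart (row_mx a (row_mx x y)) = x.
Proof. by rewrite /uwpart row_mxKr row_mxKl. Qed.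

Lemma upart_row (a : 'rV[F]_1) x y : upart (row_mx a (row_mx x y)) = lsubmx x.
Proof. by rewrite /upart uwpart_row. Qed.

Lemma vpart_row (a : 'rV[F]_1) x y : vpart (row_mx a (row_mx x y)) = y.
Proof. by rewrite /vpart !row_mxKr. Qed.

Definition partE := (ecoef_row, uwpart_row, upart_row, vpart_row).

Lemma alg_mulE k (C : tensor F k k k) x y : alg_mul C x y = bilin C x y.
Proof. by []. Qed.

Lemma assoc15a A : associative (alg_mul (t15a A)).
Proof.
move=> X Y Z; rewrite !alg_mulE !bilin15a /f15a !partE row_mxKl.
rewrite bilin0r row_mx0 addr0 mxE scalerA !linearD !linearZ /= row_mxKl addr0 bilinZl.
by rewrite -!/(ecoef _) -!/(upart _) scalerA [ecoef Y * _]mulrC scale_row_mx scaler0.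
Qed.

Lemma lie15l_alt A X : alg_mul (t15l A) X X = 0.
Proof.
rewrite alg_mulE bilin15l /f15l.
by rewrite !subrr add0r !row_mx0.
Qed.

Lemma lie15l_jacobi A X Y Z :
  alg_mul (t15l A) X (alg_mul (t15l A) Y Z) + alg_mul (t15l A) Y (alg_mul (t15l A) Z X) +
  alg_mul (t15l A) Z (alg_mul (t15l A) X Y) = 0.
Proof.
rewrite !alg_mulE !bilin15l /f15l !partE !zero00 !scale0r !subr0.
rewrite !bilin0r !sub0r !add_row_mx !addr0 !linearD !linearN !linearZ /= !row_mxKl !addr0.
rewrite -[RHS](row_mx0 _ _ 1 (n + l + m)) -(row_mx0 _ _ (n + l) m); congr (row_mx _ (row_mx _ _)).
rewrite -[uwpart X]hsubmxK -[uwpart Y]hsubmxK -[uwpart Z]hsubmxK -!/(upart _).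
rewrite !(scale_row_mx, opp_row_mx, add_row_mx) -row_mx0.
move: (upart X) (upart Y) (upart Z) (rsubmx (uwpart X)) (rsubmx (uwpart Y)) (rsubmx (uwpart Z)).
move: (vpart X) (vpart Y) (vpart Z) (ecoef X) (ecoef Y) (ecoef Z).
move=> vx vy vz ex ey ez ux uy uz wx wy wz; congr row_mx.
  apply/rowP => k; rewrite !mxE; ring.
rewrite !row_mxKl !(bilinDl, bilinNl, bilinZl).
move: (bilin A ux vy) (bilin A ux vz) (bilin A uy vx) (bilin A uy vz) (bilin A uz vx) (bilin A uz vy).
move=> b1 b2 b3 b4 b5 b6.
by apply/rowP => k; rewrite !mxE; ring.
Qed.

(** K may mix the u with the w, so two blocks are completed. The correction on the u side is
    invisible since A annihilates the rows of [dlsubmx K]; the one on the w side is invisible since,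
    by the first component of the equation, [dlsubmx K] annihilates the values of B. *)
Lemma orbit1_of_blocks A B (K : 'M[F]_(n + l)) q : K \in unitmx -> q \in unitmx ->
  (forall u v, row_mx 0 (bilin B u v) *m K = row_mx 0 (bilin A (u *m ulsubmx K) (v *m q))) ->
  (forall w v, bilin A (w *m dlsubmx K) (v *m q) = 0) ->
  same_orbit Act1 (Array A) (Array B).
Proof.
move=> uK uq eqB A0; apply/same_orbit1P.
have [M uM] := unit_ulsubmx_completion uK; have [M' uM'] := unit_drsubmx_completion uK.
exists (ulsubmx K + ursubmx K *m M *m dlsubmx K), q.
exists (invmx (drsubmx K + dlsubmx K *m M' *m ursubmx K)).
rewrite unitmx_inv; split=> // u v; apply: (can_inj (mulmxK uM')); rewrite mulmxKV //.
have := eqB u v; rewrite row_mx_block !mul0mx !add0r => /eq_row_mx[eq1 eq2].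
rewrite [LHS]mulmxDr !mulmxA eq1 !mul0mx addr0 eq2.
by rewrite mulmxDr !mulmxA bilinDl A0 addr0.
Qed.

Lemma uw_mul (R : 'M[F]_N) (x : 'rV_(n + l)) (y : 'rV_m) : dlsubmx R = 0 ->
  row_mx 0 (row_mx x y) *m R = row_mx 0 (row_mx x y *m drsubmx R).
Proof. by move=> R0; rewrite row_mx_block !mul0mx R0 mulmx0 !add0r. Qed.

(** Once R is triangular with respect to e and to the v, only the products of a vector from u and w
    by a v matter, and on these the associative and the Lie product coincide. *)
Lemma red15_tail (f : tensor F n m l -> 'rV[F]_N -> 'rV[F]_N -> 'rV[F]_N) A B (R : 'M[F]_N) :
  (forall C uw uw' v, f C (row_mx 0 (row_mx uw 0)) (row_mx 0 (row_mx uw' v)) =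
     row_mx 0 (row_mx (row_mx 0 (bilin C (lsubmx uw) v)) 0)) ->
  R \in unitmx -> dlsubmx R = 0 -> ursubmx (drsubmx R) = 0 ->
  (forall X Y, f B X Y *m R = f A (X *m R) (Y *m R)) ->
  same_orbit Act1 (Array A) (Array B).
Proof.
move=> fE uR R0 R1 eqB; have [_ uS] := unitmx_upper uR R0.
set S := drsubmx R in uS R1; have [uK uq] := unitmx_lower uS R1.
have eqB1 uw v : row_mx 0 (bilin B (lsubmx uw) v) *m ulsubmx S =
    row_mx 0 (bilin A (lsubmx (uw *m ulsubmx S)) (v *m drsubmx S)).
  have := eqB (row_mx 0 (row_mx uw 0)) (row_mx 0 (row_mx 0 v)).
  rewrite fE !uw_mul // -/S !row_mx_block R1 !mulmx0 !mul0mx !addr0 !add0r fE.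
  by move=> /eq_row_mx[_] /eq_row_mx[].
apply: (orbit1_of_blocks uK uq) => [u v|w v].
  by have := eqB1 (row_mx u 0) v; rewrite row_mxKl lsubmx_rowl_mul.
have := eqB1 (row_mx 0 w) v; rewrite row_mxKl lsubmx_row0_mul bilin0l row_mx0 mul0mx.
by move=> /esym/row_mx_eq0P[].
Qed.

Lemma red15_forward g h t :
  g \in unitmx -> h \in unitmx -> t \in unitmx ->
  let R := block_mx 1%:M 0 0 (block_mx (block_mx g 0 0 (invmx t)) 0 0 h) : 'M[F]_N in
  [/\ R \in unitmx, forall X, ecoef (X *m R) = ecoef X,
      forall X, lsubmx (X *m R) = lsubmx X,
      forall X, uwpart (X *m R) = uwpart X *m block_mx g 0 0 (invmx t) &
      forall X, vpart (X *m R) = vpart X *m h].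
Proof.
move=> ug uh ut R; split.
- by rewrite !unitmx_diag ?unitmx1 ?unitmx_inv.
- by move=> X; rewrite /ecoef mul_diag row_mxKl mulmx1.
- by move=> X; rewrite mul_diag row_mxKl mulmx1.
- by move=> X; rewrite /uwpart !mul_diag row_mxKr !row_mxKl.
- by move=> X; rewrite /vpart !mul_diag !row_mxKr.
Qed.

Lemma red15a A B :
  same_orbit Act1 (Array A) (Array B) <-> same_orbit Act5 (Array (t15a A)) (Array (t15a B)).
Proof.
rewrite same_orbit5P; split=> [/same_orbit1P[g [h [t [ug uh ut eqB]]]]|[R uR eqB0]].
  have [] := red15_forward ug uh ut; set R := block_mx 1%:M _ _ _.
  move=> uR eR lR uwR vR; exists R => // X Y; rewrite !bilin15a.
  apply: (can_inj (mulmxK uR)); rewrite mulmxKV // {1 2}/f15a eR lR uwR vR /upart uwR.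
  rewrite !mul_diag !(row_mxKl, row_mxKr) mulmx1 mul0mx; congr (row_mx _ (row_mx _ _)).
  rewrite !linearD /= !linearZ /= row_mxKl row_mxKr scale_row_mx add_row_mx !addr0.
  by rewrite mulmxDl -!scalemxAl eqB mulmxK.
have eqB X Y : f15a B X Y *m R = f15a A (X *m R) (Y *m R).
  by rewrite -!bilin15a eqB0 mulmxKV.
(* A vector without e-coordinate satisfies [X (X X) = 0], whereas the e-coordinate of [X (X X)] is
   always the cube of that of X. *)
have R0 : dlsubmx R = 0.
  apply/row_matrixP => i; rewrite row0 rowE; set x := delta_mx 0 i.
  pose X : 'rV[F]_N := row_mx 0 x.
  have f0 : f15a B X (f15a B X X) = 0.
    by rewrite /f15a !partE zero00 !scale0r bilin0r ?add0r !row_mx0.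
  have := eqB X (f15a B X X); rewrite f0 mul0mx eqB {1}/f15a => /esym/row_mx_eq0P[+ _].
  rewrite /f15a row_mxKl /ecoef lsubmx_row0_mul scalerA => /eqP.
  by rewrite scaler_eq0 mulf_eq0 orbb => /orP[|]/eqP // x0;
     apply/matrixP => a b; rewrite !ord1 x0 mxE.
have [uc _] := unitmx_upper uR R0.
apply: (@red15_tail f15a A B R) => // [C uw uw' v|].
  by rewrite /f15a !partE zero00 !scale0r add0r.
(* A combination x of the u and w equals [e x]; its image is therefore a product, and products have
   no v part. *)
apply/row_matrixP => i; rewrite row0 rowE; set x := delta_mx 0 i.
have := eqB (row_mx 1%:M 0) (row_mx 0 (row_mx x 0)).
rewrite {1}/f15a !partE row_mxKl one00 !scale1r bilin0r row_mx0 addr0 uw_mul // /f15a.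
by move=> /eq_row_mx[_]; rewrite row_mx_block => /eq_row_mx[_]; rewrite mul0mx addr0.
Qed.

Lemma red15l A B :
  same_orbit Act1 (Array A) (Array B) <-> same_orbit Act5 (Array (t15l A)) (Array (t15l B)).
Proof.
rewrite same_orbit5P; split=> [/same_orbit1P[g [h [t [ug uh ut eqB]]]]|].
  have [] := red15_forward ug uh ut; set R := block_mx 1%:M _ _ _.
  move=> uR eR lR uwR vR; exists R => // X Y; rewrite !bilin15l.
  apply: (can_inj (mulmxK uR)); rewrite mulmxKV // {1 2}/f15l !eR !uwR !vR /upart !uwR.
  rewrite !mul_diag !(row_mxKl, row_mxKr) mulmx1 mul0mx; congr row_mx; congr row_mx.
  rewrite !(scale_row_mx, opp_row_mx, add_row_mx) !linearD /= !linearN /= !linearZ /=.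
  rewrite row_mxKl row_mxKr !addr0; congr row_mx; first by rewrite mulmxDl -!scalemxAl mulNmx.
  by rewrite !mulmxDl -!scalemxAl !mulNmx !eqB !mulmxK.
(* A nonzero w is used below to detect e-coordinates; for [l = 0] there is only one array. *)
have [l0|l_gt0] := posnP l.
  move=> _; suff -> : B = A by apply: same_orbit1_refl.
  by apply/ffunP => -[ij [k lt_k]]; exfalso; rewrite l0 in lt_k.
case=> R uR eqB0.
have eqB X Y : f15l B X Y *m R = f15l A (X *m R) (Y *m R).
  by rewrite -!bilin15l eqB0 mulmxKV.
pose K := lsubmx (rsubmx (usubmx (dsubmx R))).
(* Here [x = [e, x]] is a bracket, and all brackets lie in the span of the u and w. *)
have Ruw (x : 'rV_(n + l)) : row_mx 0 (row_mx x 0) *m R = row_mx 0 (row_mx (x *m K) 0).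
  have := eqB (row_mx 1%:M 0) (row_mx 0 (row_mx x 0)).
  rewrite {1}/f15l !partE one00 zero00 scale1r scale0r subr0 bilin0r.
  rewrite {1}/vpart row_mxKr !linear0 bilin0r subrr row_mx0 addr0 => eqX.
  have <- : uwpart (row_mx 0 (row_mx x 0) *m R) = x *m K.
    by rewrite /uwpart mul_row0_mx mul_rowl_mx mulmx_lsub mulmx_rsub.
  by rewrite eqX /f15l uwpart_row.
have uK : K \in unitmx.
  apply: unit_mx_of_injective => x xK.
  have /(unitmx_injective uR)/row_mx_eq0P[_ /row_mx_eq0P[]] // :
    row_mx 0 (row_mx x 0) *m R = 0 by rewrite Ruw xK !row_mx0.
have f_uw C X (x : 'rV_(n + l)) : f15l C X (row_mx 0 (row_mx x 0)) =
    row_mx 0 (row_mx (ecoef X *: x - row_mx 0 (bilin C (lsubmx x) (vpart X))) 0).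
  by rewrite /f15l !partE zero00 scale0r subr0 bilin0r sub0r opp_row_mx oppr0.
(* Bracketing twice with a combination of the v annihilates the span of the u and w under B. Under
   A, bracketing with the image scales each w by its e-coordinate, whose square must then be 0. *)
have ev v : ecoef (row_mx 0 (row_mx 0 v) *m R) = 0.
  set X := row_mx 0 (row_mx 0 v); pose w : 'rV[F]_l := const_mx 1.
  pose Y : 'rV[F]_N := row_mx 0 (row_mx (row_mx 0 w *m invmx K) 0).
  have YR : Y *m R = row_mx 0 (row_mx (row_mx 0 w) 0) by rewrite Ruw mulmxKV.
  have fXX : f15l B X (f15l B X Y) = 0.
    rewrite !f_uw !partE zero00 !scale0r !sub0r oppr0 add0r row_mxKl bilin0l.
    by rewrite !row_mx0 oppr0 !row_mx0.
  have fw (w' : 'rV_l) : f15l A (X *m R) (row_mx 0 (row_mx (row_mx 0 w') 0)) =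
      row_mx 0 (row_mx (row_mx 0 (ecoef (X *m R) *: w')) 0).
    by rewrite f_uw row_mxKl bilin0l row_mx0 subr0 scale_row_mx scaler0.
  have := eqB X (f15l B X Y); rewrite [f15l B X Y *m R]eqB YR !fw fXX mul0mx => /esym.
  move=> /row_mx_eq0P[_ /row_mx_eq0P[/row_mx_eq0P[_ ew] _]].
  move/matrixP/(_ 0 (Ordinal l_gt0)): ew; rewrite scalerA !mxE mulr1 => /eqP.
  by rewrite mulf_eq0 orbb => /eqP.
have R0 : dlsubmx R = 0.
  apply/row_matrixP => i; rewrite row0 rowE -lsubmx_row0_mul.
  set x := delta_mx 0 i; rewrite -[x]hsubmxK.
  have -> : row_mx 0 (row_mx (lsubmx x) (rsubmx x)) =
      row_mx 0 (row_mx (lsubmx x) 0) + row_mx 0 (row_mx 0 (rsubmx x)) :> 'rV[F]_N.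
    by rewrite !add_row_mx !add0r addr0.
  rewrite mulmxDl Ruw linearD /= row_mxKl add0r.
  by apply/matrixP => a b; rewrite !ord1 -[LHS]/(ecoef _) ev mxE.
apply: (@red15_tail f15l A B R) => // [C uw uw' v|].
  by rewrite /f15l !partE zero00 !scale0r subr0 add0r bilin0r subr0.
apply/row_matrixP => i; rewrite row0 rowE; have := Ruw (delta_mx 0 i).
rewrite uw_mul // row_mx_block => /eq_row_mx[_ /eq_row_mx[_]].
by rewrite mul0mx addr0.
Qed.

End Red15.

(** * Reduction of action 1 to (skew-)symmetric slices *)

Definition esign (b : bool) (e : ent) : ent := if b then EOpp e else e.

Section Signed.
Variable F : fieldType.

Definition nsign (b : bool) (x : F) : F := if b then - x else x.

Lemma bilin_ntens_sign n m l b (T : nat -> nat -> nat -> F) x y :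
  bilin (ntens n m l (fun i j k => nsign b (T i j k))) x y =
  (-1) ^+ b *: bilin (ntens n m l T) x y.
Proof. by case: b; rewrite ?scale1r // scaleN1r -bilin_ntensN. Qed.

(** The hyperbolic form, symmetric or skew according to b, and nondegenerate in every
    characteristic. *)
Definition hyp_mx (b : bool) k : 'M[F]_(k + k) :=
  block_mx 0 1%:M ((-1) ^+ b)%:M 0.

Lemma dot_hyp b k p q (x : 'M[F]_(p, k + k)) (y : 'M[F]_(q, k + k)) :
  x *m hyp_mx b k *m y^T =
  lsubmx x *m (rsubmx y)^T + (-1) ^+ b *: (rsubmx x *m (lsubmx y)^T).
Proof.
rewrite -{1}[x]hsubmxK -{1}[y]hsubmxK mul_row_block tr_row_mx mul_row_col.
by rewrite !mulmx0 mulmx1 add0r addr0 mul_mx_scalar -scalemxAl addrC.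
Qed.

Lemma hyp_mx_unit b k : hyp_mx b k \in unitmx.
Proof.
have sq : hyp_mx b k *m hyp_mx b k = ((-1) ^+ b)%:M.
  rewrite mulmx_block !mulmx0 !mul0mx !addr0 !add0r mul1mx mulmx1.
  by rewrite (@scalar_mx_block _ k k).
have /mulmx1_unit[] // : hyp_mx b k *m ((-1) ^+ b *: hyp_mx b k) = 1%:M.
by rewrite -scalemxAr sq scale_scalar_mx -expr2 sqrr_sign.
Qed.

Lemma hyp_mx_sym b k (x y : 'rV[F]_(k + k)) :
  y *m hyp_mx b k *m x^T = (-1) ^+ b *: (x *m hyp_mx b k *m y^T).
Proof.
have tr11 (M : 'M[F]_1) : M^T = M by apply/matrixP => i j; rewrite mxE !ord1.
rewrite !dot_hyp scalerDr scalerA -expr2 sqrr_sign scale1r addrC.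
by congr (_ *: _ + _); rewrite -[RHS]tr11 trmx_mul trmxK.
Qed.

(** Any invertible g on one isotropic half extends to an isometry, by acting contragrediently on the
    other half. *)
Lemma hyp_mx_isom b k (g : 'M[F]_k) p q (x : 'M[F]_(p, k + k)) (y : 'M[F]_(q, k + k)) :
  g \in unitmx -> let d := block_mx g 0 0 (invmx g)^T in
  (x *m d) *m hyp_mx b k *m (y *m d)^T = x *m hyp_mx b k *m y^T.
Proof.
move=> ug d; rewrite !dot_hyp !mul_diag !(row_mxKl, row_mxKr) !trmx_mul trmxK.
rewrite !mulmxA mulmxK //; congr (_ + _ *: (_ *m _)).
by rewrite -mulmxA -trmx_mul mulmxV // trmx1 mulmx1.
Qed.

(** Padding vectors have [psi] value 0, so [phi] vanishes on the rows of [dlsubmx a] and does not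
    see the completing term. The type [I] carries the remaining arguments of the forms to which this
    is applied. *)
Lemma unpad_unitmx n k (I : Type) (V : zmodType) (phi psi : 'rV[F]_n -> I -> V)
    (a : 'M[F]_(n + k)) : a \in unitmx ->
  (forall x y i, phi (x + y) i = phi x i + phi y i) ->
  (forall (x : 'rV_(n + k)) i, psi (lsubmx x) i = phi (lsubmx (x *m a)) i) ->
  exists2 g, g \in unitmx & forall x i, psi x i = phi (x *m g) i.
Proof.
move=> ua phiD eq_phi; have [M uM] := unit_ulsubmx_completion ua.
have phi0 i : phi 0 i = 0 by apply: (addrI (phi 0 i)); rewrite -phiD !addr0.
have psi0 i : psi 0 i = 0.
  by have := eq_phi 0 i; rewrite mul0mx !linear0 phi0.
exists (ulsubmx a + ursubmx a *m M *m dlsubmx a) => // x i.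
have -> : psi x i = phi (x *m ulsubmx a) i.
  by rewrite -lsubmx_rowl_mul -eq_phi row_mxKl.
rewrite mulmxDr phiD !mulmxA -[_ *m dlsubmx a]lsubmx_row0_mul.
by rewrite -[in X in _ + X]eq_phi row_mxKl psi0 addr0.
Qed.

(** D is the Schur complement: the vector y is corrected inside the first block so as to cancel the
    first part of its image. *)
Lemma schur_unitmx n m (R : 'M[F]_(n + m)) : R \in unitmx -> ulsubmx R \in unitmx ->
  exists2 D, D \in unitmx & forall y : 'rV_m,
    row_mx (- (y *m dlsubmx R *m invmx (ulsubmx R))) y *m R = row_mx 0 (y *m D).
Proof.
move=> uR ua; exists (drsubmx R - dlsubmx R *m invmx (ulsubmx R) *m ursubmx R).
  apply: unit_mx_of_injective => y yD.
  have /(unitmx_injective uR)/row_mx_eq0P[] // :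
    row_mx (- (y *m dlsubmx R *m invmx (ulsubmx R))) y *m R = 0.
  rewrite row_mx_block !mulNmx mulmxKV // addNr -[X in row_mx _ X]addrC.
  by rewrite -!mulmxA -mulmxBr !mulmxA yD row_mx0.
move=> y; rewrite row_mx_block !mulNmx mulmxKV // addNr -[X in row_mx _ X]addrC.
by rewrite -!mulmxA -mulmxBr.
Qed.

End Signed.

Section Red12.
Variable F : fieldType.

Definition r12 (b : bool) : recipe :=
  let z := NConst 0 in
  let n := NVar 0 in let m := NVar 1 in let l := NVar 2 in
  let p := NAdd n (NConst 1) in let q := NAdd p p in
  Recipe (NAdd q m) (NAdd q m) (NAdd l (NConst 1))
    (EAdd (EAdd (eplace z q z EGet)
                (esign b (eplace q z z (fun a b c => EGet b a c))))
          (EAdd (eplace z p l (eid3 p)) (esign b (eplace p z l (eid3 p))))).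

Variables (b : bool) (n m l : nat).
Notation p := (n + 1)%N.
Notation N := (p + p + m)%N.
Implicit Types (X Y : 'rV[F]_N) (A B : tensor F n m l).

Definition f12w A X Y : 'rV[F]_l :=
  bilin A (lsubmx (lsubmx (lsubmx X))) (rsubmx Y)
  + (-1) ^+ b *: bilin A (lsubmx (lsubmx (lsubmx Y))) (rsubmx X).

(** The additional slice is a hyperbolic form on the first [p + p] coordinates. One half contains
    F^n and the dual half leaves room for an arbitrary g to act by isometries. *)
Definition f12 A X Y : 'rV[F]_(l + 1) :=
  row_mx (f12w A X Y) (lsubmx X *m hyp_mx F b p *m (lsubmx Y)^T).

Definition t12 A : tensor F N N (l + 1) :=
  ntens _ _ _ (fun i j k => (place 0 (p + p) 0 (aget (Array A)) i j k +
    nsign b (place (p + p) 0 0 (fun a b c => aget (Array A) b a c) i j k)) +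
    (place 0 p l (id3 F p) i j k + nsign b (place p 0 l (id3 F p) i j k))).

Lemma build12 A : build (r12 b) (Array A) = Array (t12 A).
Proof. by rewrite /t12; case: b. Qed.

Lemma bilin12 A X Y : bilin (t12 A) X Y = f12 A X Y.
Proof.
have out i j k : ~~ [&& i < m, j < n & k < l]%N -> aget (Array A) j i k = 0.
  by move=> h; apply: aget_out; apply: contra h => /= /and3P[-> -> ->].
rewrite /t12 !bilin_ntensD !bilin_ntens_sign (bilin_place _ _ _ _ _ _ (@aget_out F (Array A))).
rewrite !(bilin_place _ _ _ _ _ _ (@id3_out F p)) (bilin_place _ _ _ _ _ _ out) bilin_swap.
rewrite [dim1 _]/= [dim2 _]/= [dim3 _]/= ntens_aget !bilin_id3; shift_simp.
by rewrite /f12 dot_hyp !scale_row_mx !scaler0 !add_row_mx ?add0r ?addr0.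
Qed.

Lemma f12_sym A X Y : f12 A Y X = (-1) ^+ b *: f12 A X Y.
Proof.
rewrite /f12 /f12w scale_row_mx hyp_mx_sym scalerDr scalerA -expr2 sqrr_sign scale1r.
by rewrite addrC.
Qed.

(** Suppose a functional c on the first l outputs pulls back to A with a coefficient [t <> 0] at the
    form. Vectors of the dual half and the m-part of dimension [n + 1 + m] are subjected to [n + m]
    conditions: lying in the radical of c composed with [f12 B], and having an image without m-part.
    Such an image pairs with the first block by t times the hyperbolic form, hence is 0. *)
Lemma f12_mark A B R T : R \in unitmx ->
  (forall X Y, f12 B X Y = f12 A (X *m R) (Y *m R) *m T) -> dlsubmx T = 0.
Proof.
move=> uR eqB; apply: trmx_inj; rewrite trmx0.
apply/row_matrixP => k; rewrite row0 rowE; set phi := delta_mx 0 k.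
apply: trmx_inj; rewrite trmx_mul trmxK trmx0; set c := phi^T.
apply/eqP/negPn/negP => /mx11_neq0 nzt.
have [G eqG] := bilin_form B c.
pose Rx := col_mx (dsubmx (usubmx R)) (dsubmx R).
have [|x nzx] := @exists_kernel_vector F _ _ (row_mx (col_mx 0 G^T) (rsubmx Rx)).
  by rewrite -addnA ltn_add2l add1n.
rewrite mul_mx_row => /row_mx_eq0P[xG xR].
pose X : 'rV[F]_N := row_mx (row_mx 0 (lsubmx x)) (rsubmx x).
have XR : X *m R = x *m Rx.
  by rewrite -[x in RHS]hsubmxK mul_row_col -[R in LHS]vsubmxK mul_row_col mul_row0_mx.
have XR0 : rsubmx (X *m R) = 0 by rewrite XR -mulmx_rsub.
have BX Y : f12 B X Y *m col_mx c 0 = 0.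
  rewrite /f12 /f12w mul_row_col mulmx0 addr0 !(row_mxKl, row_mxKr) linear0 bilin0l add0r.
  rewrite -scalemxAl eqG -mulmxA -[G *m _]trmxK trmx_mul trmxK.
  suff -> : rsubmx x *m G^T = 0 by rewrite trmx0 mulmx0 scaler0.
  by move: xG; rewrite -{1}[x]hsubmxK mul_row_col mulmx0 add0r.
have AX Y : f12 A (X *m R) Y *m T *m col_mx c 0 = 0.
  by have := BX (Y *m invmx R); rewrite eqB mulmxKV.
have XR1 : lsubmx (X *m R) = 0.
  apply: (unitmx_injective (hyp_mx_unit F b p)); apply: dot_inj => y; rewrite mul0mx.
  have := AX (row_mx y 0); rewrite /f12 /f12w XR0 !(row_mxKl, row_mxKr) !bilin0r scaler0 addr0.
  rewrite row_mx_block !mul0mx add0r mul_row_col mulmx0 addr0 -mulmxA.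
  rewrite [dlsubmx T *m c]mx11_scalar mul_mx_scalar => /eqP.
  by rewrite scaler_eq0 (negPf nzt) => /eqP.
have /(unitmx_injective uR)/row_mx_eq0P[/row_mx_eq0P[_ x1] x2] : X *m R = 0.
  by rewrite -[X *m R]hsubmxK XR0 XR1 row_mx0.
by rewrite -[x]hsubmxK x1 x2 row_mx0 eqxx in nzx.
Qed.

Lemma red12 A B :
  same_orbit Act1 (Array A) (Array B) <-> same_orbit Act2 (Array (t12 A)) (Array (t12 B)).
Proof.
rewrite same_orbit1P same_orbit2P; split=> [[g [h [t [ug uh ut eqB]]]]|].
  have [g' [ug' g'l _]] := extend_unitmx 1 ug.
  pose d := block_mx g' 0 0 (invmx g')^T.
  exists (block_mx d 0 0 h), (block_mx t 0 0 1%:M).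
  rewrite !unitmx_diag ?unitmx1 ?unitmx_tr ?unitmx_inv //; split=> // X Y.
  rewrite !bilin12 /f12 /f12w row_mx_diag mulmx1.
  have hl Z : lsubmx (Z *m block_mx d 0 0 h) = lsubmx Z *m d by rewrite mul_diag row_mxKl.
  have hr Z : rsubmx (Z *m block_mx d 0 0 h) = rsubmx Z *m h by rewrite mul_diag row_mxKr.
  rewrite !hl !hr hyp_mx_isom //; congr row_mx.
  by rewrite mulmxDl -scalemxAl !eqB /d !mul_diag !row_mxKl !g'l.
case=> R [T [uR uT]] eqB0.
have eqB X Y : f12 B X Y = f12 A (X *m R) (Y *m R) *m T by rewrite -!bilin12.
have T0 := f12_mark uR eqB; have [ut uc] := unitmx_upper uT T0.
have eqW X Y : f12w B X Y = f12w A (X *m R) (Y *m R) *m ulsubmx T.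
  by have := eqB X Y; rewrite /f12 row_mx_block T0 mulmx0 addr0 => /eq_row_mx[].
(* On the first block the terms from A and B vanish, so [a] preserves the hyperbolic form up to a
   scalar; nondegeneracy makes it invertible. *)
set a := ulsubmx R; have ua : a \in unitmx.
  suff aZ : drsubmx T 0 0 *: (a *m hyp_mx F b p) *m a^T = hyp_mx F b p.
    by have := hyp_mx_unit F b p; rewrite -{1}aZ unitmx_mul unitmx_tr => /andP[].
  apply: form_mx_inj => x y; have := eqB (row_mx x 0) (row_mx y 0).
  have W0 : f12w B (row_mx x 0) (row_mx y 0) = 0.
    by rewrite /f12w !row_mxKr !bilin0r scaler0 addr0.
  have := eqW (row_mx x 0) (row_mx y 0); rewrite W0 => /esym/(unitmx_injective ut) W0'.
  rewrite /f12 W0 W0' row_mx_block mul0mx add0r !row_mxKl !lsubmx_rowl_mul -/a.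
  move=> /eq_row_mx[_]; rewrite mul0mx add0r => ->.
  rewrite [drsubmx T in RHS]mx11_scalar mul_mx_scalar trmx_mul !mulmxA.
  by rewrite -scalemxAr -!scalemxAl !mulmxA.
(* The m-part is lifted to vectors whose images avoid the first block. Paired with a vector of the
   first block, just one of the two terms of [f12w] then survives on each side. *)
have [D uD eqD] := schur_unitmx uR ua.
have eqB1 (x : 'rV_(p + p)) y :
    bilin B (lsubmx (lsubmx x)) y = bilin A (lsubmx (lsubmx (x *m a))) (y *m D) *m ulsubmx T.
  have := eqW (row_mx x 0) (row_mx (- (y *m dlsubmx R *m invmx (ulsubmx R))) y).
  rewrite eqD /f12w !(row_mxKl, row_mxKr) lsubmx_rowl_mul -/a bilin0r !linear0.
  by rewrite bilin0l ?linear0 !addr0.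
pose phi (x : 'rV[F]_n) y := bilin A x (y *m D) *m ulsubmx T.
have phiD x x' y : phi (x + x') y = phi x y + phi x' y by rewrite /phi bilinDl mulmxDl.
(* The dual half is removed first, then the extra coordinate of [n + 1]. *)
have [g1 ug1 eqB2] := unpad_unitmx (phi := fun x : 'rV_p => phi (lsubmx x))
   (psi := fun x : 'rV_p => bilin B (lsubmx x)) ua (fun x y i => etrans (congr1 (phi^~ i)
     (linearD _ x y)) (phiD _ _ i)) eqB1.
have [g ug eqB3] := unpad_unitmx ug1 phiD eqB2.
by exists g, D, (ulsubmx T); split.
Qed.

End Red12.

(** * Reduction of action 2 to (anti-)symmetric arrays *)

Section Red24.
Variable F : fieldType.

Definition r24 (b : bool) : recipe :=
  let z := NConst 0 in
  let n := NVar 0 in let l := NVar 2 in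
  let p := NAdd l (NAdd n (NConst 2)) in let q := NAdd p p in
  let o := NAdd q n in let s := NAdd o (NConst 1) in
  Recipe s s s
    (EAdd (EAdd (eplace q q z EGet)
                (EAdd (eplace z q q (fun a b c => EGet b c a))
                      (esign b (eplace q z q (fun a b c => EGet a c b)))))
    (EAdd (EAdd (eplace z p o (eid3 p)) (esign b (eplace p z o (eid3 p))))
    (EAdd (EAdd (eplace o z p (eid1 p)) (esign b (eplace o p z (eid1 p))))
          (EAdd (eplace p o z (eid2 p)) (esign b (eplace z o p (eid2 p))))))).

Variables (b : bool) (n l : nat).
Notation p := (l + (n + 2))%N.
Notation N := (p + p + n + 1)%N.
Implicit Types (X Y Z : 'rV[F]_N) (A B : tensor F n n l).

Definition hpart X : 'rV[F]_(p + p) := lsubmx (lsubmx X).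
Definition wpart X : 'rV[F]_l := lsubmx (lsubmx (hpart X)).
Definition xpart X : 'rV[F]_n := rsubmx (lsubmx X).
Definition zcoef X : F := rsubmx X 0 0.
Definition hform X Y : 'M[F]_1 := hpart X *m hyp_mx F b p *m (hpart Y)^T.

Definition t24 A : tensor F N N N :=
  let q := (p + p)%N in let o := (q + n)%N in
  ntens _ _ _ (fun i j k =>
    (place q q 0 (aget (Array A)) i j k +
      (place 0 q q (fun a b c => aget (Array A) b c a) i j k +
       nsign b (place q 0 q (fun a b c => aget (Array A) a c b) i j k))) +
    ((place 0 p o (id3 F p) i j k + nsign b (place p 0 o (id3 F p) i j k)) +
    ((place o 0 p (id1 F p) i j k + nsign b (place o p 0 (id1 F p) i j k)) +
     (place p o 0 (id2 F p) i j k + nsign b (place 0 o p (id2 F p) i j k))))).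

Definition trilin A X Y Z : 'M[F]_1 := bilin (t24 A) X Y *m Z^T.

Lemma build24 A : build (r24 b) (Array A) = Array (t24 A).
Proof. by rewrite /t24; case: b. Qed.

Lemma dotC k (x y : 'rV[F]_k) : x *m y^T = y *m x^T.
Proof.
have tr11 (M : 'M[F]_1) : M^T = M by apply/matrixP => i j; rewrite mxE !ord1.
by rewrite -[LHS]tr11 trmx_mul trmxK.
Qed.

Lemma bilin_rot A (w : 'rV_l) (x y : 'rV_n) :
  bilin (ntens l n n (fun a b c => aget (Array A) b c a)) w x *m y^T =
  bilin A x y *m w^T.
Proof.
apply/matrixP => i0 j0; rewrite !ord1 !mxE.
under eq_bigr => k _ do (rewrite !mxE mulr_suml; under eq_bigr => i _ do rewrite mulr_suml).
under [RHS]eq_bigr => k _ do (rewrite !mxE mulr_suml; under eq_bigr => i _ do rewrite mulr_suml).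
rewrite exchange_big; apply: eq_bigr => i _; rewrite exchange_big; apply: eq_bigr => k _.
by apply: eq_bigr => j _; rewrite !ffunE (@aget_ord F (Array A)) /=; ring.
Qed.

Lemma bilin_flip A (w : 'rV_l) (x y : 'rV_n) :
  bilin (ntens n l n (fun a b c => aget (Array A) a c b)) x w *m y^T =
  bilin A x y *m w^T.
Proof.
apply/matrixP => i0 j0; rewrite !ord1 !mxE.
under eq_bigr => k _ do (rewrite !mxE mulr_suml; under eq_bigr => i _ do rewrite mulr_suml).
under [RHS]eq_bigr => k _ do (rewrite !mxE mulr_suml; under eq_bigr => i _ do rewrite mulr_suml).
rewrite exchange_big [RHS]exchange_big; apply: eq_bigr => i _.
rewrite exchange_big; apply: eq_bigr => k _.
by apply: eq_bigr => j _; rewrite !ffunE (@aget_ord F (Array A)) /=; ring.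
Qed.

(** When A has the symmetry given by b, the term with the sign is [A Z X] paired with the w-part of
    Y, so both groups of three are cyclic sums. *)
Lemma trilinE A X Y Z : trilin A X Y Z =
  (bilin A (xpart X) (xpart Y) *m (wpart Z)^T +
    (bilin A (xpart Y) (xpart Z) *m (wpart X)^T +
     (-1) ^+ b *: (bilin A (xpart X) (xpart Z) *m (wpart Y)^T))) +
  (zcoef Z *: hform X Y + (zcoef X *: hform Y Z + zcoef Y *: hform Z X)).
Proof.
have out1 i j k : ~~ [&& i < l, j < n & k < n]%N -> aget (Array A) j k i = 0.
  by move=> h; apply: aget_out; apply: contra h => /= /and3P[-> -> ->].
have out2 i j k : ~~ [&& i < n, j < l & k < n]%N -> aget (Array A) i k j = 0.
  by move=> h; apply: aget_out; apply: contra h => /= /and3P[-> -> ->].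
rewrite /trilin /t24 !bilin_ntensD !bilin_ntens_sign.
rewrite (bilin_place _ _ _ _ _ _ (@aget_out F (Array A))).
rewrite (bilin_place _ _ _ _ _ _ out1) (bilin_place _ _ _ _ _ _ out2).
rewrite !(bilin_place _ _ _ _ _ _ (@id1_out F p)) !(bilin_place _ _ _ _ _ _ (@id2_out F p)).
rewrite !(bilin_place _ _ _ _ _ _ (@id3_out F p)).
rewrite [dim1 _]/= [dim2 _]/= [dim3 _]/= ntens_aget.
rewrite !mulmxDl -!scalemxAl -!(mulmxA _ (shift_mx _ _ _ _)^T) -!trmx_mul.
rewrite bilin_rot bilin_flip !bilin_id1 !bilin_id2 !bilin_id3; shift_simp.
rewrite /hform !dot_hyp -!/(hpart _); congr (_ + (_ + (_ + _))).
- have -> : (rsubmx Z)^T = (zcoef Z)%:M.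
    by apply/matrixP => i j; rewrite !ord1 !mxE /zcoef mxE.
  by rewrite !mul_mx_scalar scalerDr !scalerA mulrC.
- by rewrite -!scalemxAl scalerDr !scalerA mulrC.
- by rewrite -!scalemxAl scalerDr !scalerA mulrC !(dotC (_ (hpart Z))).
Qed.

Definition hvec (y : 'rV[F]_(p + p)) (x : 'rV[F]_n) : 'rV[F]_N := row_mx (row_mx y x) 0.

Lemma hpart_vec y x : hpart (hvec y x) = y.
Proof. by rewrite /hpart !row_mxKl. Qed.

Lemma xpart_vec y x : xpart (hvec y x) = x.
Proof. by rewrite /xpart row_mxKl row_mxKr. Qed.

Lemma wpart_vec y x : wpart (hvec y x) = lsubmx (lsubmx y).
Proof. by rewrite /wpart hpart_vec. Qed.

Lemma zcoef_vec y x : zcoef (hvec y x) = 0.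
Proof. by rewrite /zcoef row_mxKr zero00. Qed.

Definition hvecE := (hpart_vec, xpart_vec, wpart_vec, zcoef_vec).

(** The vector y of the hyperbolic space, of dimension [2 (l + n + 2)], has to meet [2 n + 2]
    conditions: n for the pairing of its w-part with the values of [B _ Z], one for orthogonality to
    Z, and [n + 1] for an image without x-part and mark. Then the form of B vanishes on y and Z,
    whatever the third argument, while for A it restricts to the mark coordinate of [Z *m R] times
    the hyperbolic form. *)
Lemma f24_mark A B R : R \in unitmx ->
  (forall X Y Z, trilin B X Y Z = trilin A (X *m R) (Y *m R) (Z *m R)) ->
  ursubmx R = 0.
Proof.
move=> uR eqB; apply/row_matrixP => i; rewrite row0 rowE.
set z := delta_mx 0 i; apply/eqP/negPn/negP => /mx11_neq0 nzv.
pose Z : 'rV[F]_N := row_mx z 0.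
pose G := \matrix_i bilin B (delta_mx 0 i) (xpart Z).
have GE (x : 'rV_n) : bilin B x (xpart Z) = x *m G.
  rewrite mulmx_sum_row {1}[x]row_sum_delta.
  elim/big_rec2: _ => [|j u v _ <-]; first by rewrite bilin0l.
  by rewrite bilinDl bilinZl rowK.
pose Ry := usubmx (usubmx R).
pose C1 : 'M[F]_(p + p, n) := col_mx (col_mx G^T 0) 0.
have [|y nzy] := @exists_kernel_vector F _ _ (row_mx (row_mx C1
    ((hyp_mx F b p)^T *m (hpart Z)^T)) (row_mx (rsubmx (lsubmx Ry)) (rsubmx Ry))).
  by lia.
rewrite !mul_mx_row => /row_mx_eq0P[/row_mx_eq0P[yG yZ] /row_mx_eq0P[yx yz]].
have yR : hvec y 0 *m R = y *m Ry by rewrite !mul_rowl_mx.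
have wG : lsubmx (lsubmx y) *m G^T = 0.
  move: yG; rewrite -{1}[y]hsubmxK mul_row_col mulmx0 addr0.
  by rewrite -{1}[lsubmx y]hsubmxK mul_row_col mulmx0 addr0.
have BX Y : trilin B (hvec y 0) Y Z = 0.
  rewrite trilinE !hvecE bilin0l mul0mx GE -mulmxA -[G *m _]trmxK trmx_mul trmxK wG.
  rewrite bilin0l mul0mx trmx0 mulmx0 scaler0 /hform hpart_vec.
  have -> : zcoef Z = 0 by rewrite /zcoef row_mxKr zero00.
  have -> : hpart Z *m hyp_mx F b p *m y^T = 0.
    by rewrite dotC trmx_mul.
  by rewrite !scale0r scaler0 !addr0.
have XR : hvec y 0 *m R = hvec (hpart (hvec y 0 *m R)) 0.
  have z0 : rsubmx (hvec y 0 *m R) = 0 by rewrite yR -mulmx_rsub.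
  have x0 : xpart (hvec y 0 *m R) = 0 by rewrite /xpart yR -mulmx_lsub -mulmx_rsub.
  by rewrite -[LHS]hsubmxK z0 -[lsubmx _]hsubmxK -/(xpart _) x0.
have XR0 : hpart (hvec y 0 *m R) = 0.
  apply: (unitmx_injective (hyp_mx_unit F b p)); apply: dot_inj => y2; rewrite mul0mx.
  have := BX (hvec y2 0 *m invmx R); rewrite eqB mulmxKV // XR.
  rewrite trilinE !hvecE !bilin0l !mul0mx scaler0 !scale0r !addr0 !add0r /hform !hpart_vec.
  have -> : zcoef (Z *m R) = (z *m ursubmx R) 0 0.
    by rewrite /zcoef rsubmx_row_mul mul0mx addr0.
  by move=> /eqP; rewrite scaler_eq0 (negPf nzv) => /eqP.
have /(unitmx_injective uR)/row_mx_eq0P[/row_mx_eq0P[y0 _] _] : hvec y 0 *m R = 0.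
  by rewrite XR XR0 /hvec !row_mx0.
by rewrite y0 eqxx in nzy.
Qed.

Lemma trilin_orbit A B :
  same_orbit Act4 (Array (t24 A)) (Array (t24 B)) <->
  exists2 R, R \in unitmx &
    forall X Y Z, trilin B X Y Z = trilin A (X *m R) (Y *m R) (Z *m R).
Proof.
rewrite same_orbit4P; split=> -[R uR eqB]; exists R => // X Y.
  by move=> Z; rewrite /trilin eqB trmx_mul mulmxA.
by apply: dot_inj => Z; rewrite -/(trilin B X Y Z) eqB /trilin trmx_mul mulmxA.
Qed.

Lemma red24 A B :
  same_orbit Act2 (Array A) (Array B) <-> same_orbit Act4 (Array (t24 A)) (Array (t24 B)).
Proof.
rewrite trilin_orbit same_orbit2P; split=> [[g [t [ug ut eqB]]]|[R uR eqB]].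
  have utT : t^T \in unitmx by rewrite unitmx_tr.
  have [h [uh hl _]] := extend_unitmx (n + 2) utT.
  pose d := block_mx h 0 0 (invmx h)^T.
  exists (block_mx (block_mx d 0 0 g) 0 0 1%:M).
    by rewrite !unitmx_diag ?unitmx1 ?unitmx_tr ?unitmx_inv.
  set R := block_mx _ 0 0 1%:M => X Y Z.
  have hR V : hpart (V *m R) = hpart V *m d by rewrite /hpart !mul_diag !row_mxKl.
  have xR V : xpart (V *m R) = xpart V *m g.
    by rewrite /xpart !mul_diag row_mxKl row_mxKr.
  have zR V : zcoef (V *m R) = zcoef V by rewrite /zcoef mul_diag row_mxKr mulmx1.
  have wR V : wpart (V *m R) = wpart V *m t^T.
    by rewrite /wpart hR mul_diag row_mxKl hl.
  have fR V W : hform (V *m R) (W *m R) = hform V W.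
    by rewrite /hform !hR hyp_mx_isom.
  by rewrite !trilinE !fR !zR !xR !wR !eqB !trmx_mul !trmxK !mulmxA.
have R0 := f24_mark uR eqB; have [ur ual] := unitmx_lower uR R0.
set r := ulsubmx R in ur.
have Rx x : row_mx x 0 *m R = row_mx (x *m r) 0.
  by rewrite row_mx_block R0 !mulmx0 !mul0mx !addr0.
set a := ulsubmx r; have ua : a \in unitmx.
  suff aZ : drsubmx R 0 0 *: (a *m hyp_mx F b p) *m a^T = hyp_mx F b p.
    by have := hyp_mx_unit F b p; rewrite -{1}aZ unitmx_mul unitmx_tr => /andP[].
  apply: form_mx_inj => y1 y2.
  pose Z0 (c : 'rV[F]_1) : 'rV[F]_N := row_mx 0 c.
  have Z0E c : (xpart (Z0 c) = 0) * (wpart (Z0 c) = 0) * (hpart (Z0 c) = 0) *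
      (zcoef (Z0 c) = c 0 0).
    by rewrite /xpart /wpart /hpart /zcoef !row_mxKl row_mxKr !linear0.
  (* The image of the mark is a multiple of the mark plus the image of an unmarked vector. The
     latter contributes to A what its preimage contributes to B, which is 0 against two hyperbolic
     vectors. *)
  have Z1 : Z0 1%:M *m R = row_mx (dlsubmx R *m invmx r) 0 *m R + Z0 (drsubmx R).
    rewrite Rx mulmxKV // add_row_mx addr0 add0r row_mx_block.
    by rewrite !mul0mx !add0r !mul1mx.
  have trilinDr C X Y Z Z' : trilin C X Y (Z + Z') = trilin C X Y Z + trilin C X Y Z'.
    by rewrite /trilin linearD mulmxDr.
  have yR y : hvec y 0 *m R = hvec (y *m a) (y *m ursubmx r).
    by rewrite Rx row_mx_block !mul0mx !addr0.
  have := eqB (hvec y1 0) (hvec y2 0) (Z0 1%:M); rewrite Z1 trilinDr -eqB !yR.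
  rewrite !trilinE !hvecE !Z0E /hform !hvecE !Z0E one00 scale1r.
  have -> : zcoef (row_mx (dlsubmx R *m invmx r) 0) = 0 by rewrite /zcoef row_mxKr zero00.
  rewrite !(bilin0l, bilin0r, mul0mx, trmx0, mulmx0, scaler0, scale0r, addr0, add0r) => ->.
  by rewrite trmx_mul !mulmxA -scalemxAr -!scalemxAl !mulmxA.
have [D uD eqD] := schur_unitmx ur ua.
have eqB1 (y : 'rV_(p + p)) (x : 'rV_n * 'rV_n) :
    bilin B x.1 x.2 *m (lsubmx (lsubmx y))^T =
    bilin A (x.1 *m D) (x.2 *m D) *m (lsubmx (lsubmx (y *m a)))^T.
  pose u x := hvec (- (x *m dlsubmx r *m invmx (ulsubmx r))) x.
  have uR' x' : u x' *m R = hvec 0 (x' *m D) by rewrite Rx eqD.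
  have := eqB (u x.1) (u x.2) (hvec y 0); rewrite !uR' Rx row_mx_block -/(hvec _ _).
  by rewrite !trilinE /hform !hvecE -/a !bilin0r !linear0 !(mul0mx, mulmx0, scaler0, scale0r, addr0).
pose phi (w : 'rV[F]_l) (x : 'rV_n * 'rV_n) := bilin A (x.1 *m D) (x.2 *m D) *m w^T.
have phiD w w' x : phi (w + w') x = phi w x + phi w' x.
  by rewrite /phi linearD mulmxDr.
have [g1 ug1 eqB2] := unpad_unitmx (phi := fun w : 'rV_p => phi (lsubmx w))
   (psi := fun (w : 'rV_p) x => bilin B x.1 x.2 *m (lsubmx w)^T) ua
   (fun x y i => etrans (congr1 (phi^~ i) (linearD _ x y)) (phiD _ _ i)) eqB1.
have [g ug eqB3] := unpad_unitmx (psi := fun (w : 'rV_l) x => bilin B x.1 x.2 *m w^T)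
  ug1 phiD eqB2.
exists D, g^T; rewrite unitmx_tr; split=> // x y; apply: dot_inj => w.
by rewrite (eqB3 w (x, y)) /phi /= trmx_mul mulmxA.
Qed.

Lemma trilin_delta A i j k :
  trilin A (delta_mx 0 i) (delta_mx 0 j) (delta_mx 0 k) 0 0 = t24 A (i, j, k).
Proof. by rewrite /trilin trmx_delta -colE mxE bilin_delta. Qed.

(** The transposition and the 3-cycle treated here generate all permutations of the indices. *)
Lemma t24_sym A : (forall x y, bilin A y x = (-1) ^+ b *: bilin A x y) ->
  forall i j k, t24 A (j, i, k) = (-1) ^+ b * t24 A (i, j, k) /\
                t24 A (j, k, i) = t24 A (i, j, k).
Proof.
move=> symA i j k; rewrite -!trilin_delta.
move: (delta_mx 0 i) (delta_mx 0 j) (delta_mx 0 k) => X Y Z.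
have hC V W : hform W V = (-1) ^+ b *: hform V W by rewrite /hform hyp_mx_sym.
have ee : (-1) ^+ b * (-1) ^+ b = 1 :> F by rewrite -expr2 sqrr_sign.
have -> : trilin A Y Z X = trilin A X Y Z.
  rewrite !trilinE [bilin A (xpart Z) (xpart X)]symA [bilin A (xpart Y) (xpart X)]symA.
  rewrite -!scalemxAl scalerA ee scale1r.
  move: (bilin _ _ _ *m _) (bilin _ _ _ *m _) (bilin _ _ _ *m _) => u v w.
  move: (_ *: hform _ _) (_ *: hform _ _) (_ *: hform _ _) => u' v' w'.
  by congr (_ + _); rewrite addrA addrC.
split=> //.
have -> : trilin A Y X Z = (-1) ^+ b *: trilin A X Y Z; last by rewrite mxE.
rewrite !trilinE [bilin A (xpart Y) (xpart X)]symA.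
rewrite (hC X Y) (hC Z X) (hC Y Z) !scalerDr -!scalemxAl !scalerA ee scale1r.
rewrite ![_ * (-1) ^+ b]mulrC; congr (_ + _ + (_ + _)); rewrite addrC.
by [].
by [].
Qed.

End Red24.

(** * Compilation of recipes *)

Local Close Scope ring_scope.

Section Runs.
Variable F : fieldType.
Implicit Types (s : state F) (p : prog F) (Q : state F -> Prop) (T : nat).

(** A total correctness triple with a time bound; nesting it in its own postcondition allows
    symbolic execution of a sequence. *)
Definition runs p s T Q : Prop :=
  exists t s', [/\ exec p s t s', t <= T & Q s'].

Definition seti s r v : state F := State [eta imem s with r |-> v] (fmem s).
Definition setf s a (v : F) : state F := State (imem s) [eta fmem s with a |-> v].

Lemma runs_weaken p s T T' Q Q' : T <= T' -> (forall s', Q s' -> Q' s') ->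
  runs p s T Q -> runs p s T' Q'.
Proof.
move=> leT QQ' [t [s' [ex le_t Qs']]].
by exists t, s'; split=> //; [exact: leq_trans leT | exact: QQ'].
Qed.

Lemma runs_le p s T T' Q : T <= T' -> runs p s T Q -> runs p s T' Q.
Proof. by move=> leT; apply: runs_weaken. Qed.

Lemma runs_iset a e s Q :
  Q (seti s (ieval s a) (ieval s e)) -> runs (ISet F a e) s (icost a + icost e).+1 Q.
Proof. by move=> Qs; eexists _, _; split; [apply: ExecISet|apply: leqnn|]. Qed.

Lemma runs_fset a e s Q :
  Q (setf s (ieval s a) (feval s e)) -> runs (FSet a e) s (icost a + fcost e).+1 Q.
Proof. by move=> Qs; eexists _, _; split; [apply: ExecFSet|apply: leqnn|]. Qed.

Lemma runs_seq p1 p2 s T1 T2 Q :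
  runs p1 s T1 (fun s1 => runs p2 s1 T2 Q) -> runs (Seq p1 p2) s (T1 + T2) Q.
Proof.
case=> t1 [s1 [ex1 le1 [t2 [s2 [ex2 le2 Q2]]]]].
by exists (t1 + t2), s2; split; [apply: ExecSeq ex1 ex2|apply: leq_add|].
Qed.

Lemma runs_if b p1 p2 s T Q :
  runs (if teval s b then p1 else p2) s T Q -> runs (If b p1 p2) s (tcost b + T) Q.
Proof.
case=> t [s' [ex le_t Qs']]; exists (tcost b + t), s'.
by split; [apply: ExecIf|rewrite leq_add2l|].
Qed.

Definition reg r : iexp := ILoad (IConst r).

Definition for_ x b body : prog F :=
  Seq (ISet F (IConst x) (IConst 0))
    (While (ILe F (IAdd (reg x) (IConst 1)) (reg b))
       (Seq body (ISet F (IConst x) (IAdd (reg x) (IConst 1))))).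

(** Besides the body, a round costs 7 for the test and 6 for the increment. The summand 10 is 3 for
    the initialisation and 7 for the last, failing test. *)
Lemma runs_for x b n body T (I : nat -> state F -> Prop) s Q :
  x != b -> imem s b = n -> I 0 (seti s x 0) ->
  (forall i s, i < n -> imem s x = i -> imem s b = n -> I i s ->
     runs body s T (fun s' =>
       [/\ imem s' x = i, imem s' b = n & I i.+1 (seti s' x i.+1)])) ->
  (forall s, imem s b = n -> I n s -> Q s) ->
  runs (for_ x b body) s (n * (T + 13) + 10) Q.
Proof.
move=> nxb sb I0 step post.
have loop k i s1 : i + k = n -> imem s1 x = i -> imem s1 b = n -> I i s1 ->
    runs (While (ILe F (IAdd (reg x) (IConst 1)) (reg b))
       (Seq body (ISet F (IConst x) (IAdd (reg x) (IConst 1))))) s1 (k * (T + 13) + 7) Q.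
  elim: k i s1 => [|k IHk] i s1 eqn xi bn Ii.
    exists 7, s1; split=> //; last by apply: post => //; rewrite -eqn addn0.
    by apply: ExecWhileDone; rewrite /= xi bn -ltnNge addn1 -eqn addn0.
  have lti : i < n by rewrite -eqn -addSnnS leq_addr.
  have [t1 [s2 [ex1 le1 [x2 b2 I2]]]] := step i s1 lti xi bn Ii.
  have x3 : imem (seti s2 x i.+1) x = i.+1 by rewrite /= eqxx.
  have b3 : imem (seti s2 x i.+1) b = n by rewrite /= eq_sym (negPf nxb).
  have [|t2 [s3 [ex2 le2 Q3]]] := IHk i.+1 (seti s2 x i.+1) _ x3 b3 I2.
    by rewrite addSnnS.
  exists (7 + (t1 + 6) + t2), s3; split=> //; last by rewrite mulSn; lia.
  apply: ExecWhileStep ex2; first by rewrite /= xi bn addn1.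
  apply: ExecSeq ex1 _.
  have -> : seti s2 x i.+1 = State [eta imem s2 with ieval s2 (IConst x) |->
      ieval s2 (IAdd (reg x) (IConst 1))] (fmem s2) by rewrite /= x2 addn1.
  exact: (ExecISet s2 (IConst x) (IAdd (reg x) (IConst 1))).
rewrite (_ : _ + 10 = 3 + (n * (T + 13) + 7)); last by lia.
apply: runs_seq; apply: runs_iset => /=; apply: loop I0 => //.
  by rewrite /= eqxx.
by rewrite /= eq_sym (negPf nxb).
Qed.

(** Multiplication by repeated addition, as the machine multiplies no integers; 20 is the 7 of one
    addition plus the 13 of the loop. *)
Lemma runs_acc x b dst step n s Q : uniq [:: x; b; dst; step] -> imem s b = n ->
  (forall s', (forall r, r != x -> r != dst -> imem s' r = imem s r) ->
     imem s' dst = imem s dst + n * imem s step -> fmem s' = fmem s -> Q s') ->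
  runs (for_ x b (ISet F (IConst dst) (IAdd (reg dst) (reg step)))) s (n * 20 + 10) Q.
Proof.
rewrite /= !inE !negb_or => /and4P[/and3P[xb xd xs] /andP[bd bs] ds _] bn post.
rewrite (_ : 20 = 7 + 13) //.
apply: (@runs_for x b n _ 7 (fun i s' =>
  [/\ forall r, r != x -> r != dst -> imem s' r = imem s r,
      imem s' dst = imem s dst + i * imem s step & fmem s' = fmem s])) => //.
- split=> //= [r /negPf-> //|]; rewrite eq_sym (negPf xd) mul0n addn0 //.
- move=> i s1 lti x1 b1 [eqr d1 f1]; apply: runs_iset => /=.
  split; rewrite ?(negPf xd) ?(negPf bd) //; split=> //=.
    by move=> r nrx nrd; rewrite (negPf nrx) (negPf nrd) eqr.
  by rewrite eq_sym (negPf xd) eqxx d1 (eqr step) ?[step == _]eq_sym // mulSn addnCA addnC addnA.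
- by move=> s1 _ [eqr d1 f1]; apply: post.
Qed.

Fixpoint cnexp (e : nexp) : iexp :=
  match e with
  | NVar x => if x < 3 then reg x else if x < 6 then reg (x + 3) else IConst 0
  | NConst n => IConst n
  | NAdd a b => IAdd (cnexp a) (cnexp b)
  | NSub a b => ISub (cnexp a) (cnexp b)
  end.

Definition venv s : nat -> nat :=
  entv (imem s 0) (imem s 1) (imem s 2) (imem s 6) (imem s 7) (imem s 8).

Lemma ieval_cnexp s e : ieval s (cnexp e) = neval (venv s) e.
Proof.
elim: e => [x|//|a /= -> b -> //|a /= -> b -> //].
by move: x => [|[|[|[|[|[|x]]]]]] //=; rewrite /venv /entv /= nth_nil.
Qed.

(* Registers: 0-2 input dimensions, 6-8 indices of the current entry, 9 index
   of the current array, 10-12 output dimensions, 13 address of the current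
   output entry, 14 base address of the current input array, 15-17 and 23
   scratch, 18 number of arrays, 19 and 20 size of one and of all inputs,
   21 size of all outputs, 22 copy index. *)
Definition scratch : seq nat := [:: 15; 16; 17; 23].

Definition cget d (a b c : nexp) : prog F :=
  Seq (ISet F (IConst 23) (cnexp a))
  (Seq (ISet F (IConst 16) (cnexp b))
  (Seq (for_ 15 23 (ISet F (IConst 16) (IAdd (reg 16) (reg 1))))
  (Seq (ISet F (IConst 17) (IAdd (cnexp c) (reg 14)))
  (Seq (for_ 15 16 (ISet F (IConst 17) (IAdd (reg 17) (reg 2))))
       (FSet (IAdd (reg 13) (IConst d)) (FLoad F (reg 17))))))).

Definition cset d (v : F) : prog F := FSet (IAdd (reg 13) (IConst d)) (FConst v).

(** Field cells from the current output entry upwards serve as an evaluation stack, and d is the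
    current height; later output entries overwrite it. *)
Fixpoint cent d (e : ent) : prog F :=
  let dst := IAdd (reg 13) (IConst d) in
  match e with
  | EZero => cset d 0%R
  | EOne => cset d 1%R
  | EOpp e1 => Seq (cent d e1) (FSet dst (FOpp (FLoad F dst)))
  | EAdd e1 e2 => Seq (cent d e1) (Seq (cent d.+1 e2)
      (FSet dst (FAdd (FLoad F dst) (FLoad F (IAdd (reg 13) (IConst d.+1))))))
  | EGet a b c =>
      If (ILe F (IAdd (cnexp a) (IConst 1)) (reg 0))
        (If (ILe F (IAdd (cnexp b) (IConst 1)) (reg 1))
          (If (ILe F (IAdd (cnexp c) (IConst 1)) (reg 2)) (cget d a b c) (cset d 0%R))
          (cset d 0%R)) (cset d 0%R)
  | EIf a b e1 e2 => If (ILe F (cnexp a) (cnexp b)) (cent d e1) (cent d e2)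
  end.

Fixpoint ecost (e : ent) : nat :=
  match e with
  | EZero | EOne => 10
  | EOpp e1 => ecost e1 + 20
  | EAdd e1 e2 => ecost e1 + ecost e2 + 40
  | EGet a b c => 2 * (icost (cnexp a) + icost (cnexp b) + icost (cnexp c)) + 150
  | EIf a b e1 e2 => icost (cnexp a) + icost (cnexp b) + ecost e1 + ecost e2 + 10
  end.

Definition frame d s s' : Prop :=
  (forall r, r \notin scratch -> imem s' r = imem s r) /\
  (forall a, a < imem s 13 + d -> fmem s' a = fmem s a).

Definition input_at (get : nat -> nat -> nat -> F) s : Prop :=
  (forall a b c, ~~ [&& a < imem s 0, b < imem s 1 & c < imem s 2] -> get a b c = 0%R) /\
  (forall a b c, a < imem s 0 -> b < imem s 1 -> c < imem s 2 ->
     fmem s (imem s 14 + ((a * imem s 1 + b) * imem s 2 + c)) = get a b c /\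
     imem s 14 + ((a * imem s 1 + b) * imem s 2 + c) < imem s 13).

Lemma frame_venv d s s' : frame d s s' -> venv s' = venv s.
Proof. by case=> eqr _; rewrite /venv !eqr. Qed.

Lemma frame_input d get s s' : frame d s s' -> input_at get s -> input_at get s'.
Proof.
case=> eqr eqf [out inp]; split=> a b c; rewrite !eqr //; first exact: out.
move=> la lb lc; have [eqg lt13] := inp a b c la lb lc; split=> //.
by rewrite eqf // ltn_addr.
Qed.

Lemma runs_cset d v s : runs (cset d v) s 10 (fun s' =>
  frame d s s' /\ fmem s' (imem s 13 + d) = v).
Proof.
apply: (@runs_weaken _ _ 6 _ (fun s' => frame d s s' /\ fmem s' (imem s 13 + d) = v)) => //.
apply: runs_fset; split=> /=; last by rewrite eqxx.
by split=> // a lta; rewrite /= ltn_eqF.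
Qed.

Lemma runs_cget d a b c s get : input_at get s ->
  neval (venv s) a < imem s 0 -> neval (venv s) b < imem s 1 ->
  neval (venv s) c < imem s 2 ->
  runs (cget d a b c) s
    ((icost (cnexp a) + icost (cnexp b) + icost (cnexp c) + 100)
       * (imem s 0 * imem s 1 + imem s 0).+1)
    (fun s' => frame d s s' /\
       fmem s' (imem s 13 + d) = get (neval (venv s) a) (neval (venv s) b) (neval (venv s) c)).
Proof.
move=> [out inp] la lb lc.
set va := neval _ a in la *; set vb := neval _ b in lb *; set vc := neval _ c in lc *.
set ca := icost (cnexp a); set cb := icost (cnexp b); set cc := icost (cnexp c).
have lev : va * imem s 1 + vb <= imem s 0 * imem s 1.
  by apply: leq_trans (leq_mul la (leqnn _)); rewrite mulSn addnC leq_add2r ltnW.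
apply: (@runs_weaken _ _ ((1 + ca).+1 + ((1 + cb).+1 + ((va * 20 + 10) +
  ((1 + (cc + 2).+1).+1 + (((va * imem s 1 + vb) * 20 + 10) + 8))))) _
  (fun s' => frame d s s' /\ fmem s' (imem s 13 + d) = get va vb vc)) => //.
  by nia.
apply: runs_seq; apply: runs_iset; rewrite ieval_cnexp [ieval _ _]/= -/va.
apply: runs_seq; apply: runs_iset; rewrite ieval_cnexp [ieval _ _]/=.
rewrite [neval _ b]/(neval (venv s) b) -/vb.
apply: runs_seq; apply: runs_acc => // s1 r1 v1 f1.
apply: runs_seq; apply: runs_iset; rewrite [ieval _ (IAdd _ _)]/= ieval_cnexp [ieval _ _]/=.
have e1 : venv s1 = venv s by rewrite /venv !r1.
rewrite e1 -/vc r1 //=.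
apply: runs_seq; apply: runs_acc => //= [|s2 r2 v2 f2].
  by rewrite v1 /= addnC.
have eqr r : r \notin scratch -> imem s2 r = imem s r.
  rewrite !inE !negb_or => /and4P[n15 n16 n17 n23].
  by rewrite r2 //= (negPf n17) r1 //= (negPf n16) (negPf n23).
have eqf : fmem s2 = fmem s by rewrite f2 /= f1.
have v17 : imem s2 17 = imem s 14 + ((va * imem s 1 + vb) * imem s 2 + vc).
  by rewrite v2 /= r1 //=; lia.
have [gE lt13] := inp _ _ _ la lb lc.
apply: runs_fset => /=; rewrite eqr // v17 eqf gE.
split; last by rewrite /= eqxx.
by split=> [r /eqr //|x ltx] /=; rewrite ltn_eqF // eqf.
Qed.

End Runs.

Section Compile.
Variable F : fieldType.
Implicit Types (s : state F) (e : ent) (A : array F).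

Lemma frame_trans d d' (s1 s2 s3 : state F) :
  d <= d' -> frame d s1 s2 -> frame d' s2 s3 -> frame d s1 s3.
Proof.
move=> led [r12 f12] [r23 f23]; split=> [r nr|a lta]; first by rewrite r23 // r12.
by rewrite f23 ?f12 // r12 // (leq_trans lta) // leq_add2l.
Qed.

(** The factor pays for the two address loops of [cget], with at most [d1] and [d1 * d2] rounds;
    everything else has a cost depending on e alone. *)
Lemma runs_cent e d s get : input_at get s ->
  runs (cent F d e) s (ecost e * (imem s 0 * imem s 1 + imem s 0).+1)
    (fun s' => frame d s s' /\ fmem s' (imem s 13 + d) = eeval get (venv s) e).
Proof.
elim: e d s => [||e IH|e1 IH1 e2 IH2|a b c|a b e1 IH1 e2 IH2] d s hin /=.
- by apply: runs_weaken (runs_cset d 0%R s) => //; nia.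
- by apply: runs_weaken (runs_cset d 1%R s) => //; nia.
- set W := (_ * _ + _).+1; have W1 : 0 < W by []; apply: (@runs_le _ _ _ (ecost e * W + 11)); first by nia.
  apply: runs_seq; apply: runs_weaken (leqnn _) _ (IH d s hin) => s1 [fr1 v1].
  apply: (@runs_le _ _ _ 11) => //.
  apply: runs_fset => /=; have [r1 f1] := fr1; rewrite r1 // v1; split; last by rewrite eqxx.
  by split=> // x ltx; rewrite /= ltn_eqF // f1.
- set W := (_ * _ + _).+1; have W1 : 0 < W by [].
  apply: (@runs_le _ _ _ (ecost e1 * W + (ecost e2 * W + 20))); first by nia.
  apply: runs_seq; apply: runs_weaken (leqnn _) _ (IH1 d s hin) => s1 [fr1 v1].
  have [r1 f1] := fr1.
  have := IH2 d.+1 s1 (frame_input fr1 hin); rewrite !r1 // (frame_venv fr1) -/W => run2.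
  apply: runs_seq; apply: runs_weaken (leqnn _) _ run2 => s2 [fr2 v2].
  have [r2 f2] := fr2.
  apply: (@runs_le _ _ _ 16) => //.
  apply: runs_fset => /=; rewrite !r2 // !r1 // v2 f2 ?v1; last by rewrite r1 // addnS.
  split; last by rewrite eqxx.
  have [r3 f3] := frame_trans (leqnSn d) fr1 fr2.
  by split=> // x ltx; rewrite /= ltn_eqF // f3.
- set W := (_ * _ + _).+1; have W1 : 0 < W by [].
  have zero : runs (cset d 0%R) s 10 (fun s' => frame d s s' /\ fmem s' (imem s 13 + d) = 0%R).
    exact: runs_cset.
  have [out _] := hin.
  pose ca := icost (cnexp a); pose cb := icost (cnexp b); pose cc := icost (cnexp c).
  apply: (@runs_le _ _ _ (((ca + 1).+1 + 2).+1 + (((cb + 1).+1 + 2).+1 + (((cc + 1).+1 + 2).+1 +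
    (ca + cb + cc + 100) * W)))); first by nia.
  have le10 x : 10 <= x + (ca + cb + cc + 100) * W by nia.
  apply: runs_if; rewrite [teval _ _]/= ieval_cnexp addn1; case: ifP => la; last first.
    rewrite out ?la //; apply: runs_weaken zero => //.
    by rewrite addnA le10.
  apply: runs_if; rewrite [teval _ _]/= ieval_cnexp addn1; case: ifP => lb; last first.
    rewrite out ?lb ?andbF //; apply: runs_weaken zero => //.
  apply: runs_if; rewrite [teval _ _]/= ieval_cnexp addn1; case: ifP => lc; last first.
    rewrite out ?lc ?andbF //; apply: runs_weaken zero => //.
    exact: (le10 0).
  exact: runs_cget.
- set W := (_ * _ + _).+1; have W1 : 0 < W by [].
  apply: (@runs_le _ _ _ ((icost (cnexp a) + icost (cnexp b)).+1 + (ecost e1 + ecost e2) * W)).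
    by nia.
  apply: runs_if; rewrite [teval _ _]/= !ieval_cnexp; case: ifP => _.
    by apply: runs_weaken (IH1 d s hin) => //; rewrite leq_mul2r leq_addr orbT.
  by apply: runs_weaken (IH2 d s hin) => //; rewrite leq_mul2r leq_addl orbT.
Qed.

Definition entries_loop e : prog F :=
  for_ 6 10 (for_ 7 11 (for_ 8 12
    (Seq (cent F 0 e) (ISet F (IConst 13) (IAdd (reg 13) (IConst 1)))))).

Definition arrays_loop e : prog F :=
  for_ 9 18 (Seq (entries_loop e) (ISet F (IConst 14) (IAdd (reg 14) (reg 19)))).

Section Loops.
Variables (d1 d2 d3 e1 e2 e3 q : nat) (inp outp : nat -> F).
Let sz := d1 * d2 * d3.
Let nin := q * sz.
Let E := e1 * e2 * e3.

(** The input pointer is at array t and r output entries are written. Outputs are collected above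
    all inputs, which thus stay readable to the end. *)
Record inv t r s : Prop := Inv {
  inv0 : imem s 0 = d1; inv1 : imem s 1 = d2; inv2 : imem s 2 = d3;
  inv10 : imem s 10 = e1; inv11 : imem s 11 = e2; inv12 : imem s 12 = e3;
  inv18 : imem s 18 = q; inv19 : imem s 19 = sz; inv20 : imem s 20 = nin;
  inv13 : imem s 13 = nin + r; inv14 : imem s 14 = t * sz;
  inv_in : forall a, a < nin -> fmem s a = inp a;
  inv_out : forall a, a < r -> fmem s (nin + a) = outp a }.

Definition pinned : seq nat := [:: 0; 1; 2; 10; 11; 12; 18; 19; 20; 13; 14].

Lemma inv_seti t r s x v : x \notin pinned -> inv t r s -> inv t r (seti s x v).
Proof.
rewrite !inE !negb_or ![x == _]eq_sym.
do 10![case/andP=> /negPf ?]; move=> /negPf ?.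
by case=> ? ? ? ? ? ? ? ? ? ? ? ? ?; split=> //=;
  repeat match goal with H : (_ == x) = false |- _ => rewrite H; clear H end.
Qed.

Variables (e : ent) (get : nat -> nat -> nat -> nat -> F).
Hypothesis get_out : forall t a b c, t < q ->
  ~~ [&& a < d1, b < d2 & c < d3] -> get t a b c = 0%R.
Hypothesis get_in : forall t a b c, t < q -> a < d1 -> b < d2 -> c < d3 ->
  inp (t * sz + ((a * d2 + b) * d3 + c)) = get t a b c.
Hypothesis outE : forall t i j k, t < q -> i < e1 -> j < e2 -> k < e3 ->
  outp (t * E + ((i * e2 + j) * e3 + k)) = eeval (get t) (entv d1 d2 d3 i j k) e.

Lemma index_bound a b c n m l : a < n -> b < m -> c < l ->
  (a * m + b) * l + c < n * m * l.
Proof.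
move=> la lb lc.
have h1 : a * m + b < n * m.
  by apply: leq_trans (leq_mul la (leqnn m)); rewrite mulSn addnC ltn_add2r.
by apply: leq_trans (leq_mul h1 (leqnn l)); rewrite mulSn addnC ltn_add2r.
Qed.

Let W := (d1 * d2 + d1).+1.

Lemma runs_entry t i j k s : t < q -> i < e1 -> j < e2 -> k < e3 ->
  inv t (t * E + ((i * e2 + j) * e3 + k)) s ->
  imem s 6 = i -> imem s 7 = j -> imem s 8 = k ->
  runs (Seq (cent F 0 e) (ISet F (IConst 13) (IAdd (reg 13) (IConst 1)))) s
    (ecost e * W + 6) (fun s' =>
    inv t (t * E + ((i * e2 + j) * e3 + k)).+1 s' /\
    forall r, r \notin 13 :: scratch -> imem s' r = imem s r).
Proof.
move=> ltt lti ltj ltk I s6 s7 s8.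
have hin : input_at (get t) s.
  split=> a b c; rewrite (inv0 I) (inv1 I) (inv2 I); first exact: get_out.
  move=> la lb lc; rewrite (inv14 I) (inv13 I).
  have lt_in : t * sz + ((a * d2 + b) * d3 + c) < nin.
    apply: leq_trans (leq_mul ltt (leqnn sz)).
    by rewrite mulSn addnC ltn_add2r index_bound.
  by rewrite (inv_in I) // get_in // ltn_addr.
have := runs_cent e 0 hin; rewrite (inv0 I) (inv1 I) -/W => run1.
apply: runs_seq; apply: runs_weaken (leqnn _) _ run1 => s1 [[r1 f1] v1].
apply: runs_iset => /=; split=> [|r]; last first.
  by rewrite inE negb_or => /andP[/negPf-> /r1].
have venvE : venv s = entv d1 d2 d3 i j k.
  by rewrite /venv (inv0 I) (inv1 I) (inv2 I) s6 s7 s8.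
have i13 := inv13 I.
split; rewrite /= ?r1 //; try by case: I.
- by rewrite i13 addn1 addnS.
- by move=> a lta; rewrite f1 ?(inv_in I) // addn0 i13 ltn_addr.
move=> a; rewrite ltnS leq_eqVlt => /orP[/eqP->|lta]; last first.
  by rewrite f1 ?(inv_out I) // addn0 i13 ltn_add2l.
by move: v1; rewrite addn0 i13 venvE outE.
Qed.

Definition entries_time : nat :=
  e1 * (e2 * (e3 * (ecost e * W + 6 + 13) + 10 + 13) + 10 + 13) + 10.

Lemma runs_entries t s : t < q -> inv t (t * E) s ->
  runs (entries_loop e) s entries_time (fun s' =>
    inv t (t.+1 * E) s' /\ imem s' 9 = imem s 9).
Proof.
move=> ltt I0.
apply: (@runs_for _ 6 10 e1 _ _ (fun i s' =>
    inv t (t * E + i * (e2 * e3)) s' /\ imem s' 9 = imem s 9)) => //.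
- exact: inv10 I0.
- by rewrite mul0n addn0; split=> //; apply: inv_seti.
- move=> i s1 lti s6 _ [I1 k9].
  apply: runs_weaken (leqnn _) _ (_ : runs _ _ _ (fun s' =>
     [/\ inv t (t * E + i.+1 * (e2 * e3)) s', imem s' 6 = i & imem s' 9 = imem s 9])).
    by move=> s' [I' h6 h9]; split=> //; [exact: inv10 I'|split=> //; apply: inv_seti].
  apply: (@runs_for _ 7 11 e2 _ _ (fun j s' => [/\ inv t (t * E + (i * (e2 * e3) + j * e3)) s',
     imem s' 6 = i & imem s' 9 = imem s 9])) => //.
  + exact: inv11 I1.
  + by rewrite mul0n addn0; split=> //; apply: inv_seti.
  + move=> j s2 ltj s7 _ [I2 h6 h9].
    apply: runs_weaken (leqnn _) _ (_ : runs _ _ _ (fun s' =>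
       [/\ inv t (t * E + (i * (e2 * e3) + j.+1 * e3)) s', imem s' 6 = i, imem s' 7 = j
         & imem s' 9 = imem s 9])).
      by move=> s' [I' g6 g7 g9]; split=> //; [exact: inv11 I'|split=> //; apply: inv_seti].
    apply: (@runs_for _ 8 12 e3 _ _ (fun k s' =>
       [/\ inv t (t * E + ((i * e2 + j) * e3 + k)) s', imem s' 6 = i, imem s' 7 = j
         & imem s' 9 = imem s 9])) => //.
    * exact: inv12 I2.
    * by rewrite addn0 mulnDl -mulnA; split=> //; apply: inv_seti.
    * move=> k s3 ltk s8 _ [I3 g6 g7 g9].
      apply: runs_weaken (leqnn _) _ (runs_entry ltt lti ltj ltk I3 g6 g7 s8).
      move=> s' [I' r']; rewrite !r' //; split=> //; first exact: inv12 I3.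
      by rewrite /= !r' //; split=> //; rewrite !addnS; apply: inv_seti.
    * move=> s3 _ [I3 g6 g7 g9]; split=> //.
      by move: I3; rewrite mulnDl -mulnA -addnA mulSn [e3 + _]addnC.
  + move=> s2 _ [I2 h6 h9]; split=> //.
    by move: I2; rewrite mulSn [e2 * e3 + _]addnC.
- by move=> s1 _ [I1 k9]; split=> //; move: I1; rewrite /E -mulnA mulSn addnC.
Qed.

Lemma runs_arrays s : inv 0 0 s ->
  runs (arrays_loop e) s (q * (entries_time + 7 + 13) + 10) (fun s' => inv q (q * E) s').
Proof.
move=> I0; apply: (@runs_for _ 9 18 q _ _ (fun t s' => inv t (t * E) s')) => //.
- exact: inv18 I0.
- by rewrite mul0n; apply: inv_seti.
- move=> t s1 ltt s9 _ I1; apply: runs_seq.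
  apply: runs_weaken (leqnn _) _ (runs_entries ltt I1) => s2 [I2 k9].
  apply: runs_iset => /=; split; rewrite ?k9 //; first exact: inv18 I2.
  apply: inv_seti => //; have i14 := inv14 I2; have i19 := inv19 I2.
  split; rewrite /= ?i14 ?i19; try by case: I2.
  by rewrite mulSn addnC.
Qed.

End Loops.

End Compile.

(** * Storage layout and correctness of the compiled program *)

Section Whole.
Variable F : fieldType.
Implicit Types (A : array F) (C : recipe).

Lemma size_flatten_uniform (T : Type) (m : nat) (ss : seq (seq T)) :
  all (fun x => size x == m) ss -> size (flatten ss) = size ss * m.
Proof.
by elim: ss => //= x ss IH /andP[/eqP sx /IH sss]; rewrite size_cat sx sss mulSn.
Qed.

Lemma nth_flatten_uniform (T : Type) (x0 : T) (m : nat) (ss : seq (seq T)) i r :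
  all (fun x => size x == m) ss -> r < m ->
  nth x0 (flatten ss) (i * m + r) = nth x0 (nth [::] ss i) r.
Proof.
elim: ss i => [|x ss IH] [|i] //=; rewrite ?nth_nil //; case/andP=> /eqP sx ass ltr.
  by rewrite mul0n add0n nth_cat sx ltr.
by rewrite nth_cat sx mulSn -addnA ltnNge leq_addr /= addKn IH.
Qed.

Lemma all_size_map (I T : Type) (f : I -> seq T) (r : seq I) m :
  (forall i, size (f i) = m) -> all (fun x => size x == m) [seq f i | i <- r].
Proof. by move=> sf; elim: r => //= i r ->; rewrite sf eqxx. Qed.

Lemma size_entries A : size (entries A) = dim1 A * dim2 A * dim3 A.
Proof.
have s3 i j : size [seq entry A (i, j, k) | k <- enum 'I_(dim3 A)] = dim3 A.
  by rewrite size_map size_enum_ord.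
have s2 i : size (flatten [seq [seq entry A (i, j, k) | k <- enum 'I_(dim3 A)]
      | j <- enum 'I_(dim2 A)]) = dim2 A * dim3 A.
  by rewrite (size_flatten_uniform (all_size_map _ (s3 i))) size_map size_enum_ord.
by rewrite (size_flatten_uniform (all_size_map _ s2)) size_map size_enum_ord mulnA.
Qed.

Lemma nth_entries A i j k : i < dim1 A -> j < dim2 A -> k < dim3 A ->
  nth 0%R (entries A) ((i * dim2 A + j) * dim3 A + k) = aget A i j k.
Proof.
move=> lti ltj ltk.
have s3 i' j' : size [seq entry A (i', j', k) | k <- enum 'I_(dim3 A)] = dim3 A.
  by rewrite size_map size_enum_ord.
have s2 i' : size (flatten [seq [seq entry A (i', j, k) | k <- enum 'I_(dim3 A)]
      | j <- enum 'I_(dim2 A)]) = dim2 A * dim3 A.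
  by rewrite (size_flatten_uniform (all_size_map _ (s3 i'))) size_map size_enum_ord.
have ltjk : j * dim3 A + k < dim2 A * dim3 A.
  by apply: leq_trans (leq_mul ltj (leqnn _)); rewrite mulSn addnC ltn_add2r.
rewrite mulnDl -addnA -mulnA (nth_flatten_uniform _ _ (all_size_map _ s2)) //.
rewrite (nth_map (Ordinal lti)) ?size_enum_ord //.
rewrite (nth_flatten_uniform _ _ (all_size_map _ (s3 _))) //.
rewrite (nth_map (Ordinal ltj)) ?size_enum_ord //.
rewrite (nth_map (Ordinal ltk)) ?size_enum_ord //.
have -> : nth (Ordinal lti) (enum 'I_(dim1 A)) i = Ordinal lti.
  by apply: val_inj; rewrite /= nth_enum_ord.
have -> : nth (Ordinal ltj) (enum 'I_(dim2 A)) j = Ordinal ltj.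
  by apply: val_inj; rewrite /= nth_enum_ord.
have -> : nth (Ordinal ltk) (enum 'I_(dim3 A)) k = Ordinal ltk.
  by apply: val_inj; rewrite /= nth_enum_ord.
by rewrite -aget_ord.
Qed.

Definition same_dims (d : nat * nat * nat) (s : seq (array F)) : bool :=
  all (fun A => dims A == d) s.

Lemma all_entries_size d1 d2 d3 s : same_dims (d1, d2, d3) s ->
  all (fun x => size x == d1 * d2 * d3) [seq entries A | A <- s].
Proof.
by elim: s => //= A s IH /andP[/eqP[h1 h2 h3] /IH->]; rewrite size_entries h1 h2 h3 eqxx.
Qed.

Definition compile (C : recipe) (q : nat) : prog F :=
  Seq (ISet F (IConst 10) (cnexp (rdim1 C)))
  (Seq (ISet F (IConst 11) (cnexp (rdim2 C)))
  (Seq (ISet F (IConst 12) (cnexp (rdim3 C)))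
  (Seq (ISet F (IConst 18) (IConst q))
  (Seq (ISet F (IConst 16) (IConst 0))
  (Seq (for_ 15 0 (ISet F (IConst 16) (IAdd (reg 16) (reg 1))))
  (Seq (ISet F (IConst 19) (IConst 0))
  (Seq (for_ 15 16 (ISet F (IConst 19) (IAdd (reg 19) (reg 2))))
  (Seq (ISet F (IConst 20) (IConst 0))
  (Seq (for_ 15 18 (ISet F (IConst 20) (IAdd (reg 20) (reg 19))))
  (Seq (ISet F (IConst 13) (reg 20))
  (Seq (ISet F (IConst 14) (IConst 0))
  (Seq (arrays_loop F (rent C))
  (Seq (ISet F (IConst 21) (ISub (reg 13) (reg 20)))
  (Seq (for_ 22 21 (FSet (reg 22) (FLoad F (IAdd (reg 20) (reg 22)))))
  (Seq (ISet F (IConst 0) (reg 10))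
  (Seq (ISet F (IConst 1) (reg 11))
  (Seq (ISet F (IConst 2) (reg 12))
  (Seq (ISet F (IConst 3) (reg 10))
  (Seq (ISet F (IConst 4) (reg 11))
       (ISet F (IConst 5) (reg 12))))))))))))))))))))).

Definition compile_time C (q d1 d2 e1 e2 e3 : nat) : nat :=
  icost (cnexp (rdim1 C)) + icost (cnexp (rdim2 C)) + icost (cnexp (rdim3 C)) + 120
  + d1 * 20 + d1 * d2 * 20 + q * 20
  + (q * (entries_time d1 d2 e1 e2 e3 (rent C) + 7 + 13) + 10)
  + q * (e1 * e2 * e3) * 22.

(** For at most two arrays all dimensions fit in registers 0 to 5. With a single array, registers 3
    to 5 lie beyond the output and may hold anything. *)
Lemma runs_compile C (s : seq (array F)) d1 d2 d3 :
  let v := dimv d1 d2 d3 in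
  let e1 := neval v (rdim1 C) in let e2 := neval v (rdim2 C) in
  let e3 := neval v (rdim3 C) in
  wf C -> same_dims (d1, d2, d3) s -> 0 < size s <= 2 ->
  runs (compile C (size s)) (initial_state s)
    (compile_time C (size s) d1 d2 e1 e2 e3)
    (fun st => stores st [seq build C A | A <- s]).
Proof.
move=> v e1 e2 e3 wfC sd /andP[q_gt0 q_le2]; set q := size s.
set s0 := initial_state s.
have d0 : (imem s0 0 = d1) * (imem s0 1 = d2) * (imem s0 2 = d3).
  by rewrite /s0; case: (s) sd q_gt0 => //= A s' /andP[/eqP[<- <- <-] _] _.
have evalE e st : dims_only e -> imem st 0 = d1 -> imem st 1 = d2 -> imem st 2 = d3 ->
    ieval st (cnexp e) = neval v e.
  move=> de h0 h1 h2; rewrite ieval_cnexp; apply: neval_dims_only => // -[|[|[|]]] //= _;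
  by rewrite ?h0 ?h1 ?h2.
have /and3P[w1 w2 w3] := wfC.
have sd' : same_dims (e1, e2, e3) [seq build C A | A <- s].
  rewrite /same_dims all_map; apply: sub_all sd => A /eqP[h1 h2 h3] /=.
  by rewrite /dims /= h1 h2 h3.
pose inp := nth 0%R (code_entries s).
have f0 : fmem s0 = inp by [].
clearbody s0.
pose outp := nth 0%R (code_entries [seq build C A | A <- s]).
have A0 : array F by case: (s) q_gt0 => [|A s'] // _; exact: A.
pose get t := aget (nth A0 s t).
have dimt t : t < q -> dims (nth A0 s t) = (d1, d2, d3).
  by move=> ltt; apply/eqP; exact: (all_nthP A0 sd).
have get_out t a b c : t < q -> ~~ [&& a < d1, b < d2 & c < d3] -> get t a b c = 0%R.
  by move=> /dimt[<- <- <-]; exact: aget_out.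
have nth_code (s1 : seq (array F)) f1 f2 f3 t r : same_dims (f1, f2, f3) s1 ->
    t < size s1 -> r < f1 * f2 * f3 ->
    nth 0%R (code_entries s1) (t * (f1 * f2 * f3) + r) = nth 0%R (entries (nth A0 s1 t)) r.
  move=> sd1 ltt ltr; rewrite (nth_flatten_uniform _ _ (all_entries_size sd1)) //.
  by rewrite (nth_map A0).
have get_in t a b c : t < q -> a < d1 -> b < d2 -> c < d3 ->
    inp (t * (d1 * d2 * d3) + ((a * d2 + b) * d3 + c)) = get t a b c.
  move=> ltt la lb lc; rewrite /inp nth_code ?index_bound // /get.
  by move: la lb lc; have [<- <- <-] := dimt t ltt => *; rewrite nth_entries.
have outE t i j k : t < q -> i < e1 -> j < e2 -> k < e3 ->
    outp (t * (e1 * e2 * e3) + ((i * e2 + j) * e3 + k)) =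
    eeval (get t) (entv d1 d2 d3 i j k) (rent C).
  move=> ltt li lj lk; rewrite /outp nth_code ?size_map ?index_bound // (nth_map A0) // /get.
  set A := nth A0 s t; have [h1 h2 h3] : dims A = (d1, d2, d3) := dimt t ltt.
  have [g1 g2 g3] : [/\ dim1 (build C A) = e1, dim2 (build C A) = e2 & dim3 (build C A) = e3].
    by rewrite /= h1 h2 h3.
  rewrite -[in LHS]g2 -[in LHS]g3 nth_entries ?g1 ?g2 ?g3 //.
  by rewrite aget_build g1 g2 g3 li lj lk h1 h2 h3.
pose sz := d1 * d2 * d3; pose E := e1 * e2 * e3.
apply: (@runs_le _ _ _ ((1 + icost (cnexp (rdim1 C))).+1 + ((1 + icost (cnexp (rdim2 C))).+1 +
  ((1 + icost (cnexp (rdim3 C))).+1 + (3 + (3 + ((d1 * 20 + 10) + (3 + ((d1 * d2 * 20 + 10) +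
  (3 + ((q * 20 + 10) + (4 + (3 + ((q * (entries_time d1 d2 e1 e2 e3 (rent C) + 7 + 13) + 10) +
  (7 + ((q * E * (9 + 13) + 10) + (4 + (4 + (4 + (4 + (4 + 4))))))))))))))))))))).
  by rewrite /compile_time -/q -/E; lia.
apply: runs_seq; apply: runs_iset; rewrite [ieval _ (IConst _)]/= evalE ?d0 // -/e1.
apply: runs_seq; apply: runs_iset; rewrite [ieval _ (IConst _)]/= evalE //= ?d0 // -/e2.
apply: runs_seq; apply: runs_iset; rewrite [ieval _ (IConst _)]/= evalE //= ?d0 // -/e3.
apply: runs_seq; apply: runs_iset; rewrite /=.
apply: runs_seq; apply: runs_iset; rewrite /=.
apply: runs_seq; apply: runs_acc => //= [|s1 r1 v1 f1]; first by rewrite d0.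
apply: runs_seq; apply: runs_iset; rewrite /=.
apply: runs_seq; apply: runs_acc => //= [|s2 r2 v2 f2].
  by rewrite v1 /= d0.
apply: runs_seq; apply: runs_iset; rewrite /=.
apply: runs_seq; apply: runs_acc => //= [|s3 r3 v3 f3].
  by rewrite r2 //= r1.
apply: runs_seq; apply: runs_iset; rewrite /=.
apply: runs_seq; apply: runs_iset; rewrite /=.
have v19 : imem s3 19 = sz by rewrite r3 //= v2 /= r1 //= d0 add0n.
have v20 : imem s3 20 = q * sz by rewrite v3 /= v2 /= r1 //= d0 !add0n.
set s4 := seti _ 14 _.
have I4 : inv d1 d2 d3 e1 e2 e3 q inp outp 0 0 s4.
  have eqr r : r \notin [:: 13; 14; 15; 16; 19; 20] -> imem s4 r = imem s1 r.
    rewrite !inE !negb_or => /and5P[n13 n14 n15 n16 /andP[n19 n20]].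
    by rewrite /= (negPf n14) (negPf n13) r3 //= (negPf n20) r2 //= (negPf n19).
  split; try by rewrite eqr // r1 //= ?d0.
  - by rewrite /= v19.
  - by rewrite /= v20.
  - by rewrite /= v20 addn0.
  - by [].
  - by move=> a _; rewrite /= f3 /= f2 /= f1 /= f0.
  - by [].
apply: runs_seq.
apply: runs_weaken (leqnn _) _ (runs_arrays get_out get_in outE I4) => s5 I5.
apply: runs_seq; apply: runs_iset; rewrite /= (inv13 I5) (inv20 I5) addKn -/E.
(* Source and target of this copy may overlap. Round i writes cell i, and the later rounds read only
   cells above [q * sz + i]. *)
apply: runs_seq; apply: (@runs_for _ 22 21 (q * E) _ 9 (fun i s' =>
  [/\ forall r, r != 22 -> imem s' r = imem (seti s5 21 (q * E)) r,
      forall a, a < i -> fmem s' a = outp a &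
      forall a, i <= a < q * E -> fmem s' (q * sz + a) = outp a])) => //=.
- split=> //= [r /negPf-> //|a lta].
  exact: (inv_out I5).
- move=> i s6 lti x6 b6 [r6 lo hi]; apply: runs_fset => /=.
  rewrite x6 (r6 20) //= (inv20 I5) hi ?leqnn //; split=> //; split=> //=.
  + by move=> r nr; rewrite (negPf nr) r6.
  + by move=> a; rewrite ltnS leq_eqVlt => /orP[/eqP->|lta]; rewrite ?eqxx // (ltn_eqF lta) lo.
  + move=> a /andP[lta lta']; rewrite gtn_eqF ?hi ?(ltnW lta) //.
    by rewrite (leq_trans lta) // leq_addl.
move=> s6 _ [r6 lo _].
do 5![apply: runs_seq; apply: runs_iset; rewrite /=].
apply: runs_iset => /=; rewrite !r6 //= (inv10 I5) (inv11 I5) (inv12 I5).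
have sout : size (code_entries [seq build C A | A <- s]) = q * E.
  by rewrite (size_flatten_uniform (all_entries_size sd')) !size_map.
split; last first.
  apply: (@eq_from_nth _ 0%R); rewrite size_map size_iota // => r ltr.
  by rewrite (nth_map 0) ?size_iota // nth_iota // add0n lo // -sout.
rewrite /code_dims.
move: (s) sd q_gt0 q_le2 => [|A [|B [|? ?]]] //= /andP[/eqP[h1 h2 h3] sB] _ _;
  rewrite h1 h2 h3 //.
by case/andP: sB => /eqP[-> -> ->].
Qed.

End Whole.

(** * Polynomial bounds on the running time *)

Fixpoint nsize (e : nexp) : nat :=
  match e with
  | NVar _ => 1
  | NConst n => n
  | NAdd a b => nsize a + nsize b
  | NSub a _ => nsize a
  end.

(** Index expressions are affine, and truncated subtraction only decreases the value; this linearity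
    also yields the linear length bound. *)
Lemma neval_le v M e : 0 < M -> (forall x, v x <= M) -> neval v e <= nsize e * M.
Proof.
move=> M_gt0 leM; elim: e => [x|n|a IHa b IHb|a IHa b IHb] /=.
- by rewrite mul1n.
- by rewrite leq_pmulr.
- by rewrite mulnDl leq_add.
- exact: leq_trans (leq_subr _ _) IHa.
Qed.

Lemma dimv_le d1 d2 d3 x : dimv d1 d2 d3 x <= (d1 + d2 + d3).+1.
Proof. by rewrite /dimv; move: x => [|[|[|x]]] /=; rewrite ?nth_nil //; lia. Qed.

Definition dsize (C : recipe) : nat := nsize (rdim1 C) + nsize (rdim2 C) + nsize (rdim3 C).

Definition time_const (C : recipe) (q : nat) : nat :=
  (icost (cnexp (rdim1 C)) + icost (cnexp (rdim2 C)) + icost (cnexp (rdim3 C)) + 180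
   + q * (2 * ecost (rent C) + 150)) * (dsize C).+1 ^ 5.

Lemma absorb a b X n : 0 < X -> a * X ^ n + b <= (a + b) * X ^ n.
Proof. by move=> X_gt0; rewrite mulnDl leq_add2l leq_pmulr // expn_gt0 X_gt0. Qed.

(** Degree 5 arises from at most [X ^ 3] output entries, each computed with address loops of order
    [X ^ 2]. *)
Lemma compile_time_le C q d1 d2 d3 (v := dimv d1 d2 d3) :
  compile_time C q d1 d2 (neval v (rdim1 C)) (neval v (rdim2 C)) (neval v (rdim3 C))
  <= time_const C q * (d1 + d2 + d3).+1 ^ 5.
Proof.
set L := (d1 + d2 + d3).+1; set e1 := neval _ _; set e2 := neval _ _.
set e3 := neval _ _; pose X := (dsize C).+1 * L.
have X_gt0 : 0 < X by [].
have leL : L <= X by rewrite leq_pmull.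
have le_e e : nsize e <= dsize C -> neval v e <= X.
  move=> le; apply: leq_trans (neval_le e (isT : 0 < L) (dimv_le d1 d2 d3)) _.
  by rewrite leq_mul2r (leq_trans le) ?orbT.
have l1 : e1 <= X by apply: le_e; rewrite /dsize -addnA leq_addr.
have l2 : e2 <= X by apply: le_e; rewrite /dsize addnAC leq_addl.
have l3 : e3 <= X by apply: le_e; rewrite /dsize leq_addl.
have ld1 : d1 <= X by apply: leq_trans leL; rewrite /L; lia.
have ld2 : d2 <= X by apply: leq_trans leL; rewrite /L; lia.
have ld12 : d1 * d2 <= X ^ 2 by rewrite expnS expn1 leq_mul.
have lW : (d1 * d2 + d1).+1 <= 2 * X ^ 2.
  have lt1 : d1 < L by rewrite /L; lia.
  rewrite mul2n -addnn -addnS leq_add //.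
  by apply: leq_trans (leq_trans lt1 leL) _; rewrite -{1}[X]expn1 leq_pexp2l.
set c := ecost (rent C).
have t1 : entries_time d1 d2 e1 e2 e3 (rent C) <= (2 * c + 75) * X ^ 5.
  rewrite /entries_time -/c.
  have s1 : c * (d1 * d2 + d1).+1 + 6 + 13 <= (2 * c + 19) * X ^ 2.
    apply: leq_trans (absorb _ _ _ X_gt0); rewrite -addnA leq_add2r.
    by rewrite (mulnC 2 c) -mulnA leq_mul2l lW orbT.
  have s2 : e3 * (c * (d1 * d2 + d1).+1 + 6 + 13) + 10 + 13 <= (2 * c + 42) * X ^ 3.
    rewrite (_ : 42 = 19 + 23) // addnA; apply: leq_trans (absorb _ _ _ X_gt0).
    rewrite -addnA leq_add2r expnS mulnCA; exact: leq_mul.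
  have s3 : e2 * (e3 * (c * (d1 * d2 + d1).+1 + 6 + 13) + 10 + 13) + 10 + 13 <= (2 * c + 65) * X ^ 4.
    rewrite (_ : 65 = 42 + 23) // addnA; apply: leq_trans (absorb _ _ _ X_gt0).
    rewrite -addnA leq_add2r expnS mulnCA; exact: leq_mul.
  rewrite (_ : 75 = 65 + 10) // addnA; apply: leq_trans (absorb _ _ _ X_gt0).
  by rewrite leq_add2r expnS mulnCA; exact: leq_mul.
have p n : n <= 5 -> X ^ n <= X ^ 5 by move=> le5; rewrite leq_pexp2l.
have lE : e1 * e2 * e3 <= X ^ 5.
  apply: leq_trans (p 3 isT); rewrite !expnS expn0 muln1 mulnA.
  by rewrite !leq_mul.
have ld1' : d1 <= X ^ 5 by apply: leq_trans (p 1 isT); rewrite expn1.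
have ld12' : d1 * d2 <= X ^ 5 by apply: leq_trans (p 2 isT).
have one : 1 <= X ^ 5 by rewrite expn_gt0.
rewrite [X in _ <= X * _]/time_const -[X in _ <= X]mulnA -expnMn /compile_time -/c.
rewrite -[_ * L]/X.
have q1 : q * (entries_time d1 d2 e1 e2 e3 (rent C) + 7 + 13) <= q * (2 * c + 95) * X ^ 5.
  rewrite -mulnA leq_mul2l -addnA (leq_trans _ (_ : (2 * c + 75) * X ^ 5 + 20 <= _)) ?orbT //.
    by rewrite leq_add2r.
  by rewrite (_ : 95 = 75 + 20) // addnA absorb.
have q2 : q * (e1 * e2 * e3) <= q * X ^ 5 by rewrite leq_mul2l lE orbT.
have q3 : q <= q * X ^ 5 by rewrite leq_pmulr.
move: (X ^ 5) q1 q2 q3 ld1' ld12' one => Y.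
move: (entries_time _ _ _ _ _ _) => et.
move: (icost (cnexp (rdim1 C)) + _ + _) => cc.
move=> q1 q2 q3 h1 h2 one.
have cY : cc <= cc * Y by rewrite leq_pmulr.
have -> : (cc + 180 + q * (2 * c + 150)) * Y =
    cc * Y + 180 * Y + (q * (2 * c + 95) * Y + 55 * (q * Y)).
  rewrite (_ : 150 = 95 + 55) // addnA mulnDr !mulnDl; congr (_ + (_ + _)).
  by rewrite (mulnC q 55) mulnA.
lia.
Qed.

(** The bound [len (f A) <= c * len A] admits no additive constant, so an array of length 0, to
    which a recipe could adjoin marks, is returned as it is. *)
Definition full (F : fieldType) (C : recipe) (A : array F) : array F :=
  if len A == 0 then A else build C A.

Definition full_prog (F : fieldType) (C : recipe) (q : nat) : prog F :=
  If (ILe F (IAdd (reg 0) (IAdd (reg 1) (reg 2))) (IConst 0))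
    (Skip F) (compile F C q).

Definition full_const (C : recipe) (q : nat) : nat := time_const C q + 20.

Lemma stores_initial (F : fieldType) (s : seq (array F)) : stores (initial_state s) s.
Proof. by split; rewrite -[RHS](mkseq_nth 0%R) ?/mkseq //= -[RHS](mkseq_nth 0). Qed.

Lemma full_computes (F : fieldType) C (s : seq (array F)) (A : array F) : wf C ->
  0 < size s <= 2 -> same_dims (dims A) s ->
  computes_within (full_prog F C (size s))
    (full_const C (size s) * (len A).+1 ^ full_const C (size s)) s
    [seq full C B | B <- s].
Proof.
move=> wfC sz2 sd; rewrite /dims in sd.
have d0 : (imem (initial_state s) 0 = dim1 A) * (imem (initial_state s) 1 = dim2 A) *
    (imem (initial_state s) 2 = dim3 A).
  by case: s sd sz2 => //= B s' /andP[/eqP[<- <- <-] _] _.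
have lenE B : dims B = dims A -> len B = len A by case=> h1 h2 h3; rewrite /len h1 h2 h3.
have run := runs_compile wfC sd sz2; have st0 := stores_initial s.
rewrite /computes_within; move: (initial_state s) d0 run st0 => s0 d0 run st0.
suff : runs (full_prog F C (size s)) s0 (10 + (time_const C (size s) * (len A).+1 ^ 5 + 1))
    (fun st => stores st [seq full C B | B <- s]).
  case=> t [st [ex le_t st_s]]; exists t, st; split=> //; apply: leq_trans le_t _.
  have le5 : (len A).+1 ^ 5 <= (len A).+1 ^ full_const C (size s).
    by rewrite leq_pexp2l // /full_const addnC.
  rewrite (_ : 10 + _ = time_const C (size s) * (len A).+1 ^ 5 + 11); last by lia.
  apply: leq_trans (absorb _ _ _ (isT : 0 < (len A).+1)) _; apply: leq_mul => //.
  by rewrite /full_const leq_add2l.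
apply: runs_if; rewrite [teval _ _]/= !d0 addnA -/(len A) leqn0; case: ifP => [l0|ln0].
  exists 1, s0; split; [exact: ExecSkip|by rewrite addn1|].
  have -> : [seq full C B | B <- s] = s; last exact: st0.
  elim: (s) sd => //= B s' IH /andP[/eqP dB /IH->].
  by rewrite /full lenE // l0.
have -> : [seq full C B | B <- s] = [seq build C B | B <- s].
  elim: (s) sd => //= B s' IH /andP[/eqP dB /IH->].
  by rewrite /full lenE // ln0.
apply: runs_le run.
apply: leq_trans (compile_time_le _ _ _ _ _) _.
by rewrite leq_addr.
Qed.

(** * The reductions *)

Definition reduces (i j : tensor_action) (C : recipe) : Prop :=
  wf C /\ forall (F : fieldType) (A : array F), compatible i A ->
    compatible j (build C A) /\
    forall B, compatible i B -> dims A = dims B ->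
      (same_orbit i A B <-> same_orbit j (build C A) (build C B)).

Lemma dims_build (F : fieldType) C (A B : array F) :
  dims A = dims B -> dims (build C A) = dims (build C B).
Proof. by case=> h1 h2 h3; rewrite /dims /= h1 h2 h3. Qed.

Lemma dims_only_subst (s : nat -> nexp) e :
  (forall x, x < 3 -> dims_only (s x)) -> dims_only e -> dims_only (nsubst s e).
Proof.
move=> ds; elim: e => [x|//|a IHa b IHb|a IHa b IHb] /=; first exact: ds.
  by case/andP=> /IHa-> /IHb->.
by case/andP=> /IHa-> /IHb->.
Qed.

Lemma wf_compose C2 C1 : wf C2 -> wf C1 -> wf (compose C2 C1).
Proof.
case/and3P=> w1 w2 w3 /and3P[v1 v2 v3].
by apply/and3P; split; apply: dims_only_subst => // -[|[|[|]]].
Qed.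

Lemma reduces_compose i j k C1 C2 :
  reduces i j C1 -> reduces j k C2 -> reduces i k (compose C2 C1).
Proof.
case=> w1 r1 [w2 r2]; split; first exact: wf_compose.
move=> F A cA; have [cA1 o1] := r1 F A cA; have [cA2 o2] := r2 F _ cA1.
rewrite build_compose //; split=> // B cB eqd; rewrite build_compose //.
have [cB1 _] := r1 F B cB.
by rewrite o1 // o2 //; apply: dims_build.
Qed.

Definition rid : recipe :=
  Recipe (NVar 0) (NVar 1) (NVar 2) (EGet (NVar 3) (NVar 4) (NVar 5)).

Lemma build_rid (F : fieldType) (A : array F) : build rid A = A.
Proof. by case: A => n m l A; rewrite /build /= ntens_aget. Qed.

Lemma reduces_id : reduces Act1 Act1 rid.
Proof. by split=> // F A _; split=> // B _ _; rewrite !build_rid. Qed.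

Lemma reduces21 : reduces Act2 Act1 r21.
Proof.
split=> // F [n m l A] /= /eqP eqm; subst m; split=> // -[n' m' l' B] /= /eqP eqm.
by subst m' => -[en _ el]; subst n' l'; rewrite !build21; exact: red21.
Qed.

Lemma reduces32 : reduces Act3 Act2 r32.
Proof.
split=> // F [n m l A] /= /eqP eqm; subst m; split=> // -[n' m' l' B] /= /eqP eqm.
by subst m' => -[en _ el]; subst n' l'; rewrite !build32; exact: red32.
Qed.

Lemma reduces42 : reduces Act4 Act2 r42.
Proof.
split=> // F [n m l A] /= /andP[/eqP em /eqP el]; subst m l; split=> // -[n' m' l' B] /=.
by case/andP=> /eqP em /eqP el; subst m' l' => -[en _ _]; subst n'; rewrite !build42; exact: red42.
Qed.

Lemma reduces52 : reduces Act5 Act2 r52.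
Proof.
split=> // F [n m l A] /= /andP[/eqP em /eqP el]; subst m l; split=> // -[n' m' l' B] /=.
by case/andP=> /eqP em /eqP el; subst m' l' => -[en _ _]; subst n'; rewrite !build52; exact: red52.
Qed.

Lemma reduces12 b : reduces Act1 Act2 (r12 b).
Proof.
split=> // F [n m l A] _; split=> [|[n' m' l' B] _ [en em el]]; first by rewrite /= eqxx.
by subst n' m' l'; rewrite !build12; exact: red12.
Qed.

Lemma reduces13 : reduces Act1 Act3 r13.
Proof.
split=> // F [n m l A] _; split=> [|[n' m' l' B] _ [en em el]]; first by rewrite /= eqxx.
by subst n' m' l'; rewrite !build13; exact: red13.
Qed.

Lemma reduces15a : reduces Act1 Act5 r15a.
Proof.
split=> // F [n m l A] _; split=> [|[n' m' l' B] _ [en em el]]; first by rewrite /= eqxx.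
by subst n' m' l'; rewrite !build15a; exact: red15a.
Qed.

Lemma reduces15l : reduces Act1 Act5 r15l.
Proof.
split=> // F [n m l A] _; split=> [|[n' m' l' B] _ [en em el]]; first by rewrite /= eqxx.
by subst n' m' l'; rewrite !build15l; exact: red15l.
Qed.

Lemma reduces24 b : reduces Act2 Act4 (r24 b).
Proof.
split=> // F [n m l A] /= /eqP eqm; subst m; split=> [|[n' m' l' B] /= /eqP eqm].
  by rewrite /= !eqxx.
by subst m' => -[en _ el]; subst n' l'; rewrite !build24; exact: red24.
Qed.

Definition source (i : tensor_action) : recipe :=
  match i with
  | Act1 => rid
  | Act2 => r21
  | Act3 => compose r21 r32
  | Act4 => compose r21 r42
  | Act5 => compose r21 r52
  end.

(* The boolean chooses the symmetric or associative (false), respectively the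
   skew-symmetric, anti-symmetric or Lie variant (true). *)
Definition target (b : bool) (j : tensor_action) : recipe :=
  match j with
  | Act1 => rid
  | Act2 => r12 b
  | Act3 => r13
  | Act4 => compose (r24 b) (r12 b)
  | Act5 => if b then r15l else r15a
  end.

Definition through (b : bool) (i j : tensor_action) : recipe :=
  compose (target b j) (source i).

Lemma reduces_source i : reduces i Act1 (source i).
Proof.
case: i; [exact: reduces_id | exact: reduces21 | | |];
  apply: reduces_compose reduces21.
- exact: reduces32.
- exact: reduces42.
- exact: reduces52.
Qed.

Lemma reduces_target b j : reduces Act1 j (target b j).
Proof.
case: j => /=; [exact: reduces_id | exact: reduces12 | exact: reduces13 | |].
  by apply: reduces_compose (reduces24 b); apply: reduces12.
by case: b; [exact: reduces15l | exact: reduces15a].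
Qed.

Lemma reduces_through b i j : reduces i j (through b i j).
Proof. exact: reduces_compose (reduces_source i) (reduces_target b j). Qed.

Lemma same_orbit_empty (F : fieldType) i (A B : array F) :
  len A = 0 -> len B = 0 -> same_orbit i A B.
Proof.
have lenE (C : array F) : len C = 0 -> [/\ dim1 C = 0, dim2 C = 0 & dim3 C = 0].
  by rewrite /len; split; lia.
move=> /lenE[h1 h2 h3] /lenE[g1 g2 g3].
case: A h1 h2 h3 => n m l A /= n0 m0 l0; case: B g1 g2 g3 => n' m' l' B /= n0' m0' l0'.
subst n m l n' m' l'.
have -> : B = A by apply/ffunP => -[[[]]].
case: i.
- exact: same_orbit1_refl.
- by apply/same_orbit2P; exists 1%:M%R, 1%:M%R; rewrite !unitmx1; split=> // x y; rewrite !mulmx1.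
- apply/same_orbit3P; exists 1%:M%R, 1%:M%R; rewrite !unitmx1; split=> // x y.
  by rewrite invmx1 trmx1 !mulmx1.
- by apply/same_orbit4P; exists 1%:M%R; rewrite ?unitmx1 // => x y; rewrite trmx1 !mulmx1.
- by apply/same_orbit5P; exists 1%:M%R; rewrite ?unitmx1 // => x y; rewrite invmx1 !mulmx1.
Qed.

Lemma compatible_empty (F : fieldType) i (A : array F) : len A = 0 -> compatible i A.
Proof.
have e0 (x y : nat) : x + y = 0 -> x = 0 /\ y = 0 by lia.
rewrite /len => /e0[/e0[h1 h2] h3].
by case: i; rewrite /= ?h1 ?h2 ?h3.
Qed.

Lemma len_dims (F : fieldType) (A B : array F) : dims A = dims B -> len A = len B.
Proof. by case=> h1 h2 h3; rewrite /len h1 h2 h3. Qed.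

(** The dimensions are bounded in terms of [len A + 1], which is at most twice a nonzero length. *)
Lemma len_build (F : fieldType) C (A : array F) :
  len A != 0 -> len (build C A) <= 2 * dsize C * len A.
Proof.
move=> ln0; set L := (len A).+1.
have le_e e : neval (dimv (dim1 A) (dim2 A) (dim3 A)) e <= nsize e * L.
  by apply: neval_le => // x; apply: dimv_le.
apply: (@leq_trans (dsize C * L)).
  by rewrite /len /dsize /= !mulnDl !leq_add.
rewrite mulnC mulnAC leq_mul2r /L; apply/orP; right; rewrite -lt0n in ln0; lia.
Qed.

Definition red_const (C : recipe) : nat := full_const C 1 + full_const C 2 + 2 * dsize C + 1.

Lemma bound_mono c c' L : c <= c' -> c * L.+1 ^ c <= c' * L.+1 ^ c'.
Proof. by move=> le; rewrite leq_mul // leq_pexp2l. Qed.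

Lemma full_reduction (F : fieldType) C i j c : reduces i j C -> red_const C <= c ->
  linear_length_reduction c i j (@full F C).
Proof.
case=> wfC red le_c; split.
- exists (full_prog F C 1) => A _.
  have [||t [st [ex le_t sts]]] := @full_computes F C [:: A] A wfC => //.
    by rewrite /same_dims /= eqxx.
  exists t, st; split=> //; apply: leq_trans le_t _; apply: bound_mono.
  by apply: leq_trans le_c; rewrite /red_const /=; lia.
- move=> A cA; rewrite /full; case: eqP => [l0|/eqP ln0].
    by rewrite l0 compatible_empty.
  have [cj _] := red F A cA; split=> //; apply: leq_trans (len_build C ln0) _.
  by rewrite leq_mul2r (leq_trans _ le_c) ?orbT // /red_const; lia.
- move=> A B cA cB eqd; rewrite /full -(len_dims eqd); case: eqP => [l0|_].
    split=> //; split=> _; apply: same_orbit_empty => //; by rewrite -(len_dims eqd).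
  by have [_ o] := red F A cA; split; [exact: dims_build|exact: o].
Qed.

Lemma full_reduction_into (F : fieldType) C i j c (Q : array F -> Prop) :
  reduces i j C -> red_const C <= c ->
  (forall A : array F, len A = 0 -> Q A) -> (forall A : array F, Q (build C A)) ->
  linear_length_reduction_into c i j Q.
Proof.
move=> red le_c Q0 QC; exists (full C); first exact: full_reduction.
by move=> A _; rewrite /full; case: eqP => [/Q0|].
Qed.

(** * Membership of the constructed arrays in the special classes *)

Section Classes.
Variable F : fieldType.

Lemma array0P (A : array F) : len A = 0 -> exists A0 : tensor F 0 0 0, A = Array A0.
Proof.
have e0 (x y : nat) : x + y = 0 -> x = 0 /\ y = 0 by lia.
by case: A => n m l A; rewrite /len /= => /e0[/e0[? ?] ?]; subst n m l; exists A.
Qed.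

Lemma build12_sym b (A : array F) : exists n l (T : tensor F n n l),
  build (r12 b) A = Array T /\
  forall x y, (bilin T y x = (-1) ^+ b *: bilin T x y)%R.
Proof.
case: A => n m l A; eexists _, _, _; split; first exact: build12.
by move=> x y; rewrite !bilin12 f12_sym.
Qed.

Lemma sign_entry b n l (T : tensor F n n l) :
  (forall x y, bilin T y x = (-1) ^+ b *: bilin T x y)%R ->
  forall k, ((frontal_slice T k)^T = (-1) ^+ b *: frontal_slice T k)%R.
Proof.
move=> symT k; apply/matrixP => i j; rewrite !mxE -!bilin_delta symT.
by rewrite mxE.
Qed.

Lemma symmetric12 (A : array F) : symmetric_slices (build (r12 false) A).
Proof.
have [n [l [T [-> symT]]]] := build12_sym false A; constructor => k.
by rewrite (sign_entry symT) scale1r.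
Qed.

Lemma skew_symmetric12 (A : array F) : skew_symmetric_slices (build (r12 true) A).
Proof.
have [n [l [T [-> symT]]]] := build12_sym true A; constructor => k.
by rewrite (sign_entry symT) expr1 scaleN1r.
Qed.

(** Invariance under rotation carries the sign of one transposition to all three, and every
    permutation is a product of transpositions. *)
Lemma entry3_sign b n (T : tensor F n n n) :
  (forall i j k, T (j, i, k) = (-1) ^+ b * T (i, j, k) /\ T (j, k, i) = T (i, j, k))%R ->
  forall (s : 'S_3) (x : 'I_3 -> 'I_n),
    (entry3 T (x \o s) = ((-1) ^+ b) ^+ s * entry3 T x)%R.
Proof.
move=> symT; set e := ((-1) ^+ b)%R.
have ee : (e * e = 1)%R by rewrite -expr2 sqrr_sign.
have i0 : inord 0 = Ordinal (isT : 0 < 3) by apply: val_inj; rewrite /= inordK.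
have i1 : inord 1 = Ordinal (isT : 1 < 3) by apply: val_inj; rewrite /= inordK.
have i2 : inord 2 = Ordinal (isT : 2 < 3) by apply: val_inj; rewrite /= inordK.
have rot i j k : T (j, k, i) = T (i, j, k) by have [] := symT i j k.
have swap01 i j k : T (j, i, k) = (e * T (i, j, k))%R by have [] := symT i j k.
have swap12 i j k : T (i, k, j) = (e * T (i, j, k))%R by rewrite rot swap01.
have swap02 i j k : T (k, j, i) = (e * T (i, j, k))%R by rewrite rot swap12.
have transp i j : i != j -> forall x : 'I_3 -> 'I_n,
    entry3 T (x \o tperm i j) = (e * entry3 T x)%R.
  have ordE (o : 'I_3) : [\/ o = inord 0, o = inord 1 | o = inord 2].
    rewrite i0 i1 i2; case: o => [[|[|[|//]]] lt3].
    - by constructor 1; apply: val_inj.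
    - by constructor 2; apply: val_inj.
    - by constructor 3; apply: val_inj.
  move=> + x; rewrite /entry3 /= !permE /=.
  case: (ordE i) => ->; case: (ordE j) => ->; rewrite i0 i1 i2 //= => _;
    first [exact: swap01 | exact: swap02 | exact: swap12].
move=> s; have [ts -> dts] := prod_tpermP s.
elim: ts dts => [_|[i j] ts IH /= /andP[nij /IH {}IH]] x.
  by rewrite big_nil odd_perm1 mul1r /entry3 /= !perm1.
rewrite big_cons /=; set p := (\prod_(t <- ts) _)%g in IH *.
have -> : entry3 T (x \o (tperm i j * p)%g) = entry3 T ((x \o p) \o tperm i j).
  by rewrite /entry3 /= !permM.
rewrite transp // IH odd_permM odd_tperm nij mulrA; congr (_ * _)%R.
by case: (odd_perm p); rewrite /= ?expr1 ?mulr1 // ee.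
Qed.

Lemma build24_sign b (A : array F) : exists n (T : tensor F n n n),
  build (compose (r24 b) (r12 b)) A = Array T /\
  forall (s : 'S_3) (x : 'I_3 -> 'I_n),
    (entry3 T (x \o s) = ((-1) ^+ b) ^+ s * entry3 T x)%R.
Proof.
rewrite build_compose //; have [n [l [T [-> symT]]]] := build12_sym b A.
by eexists _, _; split; [exact: build24|apply/entry3_sign/t24_sym].
Qed.

Lemma symmetric24 (A : array F) :
  symmetric_array (build (compose (r24 false) (r12 false)) A).
Proof.
have [n [T [-> symT]]] := build24_sign false A; constructor => s x.
by rewrite symT expr0 expr1n mul1r.
Qed.

Lemma antisymmetric24 (A : array F) :
  antisymmetric_array (build (compose (r24 true) (r12 true)) A).
Proof. by have [n [T [-> symT]]] := build24_sign true A; constructor => s x. Qed.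

Lemma associative15 (A : array F) : associative_algebra (build r15a A).
Proof. by case: A => n m l A; rewrite build15a; constructor; apply: assoc15a. Qed.

Lemma lie15 (A : array F) : lie_algebra (build r15l A).
Proof.
case: A => n m l A; rewrite build15l.
by constructor; [exact: lie15l_alt|exact: lie15l_jacobi].
Qed.

End Classes.

Definition sum_actions (g : tensor_action -> nat) : nat :=
  g Act1 + g Act2 + g Act3 + g Act4 + g Act5.

Lemma leq_sum_actions g i : g i <= sum_actions g.
Proof. by rewrite /sum_actions; case: i; lia. Qed.

Lemma through_into b i j (F : fieldType) c (Q : array F -> Prop) :
  red_const (through b i j) <= c -> (forall A : array F, len A = 0 -> Q A) ->
  (forall A : array F, Q (build (target b j) A)) ->
  linear_length_reduction_into c i j Q.
Proof.
move=> le_c Q0 QC; apply: full_reduction_into (reduces_through b i j) le_c Q0 _ => A.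
by have [[ws _] [wt _]] := (reduces_source i, reduces_target b j); rewrite build_compose.
Qed.

(** The polynomial-time program serves again, run on two arrays: [L + 1 <= 2 ^ L <= #|F| ^ L] turns
    the polynomial bound into the exponential one. *)
Lemma exptime_through (F : finFieldType) i j c :
  red_const (through false i j) <= c -> exptime_reducible F c i j.
Proof.
move=> le_c; set C := through false i j.
have [wfC red] := reduces_through false i j.
have [_ clen corb] := @full_reduction F C i j _ (reduces_through false i j) (leqnn _).
exists (fun x => (full C x.1, full C x.2)); split=> [|[A B] /and3P[/= cA cB /eqP eqd]].
  exists (full_prog F C 2) => -[A B] /and3P[/= cA cB /eqP eqd].
  have [||t [st [ex le_t sts]]] := @full_computes F C [:: A; B] A wfC => //.
    by rewrite /same_dims /= -eqd !eqxx.
  exists t, st; split=> //; apply: leq_trans le_t _.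
  have le2 : full_const C 2 <= c by apply: leq_trans le_c; rewrite /red_const -/C; lia.
  apply: leq_trans (bound_mono (len A) le2) _; rewrite leq_mul2l mulnC expnM.
  apply/orP; right; rewrite leq_exp2r; last by apply: leq_trans le_c; rewrite /red_const; lia.
  apply: leq_trans (ltn_expl (len A) (isT : 1 < 2)) _.
  have [->|lA] := posnP (len A); first by rewrite !expn0.
  by rewrite leq_exp2r // card_finNzRing_gt1.
have [[cjA _] [cjB _]] := (clen A cA, clen B cB).
have [eqd' orb] := corb A B cA cB eqd.
by split=> //; rewrite /orbit_instance /= cjA cjB eqd' eqxx.
Qed.

Theorem theorem1p10 :
  (forall i j : tensor_action, i <> j ->
     exists c : nat, forall F : fieldType,
       [/\ exists f : array F -> array F, linear_length_reduction c i j f,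
           j = Act2 ->
             linear_length_reduction_into c i j (@symmetric_slices F) /\
             linear_length_reduction_into c i j (@skew_symmetric_slices F),
           j = Act4 ->
             linear_length_reduction_into c i j (@symmetric_array F) /\
             linear_length_reduction_into c i j (@antisymmetric_array F)
         & j = Act5 ->
             linear_length_reduction_into c i j (@associative_algebra F) /\
             linear_length_reduction_into c i j (@lie_algebra F)]) /\
  (exists c : nat, forall (F : finFieldType) (i j : tensor_action),
     exptime_reducible F c i j).
Proof.
split=> [i j _|].
  (* The constant is computed from the recipes, which do not mention the field; summing covers both
     variants. *)
  exists (red_const (through false i j) + red_const (through true i j)) => F.
  have le0 := leq_addr (red_const (through true i j)) (red_const (through false i j)).
  have le1 := leq_addl (red_const (through false i j)) (red_const (through true i j)).
  move: (_ + _) le0 le1 => c le0 le1; split.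
  - by exists (full (through false i j)); apply: full_reduction le0; apply: reduces_through.
  - move=> ej; subst j; split.
      apply: (through_into le0) => [A /array0P[A0 ->]|A]; last exact: symmetric12.
      by constructor; case.
    apply: (through_into le1) => [A /array0P[A0 ->]|A]; last exact: skew_symmetric12.
    by constructor; case.
  - move=> ej; subst j; split.
      apply: (through_into le0) => [A /array0P[A0 ->]|A]; last exact: symmetric24.
      by constructor => s x; case: (x ord0).
    apply: (through_into le1) => [A /array0P[A0 ->]|A]; last exact: antisymmetric24.
    by constructor => s x; case: (x ord0).
  move=> ej; subst j; split.
    apply: (through_into le0) => [A /array0P[A0 ->]|A]; last exact: associative15.
    by constructor => x y z; apply/rowP; case.
  apply: (through_into le1) => [A /array0P[A0 ->]|A]; last exact: lie15.
  by constructor=> [x|x y z]; apply/rowP; case.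
exists (sum_actions (fun i => sum_actions (fun j => red_const (through false i j)))).
move=> F i j; apply: exptime_through.
apply: leq_trans (leq_sum_actions (fun i => sum_actions _) i).
exact: leq_sum_actions (fun j => red_const (through false i j)) j.
Qed.
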